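(* Let $\Omega$ be a regular domain. (1) $\Omega$ has the Bessel property for $L^{2,1}_c(\Omega)$ if and only if it has the Bessel property for the Bergman space $\mathscr A(\Omega)$. Also, $C_B(\Omega)=C_{B,\mathscr A}(\Omega)$. (2) $\Omega$ has the interpolation property for $L^{2,1}_c(\Omega)$ if and only if it has the interpolation property for $\mathscr A(\Omega)$. Also, $C_I(\Omega)=C_{I,\mathscr A}(\Omega)$.
   Context: $\mathbb D=\{z\in\mathbb C:|z|<1\}$. Regular domain: $\Omega=\mathbb D\setminus\bigcup_j B_j$, where $\{B_j\}$ is a countable (infinite or finite) family of pairwise disjoint compact subsets of $\mathbb D$, called holes, such that each $B_j$ is connected, does not separate the plane, and is the closure of a domain with smooth boundary, and the $B_j$ accumulate only to $\partial\mathbb D$ (every compact subset of $\mathbb D$ meets only finitely many $B_j$). For each $j$ let $\gamma_j\subset\Omega$ be a smooth closed curve winding once in the positive direction around $B_j$ and not winding around the other holes. $L^{2,1}_c(\Omega)$ is the Hilbert space of real differential $1$-forms $\omega=\omega_x dx+\omega_y dy$ on $\Omega$ with $\omega_x,\omega_y\in L^2(\Omega)$ that are closed, $d\omega=0$ in the sense of distributions; $\|\omega\|^2=\int_\Omega(\omega_x^2+\omega_y^2)\,d\lambda_2$. $\mathrm{Per}_j(\omega)=\int_{\gamma_j}\omega$ for smooth closed $L^2$-forms, extended by continuity to $L^{2,1}_c(\Omega)$; $\mathrm{Per}\,\omega=\{\mathrm{Per}_j\omega\}_j$. Bessel property for $L^{2,1}_c(\Omega)$: $\mathrm{Per}:L^{2,1}_c(\Omega)\to\ell^2$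 (real $\ell^2$) is bounded; $C_B(\Omega)$ is its norm. Interpolation property for $L^{2,1}_c(\Omega)$: there is $C<+\infty$ such that every $a\in\ell^2$ equals $\mathrm{Per}\,\omega$ for some $\omega$ with $\|\omega\|\le C\|a\|_{\ell^2}$; $C_I(\Omega)$ is the least such $C$. $\mathscr A(\Omega)$ is the unweighted Bergman space of analytic $f:\Omega\to\mathbb C$ with $\|f\|^2_{\mathscr A(\Omega)}=\int_\Omega|f|^2\,d\lambda_2<+\infty$. The Bessel and interpolation properties for $\mathscr A(\Omega)$ and the constants $C_{B,\mathscr A}(\Omega)$, $C_{I,\mathscr A}(\Omega)$ are defined in the same way for the operator $f\mapsto\{\int_{\gamma_j}f(\zeta)\,d\zeta\}_j$ from $\mathscr A(\Omega)$ to the space $\ell^2_{\mathbb C}$ of complex square-summable sequences. A constant is $+\infty$ if the corresponding property fails. *)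

(* Defs.v *)
From mathcomp Require Import all_boot all_order all_algebra complex.
From mathcomp Require Import all_classical all_reals all_analysis.

Set Implicit Arguments.
Unset Strict Implicit.
Unset Printing Implicit Defensive.

Import Order.TTheory GRing.Theory Num.Theory numFieldNormedType.Exports.

Local Open Scope classical_set_scope.
Local Open Scope complex_scope.
Local Open Scope ring_scope.

(* Subsets of the plane, their topology and their measure live in [R * R];
   analytic functions live on [R[i]], and [toC] identifies the two. *)

Section Plane.
Context {R : realType}.
Implicit Types (U : set (R * R)) (f : R * R -> R).

Definition toC (p : R * R) : R[i] := p.1 +i* p.2.

Definition lambda2 := (@lebesgue_measure R \x @lebesgue_measure R)%E.

Definition unit_disc : set (R * R) := [set p | p.1 ^+ 2 + p.2 ^+ 2 < 1].

Definition dx f : R * R -> R := 'D_((1, 0) : R * R) f.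
Definition dy f : R * R -> R := 'D_((0, 1) : R * R) f.

(* f is of class C^k on the open set U; values off U are irrelevant. *)
Fixpoint Ck_on U (k : nat) f : Prop :=
  match k with
  | 0 => forall p, U p -> {for p, continuous f}
  | k'.+1 => [/\ forall p, U p -> differentiable f p,
                 Ck_on U k' (dx f) & Ck_on U k' (dy f)]
  end.

Definition smooth_on U f := forall k, Ck_on U k f.

Definition plane_domain U := [/\ open U, connected U & U !=set0].

(* Near each boundary point, U is a sublevel set of a smooth function without
   critical point there (so U lies locally on one side of its boundary). *)
Definition smooth_boundary U := forall p, (closure U `\` U) p ->
  exists (V : set (R * R)) (rho : R * R -> R),
    [/\ open V, V p, smooth_on V rho, (dx rho p, dy rho p) <> (0, 0)
      & U `&` V = [set q | rho q < 0] `&` V].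

End Plane.

Section Curves.
Context {R : realType}.
Implicit Types (g : R -> R * R).

(* Closed curves are 1-periodic maps, run through once over [0, 1]. *)
Definition smooth_closed_curve g :=
  (forall t, g (t + 1) = g t) /\
  (forall n t, derivable (derive1n n (fun s => (g s).1)) t 1 /\
               derivable (derive1n n (fun s => (g s).2)) t 1).

Definition velocity g (t : R) : R * R :=
  (derive1 (fun s => (g s).1) t, derive1 (fun s => (g s).2) t).

Definition line_integral g (w : (R * R -> R) * (R * R -> R)) : R :=
  \int[lebesgue_measure]_(t in `[0, 1])
    (w.1 (g t) * (velocity g t).1 + w.2 (g t) * (velocity g t).2).

Definition complex_line_integral g (f : R[i] -> R[i]) : R[i] :=
  (\int[lebesgue_measure]_(t in `[0, 1])
     complex.Re (f (toC (g t)) * toC (velocity g t)))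
  +i*
  (\int[lebesgue_measure]_(t in `[0, 1])
     complex.Im (f (toC (g t)) * toC (velocity g t))).

Definition winding_number g (p : R * R) : R[i] :=
  complex_line_integral g (fun z => (z - toC p)^-1) / (0 +i* (2 * pi)).

End Curves.

Section RegularDomain.
Context {R : realType} {I : countType}.
Implicit Types (B : I -> set (R * R)) (gamma : I -> R -> R * R).

Definition is_hole (K : set (R * R)) :=
  [/\ compact K, K `<=` unit_disc, connected K, connected (~` K)
    & exists2 U, plane_domain U & smooth_boundary U /\ K = closure U].

Definition regular_holes B :=
  [/\ forall j, is_hole (B j),
      trivIset setT B
    & forall K, compact K -> K `<=` unit_disc ->
        finite_set [set j | K `&` B j !=set0]].

Definition holed_disc B : set (R * R) := unit_disc `\` \bigcup_j B j.

Definition hole_curves B gamma := forall j,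
  [/\ smooth_closed_curve (gamma j),
      forall t, holed_disc B (gamma j t),
      forall p, B j p -> winding_number (gamma j) p = 1
    & forall k p, k != j -> B k p -> winding_number (gamma j) p = 0].

End RegularDomain.

Section Forms.
Context {R : realType}.
Variable Omega : set (R * R).

(* (w.1, w.2) stands for the 1-form w.1 dx + w.2 dy; elements of L^2 are
   represented by functions on the plane, only their restriction to Omega
   being relevant. *)
Definition form := ((R * R -> R) * (R * R -> R))%type.
Implicit Types w : form.

Definition test_function (phi : R * R -> R) :=
  [/\ smooth_on setT phi, compact (closure [set p | phi p != 0])
    & closure [set p | phi p != 0] `<=` Omega].

Definition weakly_closed w := forall phi, test_function phi ->
  \int[lambda2]_(p in Omega) (w.1 p * dy phi p - w.2 p * dx phi p) = 0.

Definition L2_on (f : R * R -> R) :=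
  measurable_fun Omega f /\
  (\int[lambda2]_(p in Omega) (f p ^+ 2)%:E < +oo)%E.

Definition L21c : set form :=
  [set w | [/\ L2_on w.1, L2_on w.2 & weakly_closed w]].

Definition form_norm w : R :=
  Num.sqrt (\int[lambda2]_(p in Omega) (w.1 p ^+ 2 + w.2 p ^+ 2)).

Definition form_sub w1 w2 : form :=
  (fun p => w1.1 p - w2.1 p, fun p => w1.2 p - w2.2 p).

Definition smooth_form w := smooth_on Omega w.1 /\ smooth_on Omega w.2.

(* Extension by continuity of w |-> line_integral g w from the smooth elements
   of L21c to L21c: the limit of the integrals along any sequence of smooth
   closed L^2 forms converging to w in norm. *)
Definition period (g : R -> R * R) w : R :=
  xget 0 [set l | exists eta : nat -> form,
    [/\ forall n, L21c (eta n) /\ smooth_form (eta n),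
        form_norm (form_sub (eta n) w) @[n --> \oo] --> (0 : R)
      & line_integral g (eta n) @[n --> \oo] --> l]].

Definition bergman : set (R[i] -> R[i]) :=
  [set f | (forall p, Omega p -> @derivable R[i] R[i]^o R[i]^o f (toC p) 1) /\
           (\int[lambda2]_(p in Omega)
              (Normc.normc (f (toC p)) ^+ 2)%:E < +oo)%E].

Definition bergman_norm (f : R[i] -> R[i]) : R :=
  Num.sqrt (\int[lambda2]_(p in Omega) Normc.normc (f (toC p)) ^+ 2).

End Forms.

(* Bessel and interpolation properties of an operator T from a space S, with
   norm N, to the space l^2 of K-valued families, where K has modulus absK.
   The constants are +oo when no bound exists (infimum of the empty set);
   requiring 0 <= C only matters when I is empty. *)
Section BesselInterpolation.
Context {R : realType} {I : countType} {K X : Type}.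
Variables (absK : K -> R) (S : set X) (N : X -> R) (T : X -> I -> K).

Definition ell2 : set (I -> K) :=
  [set a | (\esum_(j in setT) (absK (a j) ^+ 2)%:E < +oo)%E].

Definition ell2_norm (a : I -> K) : R :=
  Num.sqrt (fine (\esum_(j in setT) (absK (a j) ^+ 2)%:E)%E).

Definition bessel_bound (C : R) :=
  0 <= C /\ forall x, S x -> ell2 (T x) /\ ell2_norm (T x) <= C * N x.

Definition bessel := exists C, bessel_bound C.

Definition bessel_constant : \bar R := ereal_inf (EFin @` bessel_bound).

Definition interpolation_bound (C : R) :=
  0 <= C /\ forall a, ell2 a ->
    exists x, [/\ S x, T x = a & N x <= C * ell2_norm a].

Definition interpolation := exists C, interpolation_bound C.

Definition interpolation_constant : \bar R :=
  ereal_inf (EFin @` interpolation_bound).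

End BesselInterpolation.

Section Constants.
Context {R : realType} {I : countType}.
Variables (B : I -> set (R * R)) (gamma : I -> R -> R * R).
Let Omega := holed_disc B.

Definition Per (w : form) : I -> R := fun j => period Omega (gamma j) w.

Definition PerA (f : R[i] -> R[i]) : I -> R[i] :=
  fun j => complex_line_integral (gamma j) f.

Let absR (x : R) : R := `|x|.

Definition bessel_L := bessel absR (L21c Omega) (form_norm Omega) Per.
Definition C_B := bessel_constant absR (L21c Omega) (form_norm Omega) Per.
Definition interpolation_L :=
  interpolation absR (L21c Omega) (form_norm Omega) Per.
Definition C_I :=
  interpolation_constant absR (L21c Omega) (form_norm Omega) Per.

Let absC : R[i] -> R := @Normc.normc R.

Definition bessel_A := bessel absC (bergman Omega) (bergman_norm Omega) PerA.
Definition C_BA :=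
  bessel_constant absC (bergman Omega) (bergman_norm Omega) PerA.
Definition interpolation_A :=
  interpolation absC (bergman Omega) (bergman_norm Omega) PerA.
Definition C_IA :=
  interpolation_constant absC (bergman Omega) (bergman_norm Omega) PerA.

End Constants.

(* Main.v *)
(* The real part of [f dz] and the real part of [i f dz] turn an analytic [f] into
   a closed and coclosed form [w] and its rotation [star w]; the periods of [f] are
   those of [w] and, up to sign, of [star w].  Pairing with the current of
   integration along gamma_j, mollified inside Omega, represents the j-th period of
   a closed L^2 form by the scalar product with a form J_j, and [star J_j] is closed
   with zero periods.  Let K be the orthogonal complement, in the closed forms, of
   those without periods.  By Weyl's lemma a form of K is [Re (f dz)] with f
   analytic; since [star J_j] is orthogonal to K, the rotation of a form of K has no
   periods.  So K is orthogonal to [star K], the f obtained from K have real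
   periods, and every admissible bound for one space transfers to the other: split f
   along K and [star K] in one direction, project onto K in the other.  Neither the
   winding numbers nor the shape of the holes intervene. *)
Require Import Defs.
From HB Require Import structures.
From mathcomp Require Import all_boot all_order all_algebra complex.
From mathcomp Require Import all_classical all_reals all_analysis.
From mathcomp Require Import measurable_realfun ring lra.

Set Implicit Arguments.
Unset Strict Implicit.
Unset Printing Implicit Defensive.

Import Order.TTheory GRing.Theory Num.Theory numFieldNormedType.Exports.

Local Open Scope classical_set_scope.
Local Open Scope ring_scope.

(** * Partial derivatives in the plane *)

(** One kernel carries the analysis: the field [v / |v|^2], cut off at two scales, is curl-free and
    its divergence is the difference of two mollifiers. Paired with a closed and coclosed form, it
    shows that mollification does not depend on the scale (Weyl's lemma). Integrated over the plane,
    it shows that all mollifiers have the same mass. Convolved along a closed curve, it shows that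
    two mollified currents differ by the rotated gradient of a test function. Hence a period equals,
    and is not just a limit of, a scalar product with one smooth form, up to the constant [mass].
    The periods of [star J_j] vanish for a global reason: over the whole plane the mollifier may be
    spread until the current, of size O(s), disappears. Two obstacles shape the rest. Analytic
    functions are only assumed complex differentiable, so that closedness of [f dz] requires a
    divergence theorem without continuous partial derivatives. And [period] is a choice among limits
    along smooth forms, so that smooth closed forms must first be proved dense. *)

Section PlaneCalculus.
Context {R : realType}.
Implicit Types (F G : R * R -> R) (z h : R * R).

Definition lin2 (a b : R) (h : R * R) : R := a * h.1 + b * h.2.

Lemma lin2_is_linear a b : linear (lin2 a b).
Proof. by move=> k u v; rewrite /lin2 /= /GRing.scale /=; ring. Qed.

HB.instance Definition _ a b :=
  GRing.isLinear.Build R (R * R)%type R *:%R (lin2 a b) (lin2_is_linear a b).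

Lemma lin2_continuous a b : continuous (lin2 a b).
Proof.
move=> z; apply: cvgD; apply: cvgM; try exact: cvg_cst.
  exact: cvg_fst.
exact: cvg_snd.
Qed.

Lemma diff2_eps F z a b :
  (forall e, 0 < e -> exists2 d, 0 < d & forall h, `|h| < d ->
     `|F (z + h) - F z - lin2 a b h| <= e * `|h|) ->
  differentiable F z /\ 'd F z = lin2 a b :> (R * R -> R).
Proof.
move=> H.
have E : (F : (R * R)%type -> R^o) \o shift z = cst (F z) + lin2 a b +o_ (0 : (R * R)%type) id.
  apply/eqaddoP => _/posnumP[e].
  have [d d0 Hd] := H _ [gt0 of e%:num].
  near=> h.
  have hd : `|h| < d.
    near: h; apply/nbhs_ballP; exists d => //= y.
    by rewrite -ball_normE /= sub0r normrN.
  have := Hd h hd.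
  rewrite [X in _ -> `|X| <= _](_ : _ = F (z + h) - F z - lin2 a b h)//.
  by rewrite -addrA -opprD [z + h]addrC.
have D := diff_unique (@lin2_continuous a b) E.
split => //; apply/diff_locallyP; split; rewrite D//; exact: lin2_continuous.
Unshelve. all: by end_near. Qed.

Lemma diff2_dx F z : differentiable F z -> dx F z = 'd F z (1, 0).
Proof. by move=> dF; rewrite /dx deriveE. Qed.

Lemma diff2_dy F z : differentiable F z -> dy F z = 'd F z (0, 1).
Proof. by move=> dF; rewrite /dy deriveE. Qed.

Lemma diff2_lin F z h : differentiable F z -> 'd F z h = lin2 (dx F z) (dy F z) h.
Proof.
move=> dF; rewrite diff2_dx// diff2_dy// /lin2.
have -> : h = h.1 *: ((1, 0) : R * R) + h.2 *: ((0, 1) : R * R).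
  by case: h => h1 h2; congr (_, _); rewrite /=; rewrite /GRing.scale /=; ring.
by rewrite linearD !linearZ /= /GRing.scale /=; ring.
Qed.

Lemma eps_diff2 F z : differentiable F z ->
  forall e, 0 < e -> exists2 d, 0 < d & forall h, `|h| < d ->
     `|F (z + h) - F z - lin2 (dx F z) (dy F z) h| <= e * `|h|.
Proof.
move=> dF e e0; have [_] := (iffLR (diff_locallyP _ _)) dF.
move=> /eqaddoP/(_ e e0) /nbhs_ballP[d /= d0 Hd].
exists d => // h hd; have := Hd h; rewrite -ball_normE /= sub0r normrN => /(_ hd).
rewrite [X in `|X| <= _ -> _](_ : _ = F (z + h) - F z - 'd F z h)//.
  by rewrite diff2_lin.
by rewrite -addrA -opprD [z + h]addrC.
Qed.

(** Packs differentiability and the two partial derivatives into a single estimate, so that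
    locality, reflections and complex derivatives are treated by inequalities. *)
Lemma diff2P F z a b :
  (differentiable F z /\ (dx F z = a /\ dy F z = b)) <->
  (forall e, 0 < e -> exists2 d, 0 < d & forall h, `|h| < d ->
     `|F (z + h) - F z - lin2 a b h| <= e * `|h|).
Proof.
split=> [[dF [<- <-]]|H]; first exact: eps_diff2.
have [dF E] := diff2_eps H; split => //.
by rewrite diff2_dx// diff2_dy// E /lin2 /=; split; ring.
Qed.

(** The form suited to convolutions: a quadratic remainder with an explicit constant can be
    integrated, an unquantified [o(|h|)] cannot. *)
Lemma quadratic_diff2 F z a b (M : R) :
  (forall h, `|F (z + h) - F z - lin2 a b h| <= M * `|h| ^+ 2) ->
  differentiable F z /\ (dx F z = a /\ dy F z = b).
Proof.
move=> H; apply/diff2P => e e0; exists (e / (`|M| + 1)).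
  by rewrite divr_gt0// ltr_wpDl.
move=> h; rewrite ltr_pdivlMr ?ltr_wpDl// => he; apply: (le_trans (H h)).
rewrite expr2 mulrA; apply: ler_wpM2r => //.
apply: le_trans (ltW he); rewrite mulrC ler_wpM2l//.
by rewrite (le_trans (ler_norm M))// lerDl.
Qed.

End PlaneCalculus.

Section PartialDerivatives.
Context {R : realType}.
Implicit Types (F G : R * R -> R) (z h : R * R) (U V : set (R * R)).

(** Total differentiability is included because the chain rule along a curve fails for mere partial
    derivatives. The values are arguments, so that a proof computes them by composing lemmas. *)
Definition has_partials F z a b :=
  differentiable F z /\ (dx F z = a /\ dy F z = b).

Lemma has_partials_diff F z :
  differentiable F z -> has_partials F z (dx F z) (dy F z).
Proof. by []. Qed.

Lemma has_partials_is_derive F z a b : has_partials F z a b ->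
  is_derive z (1, 0) F a /\ is_derive z (0, 1) F b.
Proof. by move=> [dF [<- <-]]; split; apply/derivableP/diff_derivable. Qed.

Lemma has_partials_cst (c : R) z : has_partials (cst c) z 0 0.
Proof. by split=> //; rewrite /dx /dy !derive_cst. Qed.

Lemma has_partials_lin2 a b z : has_partials (lin2 a b) z a b.
Proof.
apply/diff2P => e e0; exists 1 => // h _.
by rewrite linearD [lin2 a b z + _]addrC addrK subrr normr0 mulr_ge0// ltW.
Qed.

Lemma has_partials_fst z : has_partials fst z 1 0.
Proof.
rewrite (_ : fst = lin2 1 0); first exact: has_partials_lin2.
by apply/funext => p; rewrite /lin2 mul1r mul0r addr0.
Qed.

Lemma has_partials_snd z : has_partials snd z 0 1.
Proof.
rewrite (_ : snd = lin2 0 1); first exact: has_partials_lin2.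
by apply/funext => p; rewrite /lin2 mul1r mul0r add0r.
Qed.

Lemma has_partialsD F G z a b c d : has_partials F z a b ->
  has_partials G z c d -> has_partials (F \+ G) z (a + c) (b + d).
Proof.
move=> [dF [<- <-]] [dG [<- <-]]; split; first exact: differentiableD.
by rewrite /dx /dy !deriveD//; apply: diff_derivable.
Qed.

Lemma has_partialsN F z a b :
  has_partials F z a b -> has_partials (\- F) z (- a) (- b).
Proof.
move=> [dF [<- <-]]; split; first exact: differentiableN.
by rewrite /dx /dy !deriveN//; apply: diff_derivable.
Qed.

Lemma has_partialsB F G z a b c d : has_partials F z a b ->
  has_partials G z c d -> has_partials (F \- G) z (a - c) (b - d).
Proof. by move=> hF hG; apply: has_partialsD hF (has_partialsN hG). Qed.

Lemma has_partialsM F G z a b c d : has_partials F z a b ->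
  has_partials G z c d ->
  has_partials (F \* G) z (F z * c + G z * a) (F z * d + G z * b).
Proof.
move=> [dF [<- <-]] [dG [<- <-]]; split; first exact: differentiableM.
by rewrite /dx /dy !deriveM//; apply: diff_derivable.
Qed.

Lemma has_partials_comp (f : R -> R) (F : R * R -> R) z a b (df : R) :
  is_derive (F z) 1 f df -> has_partials F z a b ->
  has_partials (f \o F) z (df * a) (df * b).
Proof.
move=> [f1 f2] [dF [<- <-]].
have df' := (iffLR (derivable1_diffP _ _)) f1.
have D : differentiable (f \o F) z by apply: differentiable_comp.
have E : 'd (f \o F) z = 'd f (F z) \o 'd F z :> (R * R -> R) by exact: diff_comp.
split => //; rewrite (diff2_dx D) (diff2_dy D) (diff2_dx dF) (diff2_dy dF) E /=.
by rewrite (deriv1E f1) derive1E f2 ![df * _]mulrC.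
Qed.

Lemma near_has_partials F G z a b : (\near z, F z = G z) ->
  has_partials F z a b -> has_partials G z a b.
Proof.
move=> FG /diff2P H; apply/diff2P => e /H[d d0 Hd].
have /nbhs_ballP[r /= r0 Hr] := FG.
exists (Num.min d r); first by rewrite lt_min d0.
move=> h; rewrite lt_min => /andP[hd hr].
rewrite -(Hr z (ballxx _ r0)) -Hr ?Hd//.
by rewrite -ball_normE /= opprD addNKr normrN.
Qed.

Lemma has_partials_continuous F z a b :
  has_partials F z a b -> {for z, continuous F}.
Proof. by move=> [dF _]; apply: differentiable_continuous. Qed.

Lemma open_near_eq U F G z : open U -> {in U, F =1 G} -> U z ->
  \near z, F z = G z.
Proof.
move=> oU FG Uz; have : nbhs z U by apply: open_nbhs_nbhs.
by apply: filterS => y Uy; apply/FG/mem_set.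
Qed.

(** The derivatives are limits in the whole plane; on an open set equality of functions is equality
    near each point and passes to them. *)
Lemma Ck_on_eq U k F G : open U -> {in U, F =1 G} -> Ck_on U k F -> Ck_on U k G.
Proof.
move=> oU; elim: k F G => [|k IH] F G FG /=.
  move=> cF p Up; have E := open_near_eq oU FG Up.
  have : F @ p --> F p by exact: cF.
  by rewrite /prop_for /continuous_at -(FG p (mem_set Up)); apply: cvg_trans; exact: near_eq_cvg.
move=> [dF cx cy].
have H p : U p -> has_partials G p (dx F p) (dy F p).
  by move=> Up; apply: near_has_partials (open_near_eq oU FG Up) _; split=> //; exact: dF.
split; first by move=> p /H[].
- by apply: IH cx => p /set_mem/H[_ []].
- by apply: IH cy => p /set_mem/H[_ []].
Qed.

Lemma Ck_on_partials U k F a b : open U ->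
  (forall z, U z -> has_partials F z (a z) (b z)) ->
  Ck_on U k a -> Ck_on U k b -> Ck_on U k.+1 F.
Proof.
move=> oU dF ca cb; split; first by move=> p /dF[].
- by apply: Ck_on_eq ca => // p /set_mem/dF[_ []].
- by apply: Ck_on_eq cb => // p /set_mem/dF[_ []].
Qed.

Lemma Ck_on_pred U k F : Ck_on U k.+1 F -> Ck_on U k F.
Proof.
elim: k F => [|k IH] F [dF cx cy].
  by move=> p Up; apply/differentiable_continuous/dF.
by split; [exact: dF | exact: (IH _ cx) | exact: (IH _ cy)].
Qed.

Lemma Ck_on_sub U V k F : U `<=` V -> Ck_on V k F -> Ck_on U k F.
Proof.
move=> UV; elim: k F => [|k IH] F /=; first by move=> h p /UV/h.
by move=> [h1 h2 h3]; split; [move=> p /UV/h1 | exact: (IH _ h2) | exact: (IH _ h3)].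
Qed.

(** [Ck_on] is a conjunction over the points of the set, so [V] may be any set containing [p]. *)
Lemma Ck_on_local U k F :
  (forall p, U p -> exists2 V, V p & Ck_on V k F) -> Ck_on U k F.
Proof.
elim: k F => [|k IH] F /= H; first by move=> p /H[V Vp]; exact.
split.
- by move=> p /H[V Vp [dF _ _]]; exact: dF.
- by apply: IH => p /H[V Vp [_ c _]]; exists V.
- by apply: IH => p /H[V Vp [_ _ c]]; exists V.
Qed.

Lemma Ck_on_cst U k (c : R) : open U -> Ck_on U k (cst c).
Proof.
move=> oU; elim: k c => [|k IH] c; first by move=> p _; exact: cst_continuous.
by apply: (@Ck_on_partials _ _ _ (cst 0) (cst 0)) => // z _; exact: has_partials_cst.
Qed.

Lemma Ck_on_fst U k : open U -> Ck_on U k fst.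
Proof.
move=> oU; case: k => [|k]; first by move=> p _; apply: cvg_fst.
apply: (@Ck_on_partials _ _ _ (cst 1) (cst 0)) => //; try exact: Ck_on_cst.
by move=> z _; exact: has_partials_fst.
Qed.

Lemma Ck_on_snd U k : open U -> Ck_on U k snd.
Proof.
move=> oU; case: k => [|k]; first by move=> p _; apply: cvg_snd.
apply: (@Ck_on_partials _ _ _ (cst 0) (cst 1)) => //; try exact: Ck_on_cst.
by move=> z _; exact: has_partials_snd.
Qed.

Lemma Ck_onD U k F G : open U -> Ck_on U k F -> Ck_on U k G -> Ck_on U k (F \+ G).
Proof.
move=> oU; elim: k F G => [|k IH] F G.
  by move=> hF hG p Up; apply: cvgD; [exact: hF|exact: hG].
move=> [dF Fx Fy] [dG Gx Gy].
apply: (@Ck_on_partials _ _ _ (dx F \+ dx G) (dy F \+ dy G)) => //; try exact: IH.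
by move=> z Uz; apply: has_partialsD; split => //; [exact: dF|exact: dG].
Qed.

Lemma Ck_onM U k F G : open U -> Ck_on U k F -> Ck_on U k G -> Ck_on U k (F \* G).
Proof.
move=> oU; elim: k F G => [|k IH] F G.
  by move=> hF hG p Up; apply: cvgM; [exact: hF|exact: hG].
move=> cF cG; have pF := Ck_on_pred cF; have pG := Ck_on_pred cG.
move: cF cG => [dF Fx Fy] [dG Gx Gy].
apply: (@Ck_on_partials _ _ _ ((F \* dx G) \+ (G \* dx F))
                              ((F \* dy G) \+ (G \* dy F))) => //;
  try by apply: Ck_onD => //; exact: IH.
by move=> z Uz; apply: has_partialsM; split => //; [exact: dF|exact: dG].
Qed.

Lemma Ck_onN U k F : open U -> Ck_on U k F -> Ck_on U k (\- F).
Proof.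
move=> oU cF; have := Ck_onM oU (Ck_on_cst k (-1) oU) cF.
by apply: Ck_on_eq => // p _ /=; rewrite mulN1r.
Qed.

Lemma Ck_onB U k F G : open U -> Ck_on U k F -> Ck_on U k G -> Ck_on U k (F \- G).
Proof. by move=> oU cF cG; apply: Ck_onD => //; exact: Ck_onN. Qed.

Lemma Ck_onV U k F : open U -> (forall p, U p -> F p != 0) ->
  Ck_on U k F -> Ck_on U k (fun p => (F p)^-1).
Proof.
move=> oU F0; elim: k => [|k IH].
  by move=> cF p Up; apply: cvgV; [exact: F0|exact: cF].
move=> cF; have := IH (Ck_on_pred cF); set iF := (fun _ => _) => ciF.
move: cF => [dF Fx Fy].
have H (a : R * R -> R) : Ck_on U k a -> Ck_on U k (\- (iF \* iF \* a)).
  by move=> ca; apply: Ck_onN => //; apply: Ck_onM => //; exact: Ck_onM.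
apply: (@Ck_on_partials _ _ _ _ _ oU _ (H _ Fx) (H _ Fy)) => z Uz /=.
have := @has_partials_comp (fun x : R => x^-1) F z (dx F z) (dy F z) (- (F z) ^- 2 *: 1).
rewrite /GRing.scale /= mulr1 !mulNr expr2 invfM; apply.
  apply: DeriveDef; first by apply: (@derivableV _ _ id); [exact: F0|exact: derivable_id].
  rewrite (@deriveV _ _ id)//; first by rewrite derive_id /GRing.scale /= mulr1 expr2 invfM.
  exact: F0.
by apply: has_partials_diff; exact: dF.
Qed.

(** Derivatives never leave the family, so the order can be raised indefinitely. Applied to
    convolutions and to reflected functions, whose partial derivatives have the same shape. *)
Lemma smooth_partials (A : set (R * R -> R)) U F : open U ->
  (forall f, A f -> exists a b, [/\ A a, A b &
     forall z, U z -> has_partials f z (a z) (b z)]) ->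
  A F -> smooth_on U F.
Proof.
move=> oU HA AF k; elim: k F AF => [|k IH] F /HA[a [b [Aa Ab H]]].
  by move=> p /H/has_partials_continuous.
by apply: (@Ck_on_partials _ _ _ a b) => //; exact: IH.
Qed.

Lemma smooth_dx U F : smooth_on U F -> smooth_on U (dx F).
Proof. by move=> sF k; have [] := sF k.+1. Qed.

Lemma smooth_dy U F : smooth_on U F -> smooth_on U (dy F).
Proof. by move=> sF k; have [] := sF k.+1. Qed.

Lemma smooth_diff U F z : smooth_on U F -> U z -> differentiable F z.
Proof. by move=> /(_ 1%N)[+ _ _]; apply. Qed.

Lemma smooth_continuous U F z : smooth_on U F -> U z -> {for z, continuous F}.
Proof. by move=> /(_ 0%N); apply. Qed.

End PartialDerivatives.

Opaque dx dy.

(** * Test functions *)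

Section TestFunctions.
Context {R : realType}.
Implicit Types (F phi : R * R -> R) (z h : R * R) (U Omega : set (R * R)).

Definition box z (r : R) : set (R * R) := [set q | `|q - z| <= r].

Lemma boxE z r :
  box z r = `[z.1 - r, z.1 + r] `*` `[z.2 - r, z.2 + r].
Proof.
apply/seteqP; split => q; rewrite /box /= prod_normE ge_max /=.
  by rewrite !in_itv /= !ler_distl => /andP[-> ->].
by rewrite !in_itv /= !ler_distl => -[-> ->].
Qed.

Lemma compact_box z r : compact (box z r).
Proof. by rewrite boxE; apply: compact_setX; exact: segment_compact. Qed.

Lemma box_center z r : 0 <= r -> box z r z.
Proof. by rewrite /box /= subrr normr0. Qed.

Lemma open_box Omega z : open Omega -> Omega z ->
  exists2 r, 0 < r & box z r `<=` Omega.
Proof.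
rewrite openE => /[apply] /nbhs_ballP[r /= r0 H]; exists (r / 2).
  by rewrite divr_gt0.
move=> q; rewrite /box /= => qz; apply: H; rewrite -ball_normE /= distrC.
by rewrite (le_lt_trans qz)// ltr_pdivrMr// ltr_pMr// ltr1n.
Qed.

(** A Lebesgue number argument: half of an admissible radius is spent on moving the centre, the
    other half remains as margin, and compactness makes the margin uniform. *)
Lemma compact_margin Omega (K : set (R * R)) : open Omega -> compact K ->
  K `<=` Omega -> exists2 r, 0 < r & forall z, K z -> box z r `<=` Omega.
Proof.
move=> oO cK KO.
have := iffLR (compact_near_coveringP K) cK R (0^'+) (fun r z => box z r `<=` Omega) _.
move=> /(_ _)[].
  move=> z /KO/(open_box oO)[r r0 zr].
  exists (ball z (r / 2), [set e | 0 < e /\ e <= r / 2]) => /=.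
    split; first by apply: nbhsx_ballx; rewrite divr_gt0.
    near=> e; split; near: e; first exact: nbhs_right_gt.
    by apply: nbhs_right_le; rewrite divr_gt0.
  move=> [q e] /= [zq [e0 er]] p; rewrite /box /= => pq; apply: zr.
  rewrite /box /= -(subrK q p) -addrA (le_trans (ler_normD _ _))//.
  rewrite [leRHS](splitr r) lerD//; first exact: le_trans er.
  by apply: ltW; move: zq; rewrite -ball_normE /= distrC.
move=> e [/= e0] H; exists (e / 2); first by rewrite divr_gt0.
move=> z Kz; apply: (H (e / 2)) => //=; last by rewrite divr_gt0.
by rewrite sub0r normrN gtr0_norm ?divr_gt0// ltr_pdivrMr// ltr_pMr// ltr1n.
Unshelve. all: by end_near. Qed.

Lemma compact_norm_bounded F (K : set (R * R)) : compact K ->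
  (forall z, K z -> {for z, continuous F}) ->
  exists2 M, 0 <= M & forall z, K z -> `|F z| <= M.
Proof.
move=> cK cF.
have /continuous_compact/(_ cK)/compact_bounded[M [_ HM]] :
    {within K, continuous F}.
  by apply: continuous_in_subspaceT => z /set_mem/cF.
exists (`|M| + 1); first by rewrite addr_ge0.
move=> z Kz; apply: HM; last by exists z.
by rewrite (le_lt_trans (ler_norm M))// ltrDl.
Qed.

Lemma test_functionP Omega phi (K : set (R * R)) : smooth_on setT phi ->
  compact K -> K `<=` Omega -> (forall p, ~ K p -> phi p = 0) ->
  test_function Omega phi.
Proof.
move=> sp cK KO p0.
have sub : closure [set p | phi p != 0] `<=` K.
  have /closure_id -> := compact_closed (@norm_hausdorff _ _) cK.
  apply: closureS => p /= /eqP pn0; apply: contrapT => /p0.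
  by [].
split => //; last by apply: subset_trans KO.
by apply: subclosed_compact cK sub; exact: closed_closure.
Qed.

Lemma test_functionE Omega phi : test_function Omega phi ->
  exists K, [/\ compact K, K `<=` Omega & forall p, ~ K p -> phi p = 0].
Proof.
move=> [_ cK KO]; exists (closure [set p | phi p != 0]); split => //.
move=> p; apply: contra_notP => /eqP pn0; exact: subset_closure.
Qed.

Lemma test_sub Omega Omega' phi : Omega `<=` Omega' ->
  test_function Omega phi -> test_function Omega' phi.
Proof. by move=> OO [sp cK KO]; split => //; apply: subset_trans OO. Qed.

Lemma test_near0 Omega phi z : test_function Omega phi ->
  ~ closure [set p | phi p != 0] z -> \near z, phi z = 0.
Proof.
move=> tp zK; have : open (~` closure [set p | phi p != 0]).
  by apply: closed_openC; exact: closed_closure.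
rewrite openE => /(_ _ zK); apply: filterS => y yK.
by apply/eqP; apply: contra_notT yK => ?; exact: subset_closure.
Qed.

Lemma test_partials Omega phi : test_function Omega phi ->
  test_function Omega (dx phi) /\ test_function Omega (dy phi).
Proof.
move=> tp; have [sp cK KO] := tp.
have H p : ~ closure [set p | phi p != 0] p -> has_partials phi p 0 0.
  move=> /(test_near0 tp) n0; apply: near_has_partials (has_partials_cst 0 p).
  by apply: filterS n0 => y ->.
split.
  apply: (test_functionP (smooth_dx sp) cK KO) => p /H; by case=> _ [].
apply: (test_functionP (smooth_dy sp) cK KO) => p /H; by case=> _ [].
Qed.

Lemma test_dx Omega phi : test_function Omega phi -> test_function Omega (dx phi).
Proof. by move=> /test_partials[]. Qed.

Lemma test_dy Omega phi : test_function Omega phi -> test_function Omega (dy phi).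
Proof. by move=> /test_partials[]. Qed.

Lemma test_has_partials Omega phi z : test_function Omega phi ->
  has_partials phi z (dx phi z) (dy phi z).
Proof. by move=> [sp _ _]; split => //; exact: smooth_diff sp _. Qed.

Lemma test_continuous Omega phi : test_function Omega phi -> continuous phi.
Proof. by move=> [sp _ _] z; exact: smooth_continuous sp _. Qed.

Lemma test_bounded Omega phi : test_function Omega phi ->
  exists2 M, 0 <= M & forall z, `|phi z| <= M.
Proof.
move=> tp; have [K [cK _ K0]] := test_functionE tp.
have [M M0 HM] := compact_norm_bounded cK (fun z _ => test_continuous tp (x := z)).
exists M => // z; have [/HM//|/K0->] := pselect (K z).
by rewrite normr0.
Qed.

Lemma is_derive_slice_x F z a b : has_partials F z a b ->
  is_derive z.1 1 (fun t => F (t, z.2)) a.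
Proof.
move=> /has_partials_is_derive[[d1 d2] _].
have E : (fun h : R => h^-1 *: (((fun t => F (t, z.2)) \o shift z.1) (h *: (1 : R)) - F z)) =
    (fun k : R => k^-1 *: ((F \o shift z) (k *: ((1, 0) : (R * R)%type)) - F z)).
  apply/funext => h /=; congr (_ *: (F _ - _)).
  by case: z {d1 d2} => x y; rewrite /GRing.scale /=; congr (_, _); rewrite /= /GRing.scale /= ?mulr0 ?add0r.
by split; rewrite /derivable /derive -?surjective_pairing E.
Qed.

Lemma is_derive_slice_y F z a b : has_partials F z a b ->
  is_derive z.2 1 (fun t => F (z.1, t)) b.
Proof.
move=> /has_partials_is_derive[_ [d1 d2]].
have E : (fun h : R => h^-1 *: (((fun t => F (z.1, t)) \o shift z.2) (h *: (1 : R)) - F z)) =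
    (fun k : R => k^-1 *: ((F \o shift z) (k *: ((0, 1) : (R * R)%type)) - F z)).
  apply/funext => h /=; congr (_ *: (F _ - _)).
  by case: z {d1 d2} => x y; rewrite /GRing.scale /=; congr (_, _); rewrite /= /GRing.scale /= ?mulr0 ?add0r.
by split; rewrite /derivable /derive -?surjective_pairing E.
Qed.

Lemma MVT_increment (f df : R -> R) (x h : R) :
  (forall t : R, is_derive t 1 f (df t)) ->
  exists2 c, `|c - x| <= `|h| & f (x + h) - f x = df c * h.
Proof.
move=> fd; have cf a b : {within `[a, b], continuous f}.
  apply: continuous_subspaceT => t; apply/differentiable_continuous.
  by apply/derivable1_diffP; have [] := fd t.
have [h0|h0] := leP 0 h.
  have [|c] := @MVT_segment _ f df x (x + h) _ (fun t _ => fd t) (cf _ _).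
    by rewrite lerDl.
  rewrite in_itv /= => /andP[xc ch] ->; exists c; last by rewrite addrAC subrr add0r.
  by rewrite !ger0_norm ?subr_ge0// lerBlDl.
have [|c] := @MVT_segment _ f df (x + h) x _ (fun t _ => fd t) (cf _ _).
  by rewrite gerDl ltW.
rewrite in_itv /= => /andP[xc cx] E; exists c.
  rewrite [`|h|]ltr0_norm// distrC ger0_norm ?subr_ge0//; lra.
rewrite -[LHS]opprB E; ring.
Qed.

Lemma MVT_x F z (t : R) : (forall p, differentiable F p) ->
  exists2 c, `|c - z.1| <= `|t| & F (z.1 + t, z.2) - F z = dx F (c, z.2) * t.
Proof.
move=> dF.
have [|c c1 c2] := @MVT_increment (fun u => F (u, z.2)) (fun u => dx F (u, z.2)) z.1 t.
  by move=> u; apply: (is_derive_slice_x (z := (u, z.2)) (has_partials_diff (dF _))).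
by exists c => //; rewrite -c2 -surjective_pairing.
Qed.

Lemma MVT_y F z (t : R) : (forall p, differentiable F p) ->
  exists2 c, `|c - z.2| <= `|t| & F (z.1, z.2 + t) - F z = dy F (z.1, c) * t.
Proof.
move=> dF.
have [|c c1 c2] := @MVT_increment (fun u => F (z.1, u)) (fun u => dy F (z.1, u)) z.2 t.
  by move=> u; apply: (is_derive_slice_y (z := (z.1, u)) (has_partials_diff (dF _))).
by exists c => //; rewrite -c2 -surjective_pairing.
Qed.

Lemma pairD z (a b : R) : z + (a, b) = (z.1 + a, z.2 + b).
Proof. by []. Qed.

Lemma norm_fst_le h : `|h.1| <= `|h|.
Proof. by rewrite prod_normE le_max lexx. Qed.

Lemma norm_snd_le h : `|h.2| <= `|h|.
Proof. by rewrite prod_normE le_max lexx orbT. Qed.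

(** One horizontal and one vertical increment, each bounded through the sup norm of [h]: hence the
    factor 2. *)
Lemma lipschitz_of_partials F (M : R) : (forall p, differentiable F p) ->
  (forall p, `|dx F p| <= M) -> (forall p, `|dy F p| <= M) ->
  forall z h, `|F (z + h) - F z| <= 2 * M * `|h|.
Proof.
move=> dF Mx My z h.
have [c _ c2] := MVT_x z h.1 dF.
have [d _ d2] := MVT_y (z.1 + h.1, z.2) h.2 dF.
have -> : F (z + h) - F z = dy F (z.1 + h.1, d) * h.2 + dx F (c, z.2) * h.1.
  by rewrite -c2 -d2 /= addrA subrK.
apply: (le_trans (ler_normD _ _)); rewrite !normrM mulr_natl mulr2n mulrDl.
have M0 : 0 <= M by apply: le_trans (Mx z).
by rewrite lerD// ler_pM// ?norm_fst_le ?norm_snd_le.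
Qed.

(** The remainder is uniform in [z] because the second derivatives of a test function are bounded.
    This uniformity replaces dominated convergence when a convolution is differentiated. *)
Lemma test_taylor Omega phi : test_function Omega phi ->
  exists2 M, 0 <= M & forall z h,
    `|phi (z + h) - phi z - lin2 (dx phi z) (dy phi z) h| <= M * `|h| ^+ 2.
Proof.
move=> tp.
have [M1 M10 H1] := test_bounded (test_dx (test_dx tp)).
have [M2 M20 H2] := test_bounded (test_dy (test_dx tp)).
have [M3 M30 H3] := test_bounded (test_dx (test_dy tp)).
have [M4 M40 H4] := test_bounded (test_dy (test_dy tp)).
pose M := M1 + M2 + M3 + M4.
have D (f : R * R -> R) (tf : test_function Omega f) p : differentiable f p.
  by have [] := test_has_partials p tf.
have Lx z h : `|dx phi (z + h) - dx phi z| <= 2 * M * `|h|.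
  apply: lipschitz_of_partials; first exact/D/test_dx.
    by move=> p; apply: (le_trans (H1 p)); rewrite /M; lra.
  by move=> p; apply: (le_trans (H2 p)); rewrite /M; lra.
have Ly z h : `|dy phi (z + h) - dy phi z| <= 2 * M * `|h|.
  apply: lipschitz_of_partials; first exact/D/test_dy.
    by move=> p; apply: (le_trans (H3 p)); rewrite /M; lra.
  by move=> p; apply: (le_trans (H4 p)); rewrite /M; lra.
have M0 : 0 <= M by rewrite /M; lra.
exists (4 * M); first by rewrite mulr_ge0.
move=> z h.
have [c c1 c2] := MVT_x z h.1 (D _ tp).
have [d d1 d2] := MVT_y (z.1 + h.1, z.2) h.2 (D _ tp).
(* On each leg of the broken path from [z] to [z + h] the increment is a mean value of one partial
   derivative, which is itself Lipschitz. *)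
have -> : phi (z + h) - phi z - lin2 (dx phi z) (dy phi z) h =
    (dy phi (z.1 + h.1, d) - dy phi z) * h.2 + (dx phi (c, z.2) - dx phi z) * h.1.
  rewrite !mulrBl -c2 -d2 /lin2 /=.
  rewrite (_ : z + h = (z.1 + h.1, z.2 + h.2))//; ring.
apply: (le_trans (ler_normD _ _)); rewrite !normrM.
have -> : 4 * M * `|h| ^+ 2 = 2 * M * `|h| * `|h| + 2 * M * `|h| * `|h| by ring.
apply: lerD; apply: ler_pM => //; rewrite ?norm_fst_le ?norm_snd_le//.
  have := Ly z (h.1, d - z.2).
  rewrite (_ : z + _ = (z.1 + h.1, d)); last by rewrite pairD [z.2 + _]addrC subrK.
  move=> /le_trans; apply; rewrite ler_wpM2l ?mulr_ge0//.
  by rewrite [leLHS]prod_normE ge_max /= norm_fst_le (le_trans d1)// norm_snd_le.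
have := Lx z (c - z.1, 0).
rewrite (_ : z + _ = (c, z.2)); last by rewrite pairD [z.1 + _]addrC subrK addr0.
move=> /le_trans; apply; rewrite ler_wpM2l ?mulr_ge0//.
by rewrite [leLHS]prod_normE ge_max /= normr0 normr_ge0 andbT (le_trans c1)// norm_fst_le.
Qed.

Lemma schwarz_symmetry F z : smooth_on setT F -> dx (dy F) z = dy (dx F) z.
Proof.
move=> sF.
have D (f : R * R -> R) (sf : smooth_on setT f) p : differentiable f p by exact: smooth_diff sf _.
have sub4 (a b c d : R) : (a - b) - (c - d) = (a - c) - (b - d) by ring.
(* Both mixed derivatives are mean values of the same second difference over a square of side [t];
   [G] and [H] group its four terms in the two possible ways. *)
have key (t : R) : t != 0 -> exists p q, [/\ `|p - z| <= `|t|, `|q - z| <= `|t| &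
    dx (dy F) p = dy (dx F) q].
  move=> t0.
  pose G u := F (u, z.2 + t) - F (u, z.2).
  pose H u := F (z.1 + t, u) - F (z.1, u).
  have dF y (u : R) : is_derive u 1 (fun s => F (s, y)) (dx F (u, y)).
    exact: (is_derive_slice_x (z := (u, y)) (has_partials_diff (D _ sF _))).
  have dF' x (u : R) : is_derive u 1 (fun s => F (x, s)) (dy F (x, u)).
    exact: (is_derive_slice_y (z := (x, u)) (has_partials_diff (D _ sF _))).
  have [c c1 c2] := @MVT_increment G
    (fun u => dx F (u, z.2 + t) - dx F (u, z.2)) z.1 t.
  have [d d1 d2] := @MVT_increment H
    (fun u => dy F (z.1 + t, u) - dy F (z.1, u)) z.2 t.
  have [c' c'1 c'2] := MVT_y (c, z.2) t (D _ (smooth_dx sF)).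
  have [d' d'1 d'2] := MVT_x (z.1, d) t (D _ (smooth_dy sF)).
  exists (d', d), (c, c'); split.
  - by rewrite prod_normE ge_max /= d'1 d1.
  - by rewrite prod_normE ge_max /= c1 c'1.
  - move: c2; rewrite c'2 => c2; move: d2; rewrite d'2 => d2.
    have E : dx (dy F) (d', d) * t * t = dy (dx F) (c, c') * t * t.
      by apply: etrans (esym d2) (etrans _ c2); exact: sub4.
    by apply: (mulIf t0); apply: (mulIf t0).
apply/eqP; rewrite -subr_eq0 -normr_eq0; apply/eqP/le_anti/andP; split; last first.
  by [].
apply/ler_addgt0Pl => e e0; rewrite addr0.
have c1 : {for z, continuous (dx (dy F))}.
  exact: smooth_continuous (smooth_dx (smooth_dy sF)) _.
have c2 : {for z, continuous (dy (dx F))}.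
  exact: smooth_continuous (smooth_dy (smooth_dx sF)) _.
have e2 : 0 < e / 2 by rewrite divr_gt0.
have /cvgrPdist_lt/(_ _ e2)/nbhs_ballP[r1 /= r10 H1] := c1.
have /cvgrPdist_lt/(_ _ e2)/nbhs_ballP[r2 /= r20 H2] := c2.
have : 0 < Num.min r1 r2 by rewrite lt_min r10.
have : Num.min r1 r2 <= r1 /\ Num.min r1 r2 <= r2 by rewrite !ge_min !lexx orbT.
move: (Num.min r1 r2) => m [m1 m2] m0.
have t0 : 0 < m / 2 by lra.
have [p [q [pz qz E]]] := key (m / 2) (lt0r_neq0 t0).
move: pz qz; rewrite (gtr0_norm t0) => pz qz.
have := H1 p; have := H2 q; rewrite -!ball_normE /= [`|z - p|]distrC [`|z - q|]distrC.
move=> /(_ (le_lt_trans qz _)) h2 /(_ (le_lt_trans pz _)) h1.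
have sub5 (a b c d : R) : c = d -> a - b = (a - c) - (b - d) by move=> ->; ring.
rewrite (sub5 _ _ _ _ E).
apply: (le_trans (ler_normB _ _)); rewrite (splitr e).
apply: lerD; apply: ltW.
  by apply: h1; lra.
by apply: h2; lra.
Qed.

Lemma has_partials_reflect phi z p a b : has_partials phi (z - p) a b ->
  has_partials (fun q => phi (z - q)) p (- a) (- b).
Proof.
move=> /diff2P H; apply/diff2P => e /H[d d0 Hd]; exists d => // h hd.
have := Hd (- h); rewrite normrN => /(_ hd).
rewrite (_ : lin2 (- a) (- b) h = lin2 a b (- h)); last by rewrite /lin2 !mulNr -!mulrN.
by rewrite (opprD p) addrA.
Qed.

Lemma smooth_reflect phi z : smooth_on setT phi ->
  smooth_on setT (fun q => phi (z - q)).
Proof.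
(* The scalar [c] absorbs the sign produced by each differentiation. *)
move=> sp; pose A := [set f | exists c g, smooth_on setT g /\
  f = (fun q => c * g (z - q))].
apply: (@smooth_partials _ A); first exact: openT.
  move=> _ [c [g [sg ->]]].
  exists (fun q => - c * dx g (z - q)), (fun q => - c * dy g (z - q)); split.
  - by exists (- c), (dx g); split => //; exact: smooth_dx.
  - by exists (- c), (dy g); split => //; exact: smooth_dy.
  - move=> q _; have := has_partials_reflect (has_partials_diff (smooth_diff (z := z - q) sg I)).
    move=> /(has_partialsM (has_partials_cst c q)) /=.
    by rewrite !mulr0 !addr0 !mulrN !mulNr.
by exists 1, phi; split => //; apply/funext => q; rewrite mul1r.
Qed.

Lemma test_reflect Omega phi z r : test_function setT phi ->
  (forall v, r < `|v| -> phi v = 0) -> box z r `<=` Omega ->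
  test_function Omega (fun q => phi (z - q)).
Proof.
move=> [sp _ _] p0 zO.
apply: (test_functionP (smooth_reflect z sp) (@compact_box z r) zO) => p /negP.
by rewrite -ltNge distrC => /p0.
Qed.

End TestFunctions.

(** * Mollifiers *)

Section FlatFunction.
Context {R : realType}.
Implicit Types (x : R) (k : nat).

(* The derivatives of [exp (-1/x)] (extended by 0 to [x <= 0]) stay in the span
   of this family. *)
Definition flat k x : R := if 0 < x then x^-1 ^+ k * expR (- x^-1) else 0.

Lemma flat_ge0 k x : 0 <= flat k x.
Proof.
rewrite /flat; case: ifPn => // x0.
by rewrite mulr_ge0 ?expR_ge0// exprn_ge0// invr_ge0 ltW.
Qed.

Lemma flat_gt0 k x : 0 < x -> 0 < flat k x.
Proof. by move=> x0; rewrite /flat x0 mulr_gt0 ?expR_gt0// exprn_gt0// invr_gt0. Qed.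

Lemma flat_eq0 k x : x <= 0 -> flat k x = 0.
Proof. by rewrite /flat; case: ltP. Qed.

Lemma flat0_le1 x : flat 0 x <= 1.
Proof.
rewrite /flat; case: ifPn => // x0.
by rewrite expr0 mul1r expR_le1 lerNl oppr0 invr_ge0 ltW.
Qed.

(** Comes from [y ^ (k + 1) / (k + 1)! <= exp y] at [y = 1 / x]; it makes the whole family tend to 0
    at the origin. *)
Lemma flat_le k x : flat k x <= k.+1`!%:R * `|x|.
Proof.
have [x0|x0] := leP x 0; first by rewrite flat_eq0// mulr_ge0.
have y0 : 0 < x^-1 by rewrite invr_gt0.
rewrite /flat x0 (gtr0_norm x0) expRN ler_pdivrMr ?expR_gt0//.
have E : x^-1 ^+ k.+1 <= k.+1`!%:R * expR x^-1.
  have f0 : 0 < k.+1`!%:R :> R by rewrite ltr0n fact_gt0.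
  rewrite mulrC -ler_pdivrMr//; apply: le_trans (expR_ge1Dxn k (ltW y0)).
  by rewrite lerDr.
rewrite mulrAC -ler_pdivrMr// -exprSr//.
Qed.

Lemma is_derive_flat k x :
  is_derive x 1 (flat k) (- k%:R * flat k.+1 x + flat k.+2 x).
Proof.
have [x0|x0|->] := ltgtP x 0.
- rewrite !flat_eq0 ?ltW// mulr0 addr0.
  apply: (@near_eq_is_derive _ _ _ (cst (0 : R))).
  near=> y; rewrite flat_eq0// ltW//; near: y.
  exact: lt_nbhsl.
- pose g (y : R) := y ^+ k * expR (- y).
  apply: (@near_eq_is_derive _ _ _ (g \o GRing.inv)).
    near=> y; rewrite /flat ifT//; near: y.
    exact: lt_nbhsr.
  have -> : - k%:R * flat k.+1 x + flat k.+2 x =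
    (x^-1 ^+ k * - expR (- x^-1) + expR (- x^-1) * (k%:R * x^-1 ^+ k.-1)) *
    - (x ^- 2).
    by rewrite /flat x0 -exprVn; case: k g => [|k] g /=; rewrite ?exprS; ring.
  apply: is_derive1_comp.
    apply: is_deriveM.
    + apply: DeriveDef; first exact: exprn_derivable.
      by rewrite exp_derive /GRing.scale /= mulr1.
    + rewrite -[X in is_derive _ _ _ X]mulrN1.
      by apply: is_derive1_comp.
  apply: DeriveDef; first by apply: (@derivableV _ _ id); [rewrite gt_eqF|exact: derivable_id].
  rewrite (@deriveV _ _ id)//; first by rewrite derive_id /GRing.scale /= mulr1.
  by rewrite gt_eqF.
(* At the origin the difference quotient of [flat k] is exactly [flat k.+1]. *)
- rewrite !flat_eq0// mulr0 addr0.
  have E : (fun h : R => h^-1 *: ((flat k \o shift 0) (h *: (1 : R)) - flat k 0)) = flat k.+1.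
    apply/funext => h /=; rewrite /GRing.scale /= mulr1 addr0 (flat_eq0 k (lexx 0)) subr0.
    by rewrite /flat; case: ifPn => h0; rewrite ?mulr0// exprS mulrA.
  have C : flat k.+1 @ 0^' --> (0 : R).
    have f0 : 0 < k.+2`!%:R :> R by rewrite ltr0n fact_gt0.
    apply/cvgrPdist_le => e e0; near=> h.
    rewrite sub0r normrN ger0_norm ?flat_ge0//; apply: le_trans (flat_le _ _) _.
    rewrite mulrC -ler_pdivlMr//; near: h; apply: dnbhs0_le.
    by rewrite divr_gt0.
  split; first by rewrite /derivable E; apply/cvg_ex; exists 0.
  by rewrite /derive E; apply: cvg_lim.
Unshelve. all: by end_near. Qed.

Lemma Ck_on_flat U n k F : open U -> Ck_on U n F -> Ck_on U n (flat k \o F).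
Proof.
move=> oU; elim: n k F => [|n IH] k F cF.
  move=> p Up; apply: continuous_comp; first exact: cF.
  apply/differentiable_continuous/derivable1_diffP.
  by have [] := is_derive_flat k (F p).
have pF := Ck_on_pred cF; case: cF => dF cx cy.
have H (a : R * R -> R) : Ck_on U n a ->
    Ck_on U n (((cst (- k%:R) \* (flat k.+1 \o F)) \+ (flat k.+2 \o F)) \* a).
  move=> ca; apply: Ck_onM => //; apply: Ck_onD => //; last exact: IH.
  by apply: Ck_onM => //; [exact: Ck_on_cst|exact: IH].
apply: (Ck_on_partials oU _ (H _ cx) (H _ cy)) => z Uz.
apply: has_partials_comp; first exact: is_derive_flat.
by apply: has_partials_diff; exact: dF.
Qed.

(** A smooth transition from 0 on [x <= 1] to 1 on [x >= 2]; the denominator is positive because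
    [x - 1] or [2 - x] is. *)
Definition step x : R := flat 0 (x - 1) / (flat 0 (x - 1) + flat 0 (2 - x)).

Definition dstep x : R :=
  (flat 2 (x - 1) * flat 0 (2 - x) + flat 0 (x - 1) * flat 2 (2 - x)) /
  (flat 0 (x - 1) + flat 0 (2 - x)) ^+ 2.

Lemma step_den_gt0 x : 0 < flat 0 (x - 1) + flat 0 (2 - x).
Proof.
have [x1|x1] := ltP 1 x.
  by rewrite ltr_wpDr ?flat_ge0// flat_gt0// subr_gt0.
by rewrite ltr_wpDl ?flat_ge0// flat_gt0// subr_gt0 (le_lt_trans x1)// ltr1n.
Qed.

Lemma step_eq0 x : x <= 1 -> step x = 0.
Proof. by move=> x1; rewrite /step flat_eq0 ?mul0r// subr_le0. Qed.

Lemma step_eq1 x : 2 <= x -> step x = 1.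
Proof.
move=> x2; have := step_den_gt0 x; rewrite /step.
by rewrite (@flat_eq0 _ (2 - x)) ?subr_le0// addr0 => /lt0r_neq0/divff.
Qed.

Lemma dstep_ge0 x : 0 <= dstep x.
Proof.
apply: divr_ge0; first by rewrite addr_ge0 ?mulr_ge0 ?flat_ge0.
by rewrite exprn_ge0 ?addr_ge0 ?flat_ge0.
Qed.

Lemma dstep_eq0 x : x <= 1 \/ 2 <= x -> dstep x = 0.
Proof.
rewrite /dstep => -[h|h].
  by rewrite !(@flat_eq0 _ (x - 1)) ?subr_le0// !mul0r addr0 mul0r.
by rewrite !(@flat_eq0 _ (2 - x)) ?subr_le0// !mulr0 addr0 mul0r.
Qed.

Lemma dstep_gt0 x : 1 < x -> x < 2 -> 0 < dstep x.
Proof.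
move=> x1 x2; rewrite /dstep divr_gt0// ?exprn_gt0 ?step_den_gt0//.
by rewrite addr_gt0// mulr_gt0// flat_gt0// subr_gt0.
Qed.

Lemma is_derive_step x : is_derive x 1 step (dstep x).
Proof.
pose A (y : R) := flat 0 (y - 1); pose B (y : R) := flat 0 (2 - y).
have dA : is_derive x 1 A (flat 2 (x - 1)).
  (* [is_derive_flat] gives the derivative of [flat 0] as [- 0 * flat 1 + flat 2]; the goal is
     brought to this shape. *)
  rewrite -[flat 2 _]add0r -[X in X + _](mul0r (flat 1 (x - 1))) -{1}[0]oppr0.
  rewrite -[X in is_derive _ _ _ X]mulr1.
  apply: (@is_derive1_comp _ (flat 0) (fun y => y - 1)); first exact: is_derive_flat.
  by rewrite -[X in is_derive _ _ _ X]subr0; apply: is_deriveB.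
have dB : is_derive x 1 B (- flat 2 (2 - x)).
  rewrite -[flat 2 _]add0r -[X in X + _](mul0r (flat 1 (2 - x))) -{1}[0]oppr0.
  rewrite -[X in is_derive _ _ _ X]mulrN1.
  apply: (@is_derive1_comp _ (flat 0) (fun y => 2 - y)); first exact: is_derive_flat.
  by rewrite -[X in is_derive _ _ _ X]sub0r; apply: is_deriveB.
have D0 := lt0r_neq0 (step_den_gt0 x).
have dV := @is_deriveV _ (A + B) x _ 1 D0 (is_deriveD dA dB).
have := is_deriveM dA dV.
congr (is_derive _ _ _ _).
rewrite /dstep /GRing.scale /= -[(A + B) x]/(A x + B x) -/(A x) -/(B x).
move: D0; rewrite -/(A x) -/(B x) => D0; field.
by [].
Qed.

End FlatFunction.

Section Mollifier.
Context {R : realType}.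
Implicit Types (s r d : R) (v : R * R).

Definition sqn v : R := v.1 ^+ 2 + v.2 ^+ 2.

Lemma sqn_ge0 v : 0 <= sqn v. Proof. by rewrite addr_ge0// sqr_ge0. Qed.

Lemma norm_sqn v : `|v| ^+ 2 <= sqn v.
Proof.
rewrite prod_normE /=; have [_|_] := leP `|v.1| `|v.2|; rewrite real_normK ?num_real//.
  by rewrite lerDr sqr_ge0.
by rewrite lerDl sqr_ge0.
Qed.

Lemma has_partials_sqn v : has_partials sqn v (2 * v.1) (2 * v.2).
Proof.
have := has_partialsD (has_partialsM (has_partials_fst v) (has_partials_fst v))
  (has_partialsM (has_partials_snd v) (has_partials_snd v)).
rewrite !mulr0 !mulr1 !addr0 !add0r => H.
rewrite (_ : sqn = (fst \* fst) \+ (snd \* snd)); last first.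
  by apply/funext => p; rewrite /sqn !expr2.
by rewrite !mulr_natl !mulr2n.
Qed.

Lemma smooth_sqn : smooth_on setT sqn.
Proof.
move=> k; rewrite (_ : sqn = (fst \* fst) \+ (snd \* snd)).
  by apply: Ck_onD; [exact: openT| |]; apply: Ck_onM; try exact: openT;
    try exact: (Ck_on_fst _ openT); exact: (Ck_on_snd _ openT).
by apply/funext => p; rewrite /sqn !expr2.
Qed.

Definition cutoff s v := step (s * sqn v).

Lemma has_partials_cutoff s v :
  has_partials (cutoff s) v (dstep (s * sqn v) * (s * (2 * v.1)))
                            (dstep (s * sqn v) * (s * (2 * v.2))).
Proof.
apply: has_partials_comp; first exact: is_derive_step.
have := has_partialsM (has_partials_cst s v) (has_partials_sqn v).
by rewrite !mulr0 !addr0.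
Qed.

Lemma Ck_scaled_sqn k s : Ck_on setT k (fun v => s * sqn v).
Proof.
by apply: Ck_onM; [exact: openT|exact: Ck_on_cst openT|exact: smooth_sqn].
Qed.

Lemma Ck_shifted k s (a b : R) : Ck_on setT k (fun v => a + b * (s * sqn v)).
Proof.
apply: Ck_onD; [exact: openT|exact: (Ck_on_cst _ _ openT)|].
apply: Ck_onM; [exact: openT|exact: (Ck_on_cst _ _ openT)|exact: Ck_scaled_sqn].
Qed.

Let A k s j : Ck_on setT k (fun v => flat j (s * sqn v - 1)).
Proof.
apply: (Ck_on_flat _ openT).
have := Ck_shifted k s (-1) 1; congr Ck_on; apply/funext => v.
by rewrite mul1r addrC.
Qed.

Let B k s j : Ck_on setT k (fun v => flat j (2 - s * sqn v)).
Proof.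
apply: (Ck_on_flat _ openT).
by have := Ck_shifted k s 2 (-1); congr Ck_on; apply/funext => v; rewrite mulN1r.
Qed.

Let V k s : Ck_on setT k (fun v => (flat 0 (s * sqn v - 1) + flat 0 (2 - s * sqn v))^-1).
Proof.
apply: Ck_onV; [exact: openT| |apply: Ck_onD; [exact: openT|exact: A|exact: B]].
by move=> p _; rewrite gt_eqF// step_den_gt0.
Qed.

Lemma smooth_cutoff s : smooth_on setT (cutoff s).
Proof. by move=> k; apply: Ck_onM; [exact: openT|exact: A|exact: V]. Qed.

(** The divergence of [cutoff s v * v / |v|^2], hence a ring [1 < s * |v|^2 < 2] and not a bump at
    the centre. This shape makes the difference of two mollifiers the divergence of a test field. *)
Definition moll s v := 2 * s * dstep (s * sqn v).

Lemma smooth_moll s : smooth_on setT (moll s).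
Proof.
move=> k; apply: Ck_onM; [exact: openT|exact: (Ck_on_cst _ _ openT)|].
apply: Ck_onM; [exact: openT| |].
  by apply: Ck_onD; [exact: openT| |]; (apply: Ck_onM; [exact: openT| |]); try exact: A; exact: B.
have := Ck_onM openT (V k s) (V k s); congr Ck_on.
by apply/funext => v /=; rewrite expr2 invfM.
Qed.

Lemma moll_ge0 s v : 0 <= s -> 0 <= moll s v.
Proof. by move=> s0; rewrite mulr_ge0 ?dstep_ge0// mulr_ge0. Qed.

Lemma moll_sym s v : moll s (- v) = moll s v.
Proof. by rewrite /moll /sqn /= !sqrrN. Qed.

Lemma sqn_far s d v : 0 < s -> 0 < d -> 2 <= s * d ^+ 2 -> d < `|v| -> 2 <= s * sqn v.
Proof.
move=> s0 d0 sd dv; apply: (le_trans sd); rewrite ler_wpM2l ?(ltW s0)//.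
by apply: le_trans (norm_sqn v); rewrite ler_sqr ?nnegrE ?normr_ge0// ltW.
Qed.

Lemma moll_far s d v : 0 < s -> 0 < d -> 2 <= s * d ^+ 2 -> d < `|v| -> moll s v = 0.
Proof.
by move=> s0 d0 sd dv; rewrite /moll dstep_eq0 ?mulr0//; right; exact: sqn_far dv.
Qed.

Lemma exists_radius s : 0 < s -> exists2 d, 0 < d & 2 <= s * d ^+ 2.
Proof.
(* With [t = 2 / s] one has [s * (1 + t) ^ 2 >= s * t = 2]. *)
move=> s0; exists (1 + 2 / s); first by rewrite ltr_wpDr// divr_ge0// ltW.
have h : 0 <= 2 / s by rewrite divr_ge0// ltW.
have E : s * (2 / s) = 2 by rewrite mulrC divfK// gt_eqF.
rewrite -[leLHS]E ler_wpM2l ?(ltW s0)//; move: (2 / s) h => t h; nra.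
Qed.

Lemma test_moll s : 0 < s -> test_function setT (moll s).
Proof.
move=> s0; have [d d0 sd] := exists_radius s0.
apply: (test_functionP (smooth_moll s) (@compact_box _ 0 d)) => //.
by move=> v /negP; rewrite -ltNge subr0; exact: moll_far.
Qed.

(** [moll s v] is [s] times a value of [moll 1]. The decay as [s] tends to 0 is what makes very wide
    mollified currents small. *)
Lemma moll_scale : exists2 M, 0 <= M & forall s v, 0 <= s -> moll s v <= s * M.
Proof.
have [M M0 HM] := test_bounded (test_moll (@ltr01 R)).
exists M => // {}s v s0; have := HM (Num.sqrt (s * sqn v), 0).
rewrite /moll {1}/sqn /= expr0n /= addr0 mulr1 mul1r sqr_sqrtr ?mulr_ge0 ?sqn_ge0//.
rewrite ger0_norm; last by apply: mulr_ge0 => //; exact: dstep_ge0.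
move=> h.
by rewrite -mulrA mulrCA ler_wpM2l.
Qed.

Lemma moll_gt0 : exists v, 0 < moll 1 v.
Proof.
(* A point of squared norm 3/2, in the middle of the ring. *)
exists (1, Num.sqrt (1/2)); rewrite /moll !mulr1 mulr_gt0// /sqn /= expr1n mul1r.
by rewrite sqr_sqrtr ?divr_ge0//; apply: dstep_gt0; lra.
Qed.

(* A truncation of [v / |v|^2], the conjugate of the Cauchy kernel [1/v]: it is
   curl-free and its divergence is a difference of mollifiers. *)
Definition kern s r v := (cutoff s v - cutoff r v) / sqn v.

Lemma kern_near0 s r v : 0 < s -> 0 < r -> s * sqn v < 1 -> r * sqn v < 1 -> kern s r v = 0.
Proof.
by move=> s0 r0 sv rv; rewrite /kern /cutoff !step_eq0 ?ltW// subrr mul0r.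
Qed.

Lemma kern_far s r d v : 0 < s -> 0 < r -> 0 < d -> 2 <= s * d ^+ 2 -> 2 <= r * d ^+ 2 ->
  d < `|v| -> kern s r v = 0.
Proof.
move=> s0 r0 d0 sd rd dv; rewrite /kern /cutoff !step_eq1 ?subrr ?mul0r//;
  [exact: sqn_far dv|exact: sqn_far dv].
Qed.

Let near_origin s r := [set v | s * sqn v < 1] `&` [set v | r * sqn v < 1].

Let open_sublevel s : open [set v | s * sqn v < 1].
Proof.
apply: (@open_comp _ _ (fun v => s * sqn v) [set x | x < 1]) => [v _|].
  exact: (smooth_continuous (fun k => Ck_scaled_sqn k s)).
exact: open_lt.
Qed.

Let open_near_origin s r : open (near_origin s r).
Proof. by apply: openI; exact: open_sublevel. Qed.

Let open_nonzero : open [set v | sqn v != 0].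
Proof.
rewrite (_ : [set v | sqn v != 0] = sqn @^-1` [set x | x != 0])//.
apply: (@open_comp _ _ sqn) => [v _|]; first exact: (smooth_continuous smooth_sqn).
rewrite (_ : [set x | x != 0] = ~` [set 0]); last by apply/seteqP; split => x /= /eqP.
by apply: closed_openC; exact: closed_eq.
Qed.

(** The singularity of [1 / |v|^2] disappears because both cutoffs vanish identically near the
    origin. *)
Lemma smooth_kern s r : 0 < s -> 0 < r -> smooth_on setT (kern s r).
Proof.
move=> s0 r0 k; apply: Ck_on_local => v _.
have [v0|v0] := eqVneq (sqn v) 0.
  exists (near_origin s r); first by split; rewrite /= v0 mulr0.
  have c0 := Ck_on_cst k (0 : R) (@open_near_origin s r).
  apply: Ck_on_eq c0; first exact: open_near_origin.
  by move=> p /set_mem[sp rp]; rewrite kern_near0.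
exists [set v | sqn v != 0] => //.
apply: Ck_onM; [exact: open_nonzero|apply: Ck_onB; [exact: open_nonzero| |]|].
- exact: (Ck_on_sub (@subsetT _ _) (@smooth_cutoff s k)).
- exact: (Ck_on_sub (@subsetT _ _) (@smooth_cutoff r k)).
- apply: Ck_onV; [exact: open_nonzero|by []|].
  exact: (Ck_on_sub (@subsetT _ _) (@smooth_sqn k)).
Qed.

Definition kern1 s r v := v.1 * kern s r v.
Definition kern2 s r v := v.2 * kern s r v.

Lemma test_kern s r : 0 < s -> 0 < r ->
  test_function setT (kern1 s r) /\ test_function setT (kern2 s r).
Proof.
move=> s0 r0.
have [d d0 sd] := exists_radius s0; have [e e0 re] := exists_radius r0.
have H v : ~ box 0 (d + e) v -> kern s r v = 0.
  move=> /negP; rewrite -ltNge subr0.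
  apply: kern_far; rewrite ?addr_gt0//.
    by apply: (le_trans sd); rewrite ler_wpM2l ?(ltW s0)// ler_sqr ?nnegrE ?lerDl ?addr_ge0 ?ltW.
  by apply: (le_trans re); rewrite ler_wpM2l ?(ltW r0)// ler_sqr ?nnegrE ?lerDr ?addr_ge0 ?ltW.
split; apply: (test_functionP _ (@compact_box _ 0 (d + e))) => //.
- move=> k; apply: Ck_onM; [exact: openT|exact: (Ck_on_fst _ openT)|exact: smooth_kern].
- by move=> v /H; rewrite /kern1 => ->; rewrite mulr0.
- move=> k; apply: Ck_onM; [exact: openT|exact: (Ck_on_snd _ openT)|exact: smooth_kern].
- by move=> v /H; rewrite /kern2 => ->; rewrite mulr0.
Qed.

Lemma kern_partials s r v : 0 < s -> 0 < r ->
  dx (kern1 s r) v + dy (kern2 s r) v = moll s v - moll r v /\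
  dx (kern2 s r) v = dy (kern1 s r) v.
Proof.
(* At the origin all terms vanish in a neighbourhood; elsewhere this is an identity between rational
   functions of the coordinates. *)
move=> s0 r0; have [v0|v0] := eqVneq (sqn v) 0.
  have H f : (forall p, kern s r p = 0 -> f p = 0) -> has_partials f v 0 0.
    move=> f0; apply: near_has_partials (has_partials_cst 0 v).
    have : nbhs v (near_origin s r).
      apply: open_nbhs_nbhs; split; first exact: open_near_origin.
      by split; rewrite /= v0 mulr0.
    by apply: filterS => p [sp rp]; rewrite f0// kern_near0.
  have [_ [-> ->]] : has_partials (kern1 s r) v 0 0.
    by apply: H => p; rewrite /kern1 => ->; rewrite mulr0.
  have [_ [-> ->]] : has_partials (kern2 s r) v 0 0.
    by apply: H => p; rewrite /kern2 => ->; rewrite mulr0.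
  by rewrite /moll v0 !mulr0 dstep_eq0 ?mulr0 ?subrr ?addr0//; left; rewrite ler01.
have PV : has_partials (fun p => (sqn p)^-1) v (- (sqn v) ^- 2 * (2 * v.1)) (- (sqn v) ^- 2 * (2 * v.2)).
  apply: (has_partials_comp (f := GRing.inv) _ (has_partials_sqn v)).
  apply: DeriveDef; first by apply: (@derivableV _ _ id) => //; exact: derivable_id.
  by rewrite (@deriveV _ _ id)// derive_id /GRing.scale /= mulr1.
have PK := has_partialsM (has_partialsB (has_partials_cutoff s v) (has_partials_cutoff r v)) PV.
have [_ [-> ->]] := has_partialsM (has_partials_fst v) PK.
have [_ [-> ->]] := has_partialsM (has_partials_snd v) PK.
rewrite /moll /=; move: (dstep _) (dstep _) (cutoff _ _) (cutoff _ _) => a b c e.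
move: v0; rewrite /sqn; case: v {PV PK} => x y /= v0.
by split; field.
Qed.

End Mollifier.

(** * Integration in the plane and the divergence theorem *)

Lemma lambda2_sigma_finite (R : realType) : sigma_finite setT (@lambda2 R).
Proof.
have /sigma_finiteP[F [TF ndF Foo]] := sigma_finiteT (@lebesgue_measure R).
exists (fun n => F n `*` F n).
  rewrite -setXTT TF predeqE => -[x y]; split.
    move=> [/= [n _ Fnx] [k _ Gky]]; exists (maxn n k) => //; split.
    - by move: x Fnx; exact/subsetPset/ndF/leq_maxl.
    - by move: y Gky; exact/subsetPset/ndF/leq_maxr.
  by move=> [n _ []/= ? ?]; split; exists n.
move=> k; have [? ?] := Foo k.
split; first exact: measurableX.
have -> : lambda2 (F k `*` F k) = (lebesgue_measure (F k) * lebesgue_measure (F k))%E.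
  exact: product_measure1E.
by rewrite lte_mul_pinfty// ge0_fin_numE.
Qed.

HB.instance Definition _ (R : realType) := Measure.on (@lambda2 R).

HB.instance Definition _ (R : realType) :=
  Measure_isSigmaFinite.Build _ _ _ (@lambda2 R) (@lambda2_sigma_finite R).

Section PlaneMeasure.
Context {R : realType}.
Implicit Types (A B U : set (R * R)) (f g : R * R -> R) (z : R * R).
Local Notation P2 := (measurableTypeR R * measurableTypeR R)%type.

(* [lambda2] lives on the product of two copies of [measurableTypeR R]; these
   names fix that measurable structure on [R * R]. *)
Definition pmset A := measurable (A : set P2).
Definition pmfun A f := measurable_fun (T := P2) A f.
Definition area A : \bar R := lambda2 A.
Definition intg A f := (@lambda2 R).-integrable A (EFin \o f).
Definition I2 A f : R := \int[@lambda2 R]_(p in A) f p.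

Lemma pmset_rect (A1 A2 : set R) : measurable A1 -> measurable A2 -> pmset (A1 `*` A2).
Proof. by move=> m1 m2; exact: measurableX. Qed.

Lemma pmset_box z r : pmset (box z r).
Proof. by rewrite boxE; apply: pmset_rect. Qed.

(** The pieces have half the radius of a box still contained in [U]: they cover [U], and each keeps
    room around it for test functions. *)
Lemma open_box_cover U : open U -> exists F : nat -> set (R * R),
  (forall n, F n = set0 \/
     exists z r, [/\ 0 < r, F n = box z (r / 2) & box z r `<=` U]) /\
  U = \bigcup_n F n.
Proof.
move=> oU.
pose w (i : rat * rat * nat) : R * R := (ratr i.1.1, ratr i.1.2).
pose e (i : rat * rat * nat) : R := i.2.+1%:R^-1.
pose F n := if unpickle n is Some i
  then if pselect (box (w i) (e i) `<=` U) then box (w i) (e i / 2) else set0 else set0.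
have e0 i : 0 < e i by rewrite invr_gt0.
exists F; split.
  move=> n; rewrite /F; case: unpickle => [i|]; last by left.
  by case: (pselect (box (w i) (e i) `<=` U)) => QU; [right; exists (w i), (e i)|left].
apply/seteqP; split => [p Up|p [n _]]; last first.
  rewrite /F; case: unpickle => // i; case: (pselect (box (w i) (e i) `<=` U)) => // H.
  rewrite /box /= => pw; apply: H; apply: (le_trans pw).
  by rewrite ler_pdivrMr// ler_pMr// ler1n.
have /open_box/(_ Up)[r r0 rU] := oU.
(* A rational centre within half of this radius: the half box contains [p] and the full box stays
   within [r] of [p]. *)
have [n nr] : exists n, n.+1%:R^-1 < r / 2.
  have [n] := ltr_add_invr (y := 0) (x := r/2) ltac:(by rewrite divr_gt0).
  by rewrite add0r; exists n.
have n0 : 0 < n.+1%:R^-1 / 2 :> R by rewrite divr_gt0// invr_gt0.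
have near_rat (x : R) : exists a : rat, `|x - ratr a| <= n.+1%:R^-1 / 2.
  have := @rat_in_itvoo R (x - n.+1%:R^-1 / 2) (x + n.+1%:R^-1 / 2).
  rewrite ltrD2l gtrN// => /(_ isT)[a]; rewrite in_itv /= => /andP[h1 h2].
  by exists a; rewrite ltW// ltr_distlC h1 h2.
have [a ap] := near_rat p.1; have [b bp] := near_rat p.2.
pose i := (a, b, n); have pw : `|p - w i| <= e i / 2 by rewrite prod_normE ge_max ap bp.
exists (pickle i); first exact: I.
rewrite /F pickleK; case: (pselect (box (w i) (e i) `<=` U)) => // QU.
exfalso; apply: QU; move=> q; rewrite /box /= => qw; apply: rU; rewrite /box /=.
have -> : q - p = (q - w i) + (w i - p) by rewrite addrA subrK.
apply: (le_trans (ler_normD _ _)); rewrite (splitr r); apply: lerD.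
  exact: le_trans qw (ltW nr).
rewrite distrC; apply: le_trans (ltW nr); apply: (le_trans pw).
by rewrite ler_pdivrMr// ler_pMr// ler1n.
Qed.

Lemma open_pmset U : open U -> pmset U.
Proof.
move=> /open_box_cover[F [HF ->]]; apply: bigcupT_measurable => n.
by have [->|[z [r [_ -> _]]]] := HF n; [exact: measurable0|exact: pmset_box].
Qed.

Lemma pmsetC A : pmset A -> pmset (~` A).
Proof. exact: measurableC. Qed.

Lemma compact_pmset A : compact A -> pmset A.
Proof.
move=> /(compact_closed (@norm_hausdorff _ _)) cA; rewrite -(setCK A); apply: pmsetC.
by apply: open_pmset; apply: closed_openC.
Qed.

Lemma continuous_pmfun U f : open U -> (forall p, U p -> {for p, continuous f}) -> pmfun U f.
Proof.
move=> oU cf; apply: (measurability _ (RGenOpens.measurableE R)).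
move=> _ [_ [a [b ->] <-]]; apply: open_pmset.
rewrite openE => p [Up fp].
have nU : nbhs p U by apply: open_nbhs_nbhs.
have nf : nbhs p (f @^-1` `]a, b[%classic).
  by apply: cf => //; apply: open_nbhs_nbhs; split => //; exact: interval_open.
by near=> q; split; near: q.
Unshelve. all: by end_near. Qed.

Lemma pmfun_sub A B f : pmset A -> B `<=` A -> pmfun A f -> pmfun B f.
Proof. exact: measurable_funS. Qed.

Lemma area_rect (A1 A2 : set R) : measurable A1 -> measurable A2 ->
  area (A1 `*` A2) = (lebesgue_measure A1 * lebesgue_measure A2)%E.
Proof. by move=> m1 m2; exact: product_measure1E. Qed.

Lemma area_box z r : 0 <= r -> area (box z r) = ((2 * r) ^+ 2)%:E.
Proof.
move=> r0; rewrite boxE area_rect// !lebesgue_measure_itv /= !lte_fin.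
have E (x : R) : (x - r < x + r) = (0 < r) by lra.
rewrite !E; case: ltP => [_|r0'].
  by rewrite -!EFinB -EFinM; congr EFin; ring.
by rewrite (le_anti (introT andP (conj r0' r0))) mulr0 expr0n mul0e.
Qed.

Lemma le_area A B : pmset A -> pmset B -> A `<=` B -> (area A <= area B)%E.
Proof. by move=> mA mB AB; apply: le_measure; rewrite ?inE. Qed.

Lemma area_bounded A z r : pmset A -> A `<=` box z r -> (area A < +oo)%E.
Proof.
move=> mA Az; have [r0|r0] := leP 0 r.
  by apply: (le_lt_trans (le_area mA (pmset_box z r) Az)); rewrite area_box// ltry.
rewrite (_ : A = set0); first by rewrite /area measure0 ltry.
apply/seteqP; split => // p /Az; rewrite /box /= => pr.
by have := le_lt_trans (le_trans (normr_ge0 _) pr) r0; rewrite ltxx.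
Qed.

Lemma compact_sub_box A : compact A -> exists2 r, 0 < r & A `<=` box 0 r.
Proof.
move=> /compact_bounded[M [_ HM]]; exists (`|M| + 1); first by rewrite ltr_wpDl.
move=> p Ap; rewrite /box /= subr0; apply: HM => //.
by rewrite (le_lt_trans (ler_norm M))// ltrDl.
Qed.

Lemma area_compact A : compact A -> (area A < +oo)%E.
Proof.
move=> cA; have [r _ Ar] := compact_sub_box cA.
by apply: area_bounded Ar; exact: compact_pmset.
Qed.

Lemma intg_bounded A f (M : R) : pmset A -> (area A < +oo)%E -> pmfun A f ->
  (forall p, A p -> `|f p| <= M) -> intg A f.
Proof.
move=> mA aA mf fM; apply: measurable_bounded_integrable => //.
exists M; split; first exact: num_real.
by move=> M' MM' p Ap; apply: (le_trans (fM _ Ap)); exact: ltW.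
Qed.

Lemma intg_pmfun A f : intg A f -> pmfun A f.
Proof. by move=> /measurable_int/measurable_EFinP. Qed.

Lemma intg_le A f g : pmset A -> pmfun A f -> (forall p, A p -> `|f p| <= g p) ->
  intg A g -> intg A f.
Proof.
move=> mA mf fg; apply: le_integrable => //; first exact/measurable_EFinP.
by move=> p Ap /=; rewrite lee_fin (le_trans (fg _ Ap))// ler_norm.
Qed.

Lemma intg_eq A f g : pmset A -> (forall p, A p -> f p = g p) -> intg A f -> intg A g.
Proof. by move=> mA fg; apply: eq_integrable => // p /set_mem Ap /=; rewrite fg. Qed.

Lemma intgD A f g : pmset A -> intg A f -> intg A g -> intg A (fun p => f p + g p).
Proof. move=> mA fi gi; exact (integrableD mA fi gi). Qed.

Lemma intgB A f g : pmset A -> intg A f -> intg A g -> intg A (fun p => f p - g p).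
Proof. move=> mA fi gi; exact (integrableB mA fi gi). Qed.

Lemma intgZ A (k : R) f : pmset A -> intg A f -> intg A (fun p => k * f p).
Proof. move=> mA fi; exact (integrableZl mA k fi). Qed.

Lemma intg_norm A f : pmset A -> intg A f -> intg A (fun p => `|f p|).
Proof. by move=> mA; exact: integrable_norm. Qed.

Lemma intg_sub A B f : pmset A -> pmset B -> B `<=` A -> intg A f -> intg B f.
Proof. exact: integrableS. Qed.

Lemma intgM_bounded A f g (M : R) : pmset A -> pmfun A g ->
  (forall p, A p -> `|g p| <= M) -> intg A f -> intg A (fun p => f p * g p).
Proof.
move=> mA mg gM fi; apply: (@intg_le _ _ (fun p => M * `|f p|)) => //.
- by apply: measurable_funM => //; exact: intg_pmfun.
- by move=> p Ap; rewrite normrM mulrC ler_wpM2r// gM.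
- by apply: intgZ => //; exact: intg_norm.
Qed.

Lemma eq_I2 A f g : (forall p, A p -> f p = g p) -> I2 A f = I2 A g.
Proof. by move=> fg; apply: eq_Rintegral => p /set_mem/fg. Qed.

Lemma I2D A f g : pmset A -> intg A f -> intg A g ->
  I2 A (fun p => f p + g p) = I2 A f + I2 A g.
Proof. exact: RintegralD. Qed.

Lemma I2B A f g : pmset A -> intg A f -> intg A g ->
  I2 A (fun p => f p - g p) = I2 A f - I2 A g.
Proof. exact: RintegralB. Qed.

Lemma I2Z A (k : R) f : pmset A -> intg A f -> I2 A (fun p => k * f p) = k * I2 A f.
Proof. by move=> mA fi; exact: RintegralZl. Qed.

Lemma I2_ge0 A f : (forall p, A p -> 0 <= f p) -> 0 <= I2 A f.
Proof. by move=> h; rewrite /I2; apply: Rintegral_ge0. Qed.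

Lemma le_I2 A f g : pmset A -> intg A f -> intg A g ->
  (forall p, A p -> f p <= g p) -> I2 A f <= I2 A g.
Proof. by move=> mA fi gi fg; rewrite /I2; apply: le_Rintegral. Qed.

Lemma norm_I2 A f : pmset A -> intg A f -> `|I2 A f| <= I2 A (fun p => `|f p|).
Proof. by move=> mA fi; rewrite /I2; apply: le_normr_Rintegral. Qed.

Lemma I2_cst A (k : R) : pmset A -> I2 A (fun=> k) = k * fine (area A).
Proof. by move=> mA; exact: Rintegral_cst. Qed.

Lemma I2_restrict A B f : pmset A -> pmset B -> B `<=` A ->
  (forall p, A p -> ~ B p -> f p = 0) -> I2 A f = I2 B f.
Proof.
move=> mA mB BA f0; rewrite -(setIidr BA) /I2 Rintegral_mkcondr.
apply: eq_Rintegral => p /set_mem Ap; rewrite patchE; case: ifPn => // /negP.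
by rewrite inE; exact: f0.
Qed.

End PlaneMeasure.

(** * The divergence theorem by bisection *)

Section Divergence.
Context {R : realType}.
Implicit Types (f : R -> R) (a p : R * R).

(** Half-open intervals, so that a square is the disjoint union of its four quarters. *)
Definition I1 f (x h : R) : R :=
  \int[@lebesgue_measure R]_(t in `[x, x + h[) f t.

Lemma I1_integrable f x h : continuous f ->
  (@lebesgue_measure R).-integrable `[x, x + h[ (EFin \o f).
Proof.
move=> cf.
have : (@lebesgue_measure R).-integrable `[x, x + h] (EFin \o f).
  by apply: continuous_compact_integrable; [exact: segment_compact|exact: continuous_subspaceT].
by apply: integrableS => //; apply: subset_itvl; rewrite bnd_simp.
Qed.

Lemma I1_add f x h k : continuous f -> 0 <= h -> 0 <= k ->
  I1 f x (h + k) = I1 f x h + I1 f (x + h) k.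
Proof.
move=> cf h0 k0; have E : `[x, x + (h + k)[%classic = `[x, x + h[ `|` `[x + h, x + h + k[ :> set R.
  apply/seteqP; split => t /=; rewrite !in_itv /=; last by case=> /andP[t1 t2]; apply/andP; split; lra.
  by move=> /andP[t1 t2]; have [th|th] := ltP t (x + h); [left|right]; apply/andP; split; lra.
rewrite /I1 E Rintegral_setU//; first by rewrite -E; exact: I1_integrable.
apply/disj_setPS => t /= []; rewrite !in_itv /= => /andP[_ t1] /andP[t2 _].
by move: t1; rewrite ltNge t2.
Qed.

Lemma I1_near f x h (k e : R) : continuous f -> 0 <= h ->
  (forall t, x <= t < x + h -> `|f t - k| <= e) -> `|I1 f x h - k * h| <= e * h.
Proof.
move=> cf h0 fk.
have L (r : R) : \int[@lebesgue_measure R]_(t in `[x, x + h[) r = r * h.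
  rewrite Rintegral_cst//= lebesgue_measure_itv /= lte_fin ltrDl.
  case: ltP => [_|h0'] /=; first by rewrite addrAC subrr add0r.
  have -> : h = 0 by apply/le_anti; rewrite h0 h0'.
  by rewrite !mulr0.
have ik : (@lebesgue_measure R).-integrable `[x, x + h[ (EFin \o cst k).
  by apply: I1_integrable; exact: cst_continuous.
have ie : (@lebesgue_measure R).-integrable `[x, x + h[ (EFin \o cst e).
  by apply: I1_integrable; exact: cst_continuous.
have cfk : continuous (fun t => f t - k).
  by move=> t; apply: cvgB; [exact: cf|exact: cvg_cst].
rewrite -(L k) /I1 -RintegralB//; last exact: I1_integrable.
apply: (le_trans (le_normr_Rintegral _ _)) => //; first exact: (I1_integrable _ _ cfk).
rewrite -(L e); apply: le_Rintegral => //.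
by apply: integrable_norm; exact: (I1_integrable _ _ cfk).
Qed.

Definition square a (h : R) : set (R * R) := `[a.1, a.1 + h[ `*` `[a.2, a.2 + h[.

Lemma pmset_square a h : pmset (square a h).
Proof. by apply: pmset_rect. Qed.

Lemma square_sub_box a h p : 0 <= h -> a.1 <= p.1 <= a.1 + h -> a.2 <= p.2 <= a.2 + h ->
  square a h `<=` box p h.
Proof.
move=> h0 /andP[p1 p2] /andP[p3 p4] q [/=]; rewrite !in_itv /= => /andP[q1 q2] /andP[q3 q4].
rewrite /box /= prod_normE ge_max /= !ler_norml.
by apply/andP; split; apply/andP; split; lra.
Qed.

Variables (X1 X2 : R * R -> R).
Hypothesis dX1 : forall p, differentiable X1 p.
Hypothesis dX2 : forall p, differentiable X2 p.
Let c p := dx X1 p + dy X2 p.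
Hypothesis cc : continuous c.

Let slice1 x : continuous (fun y => X1 (x, y)).
Proof.
move=> y; apply/differentiable_continuous/derivable1_diffP.
by have [] := is_derive_slice_y (z := (x, y)) (has_partials_diff (dX1 _)).
Qed.

Let slice2 y : continuous (fun x => X2 (x, y)).
Proof.
move=> x; apply/differentiable_continuous/derivable1_diffP.
by have [] := is_derive_slice_x (z := (x, y)) (has_partials_diff (dX2 _)).
Qed.

Let cB1 x x' : continuous (fun y => X1 (x, y) - X1 (x', y)).
Proof. by move=> y; apply: cvgB; exact: slice1. Qed.

Let cB2 y y' : continuous (fun x => X2 (x, y) - X2 (x, y')).
Proof. by move=> y0; apply: cvgB; exact: slice2. Qed.

(** The flux of [(X1, X2)] out of a square minus the integral of the divergence. *)
Let defect a h := I1 (fun y => X1 (a.1 + h, y) - X1 (a.1, y)) a.2 h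
  + I1 (fun x => X2 (x, a.2 + h) - X2 (x, a.2)) a.1 h - I2 (square a h) c.

Let intg_rect (A : set (R * R)) a h : pmset A -> A `<=` box a h -> intg A c.
Proof.
move=> mA Ab.
have [M _ cM] := compact_norm_bounded (@compact_box _ a h) (fun p _ => cc (x := p)).
apply: (@intg_bounded _ _ _ M) => //; first exact: area_bounded Ab.
  apply: (@pmfun_sub _ setT) => //; first exact: measurableT.
  by apply: continuous_pmfun; [exact: openT|move=> p _; exact: cc].
by move=> p /Ab/cM.
Qed.

Let I1B (f g : R -> R) x h : continuous f -> continuous g ->
  I1 (fun t => f t - g t) x h = I1 f x h - I1 g x h.
Proof. by move=> cf cg; apply: RintegralB => //; exact: I1_integrable. Qed.

(** The fluxes through the interior sides cancel in pairs, and the quarters tile the square. *)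
Lemma defect_split a h : 0 <= h -> defect a (h + h) =
  defect a h + defect (a.1 + h, a.2) h +
  defect (a.1, a.2 + h) h + defect (a.1 + h, a.2 + h) h.
Proof.
move=> h0; case: a => x y; rewrite /defect /=.
have IS : I2 (square (x, y) (h + h)) c = I2 (square (x, y) h) c + I2 (square (x + h, y) h) c +
    I2 (square (x, y + h) h) c + I2 (square (x + h, y + h) h) c.
  have hE (u : R) : `[u, u + (h + h)[%classic = `[u, u + h[ `|` `[u + h, u + h + h[ :> set R.
    apply/seteqP; split => t /=; rewrite !in_itv /=; last by case=> /andP[t1 t2]; apply/andP; split; lra.
    by move=> /andP[t1 t2]; have [th|th] := ltP t (u + h); [left|right]; apply/andP; split; lra.
  have dis (u : R) t : `[u, u + h[%classic t -> `[u + h, u + h + h[%classic t -> False.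
    by rewrite /= !in_itv /= => /andP[_ t1] /andP[t2 _]; move: t1; rewrite ltNge t2.
  have split1 (A B C : set R) : measurable A -> measurable B -> measurable C ->
      (forall t, A t -> B t -> False) -> A `|` B `<=` `[x, x + (h + h)] -> C `<=` `[y, y + (h + h)] ->
      I2 ((A `|` B) `*` C) c = I2 (A `*` C) c + I2 (B `*` C) c.
    move=> mA mB mC AB ABx Cy.
    have E : (A `|` B) `*` C = (A `*` C) `|` (B `*` C).
      by apply/seteqP; split => [[s t] [[?|?] ?]|[s t] [[? ?]|[? ?]]] //=; [left|right|split => //; left|split => //; right].
    rewrite E /I2 Rintegral_setU//; [exact: pmset_rect|exact: pmset_rect| |].
      rewrite -E; apply: (intg_rect (a := (x, y)) (h := h + h)); first by apply: pmset_rect => //; exact: measurableU.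
      move=> q [/ABx + /Cy]; rewrite /= !in_itv /= => /andP[q1 q2] /andP[q3 q4].
      by rewrite /box /= prod_normE ge_max /= !ler_norml; apply/andP; split; apply/andP; split; lra.
    apply/disj_setPS => -[s t] [[sA _] [sB _]]; exact: AB sA sB.
  have split2 (A B C : set R) : measurable A -> measurable B -> measurable C ->
      (forall t, A t -> B t -> False) -> A `|` B `<=` `[y, y + (h + h)] -> C `<=` `[x, x + (h + h)] ->
      I2 (C `*` (A `|` B)) c = I2 (C `*` A) c + I2 (C `*` B) c.
    move=> mA mB mC AB ABx Cy.
    have E : C `*` (A `|` B) = (C `*` A) `|` (C `*` B).
      by apply/seteqP; split => [[s t] [? [?|?]]|[s t] [[? ?]|[? ?]]] //=; [left|right|split => //; left|split => //; right].
    rewrite E /I2 Rintegral_setU//; [exact: pmset_rect|exact: pmset_rect| |].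
      rewrite -E; apply: (intg_rect (a := (x, y)) (h := h + h)); first by apply: pmset_rect => //; exact: measurableU.
      move=> q [/Cy + /ABx]; rewrite /= !in_itv /= => /andP[q1 q2] /andP[q3 q4].
      by rewrite /box /= prod_normE ge_max /= !ler_norml; apply/andP; split; apply/andP; split; lra.
    apply/disj_setPS => -[s t] [[_ sA] [_ sB]]; exact: AB sA sB.
  have sub u : `[u, u + h[%classic `|` `[u + h, u + h + h[%classic `<=` `[u, u + (h + h)]%classic.
    by rewrite -hE; apply: subset_itvl; rewrite bnd_simp.
  have subl u : `[u, u + h[%classic `<=` `[u, u + (h + h)]%classic.
    by move=> t ut; apply: sub; left.
  have subr u : `[u + h, u + h + h[%classic `<=` `[u, u + (h + h)]%classic.
    by move=> t ut; apply: sub; right.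
  have mi (u v : R) : measurable `[u, v[%classic by [].
  rewrite /square /= !hE (split1 _ _ _ (mi _ _) (mi _ _)); first last.
  - by rewrite -hE; apply: subset_itvl; rewrite bnd_simp.
  - exact: sub.
  - exact: dis.
  - by rewrite -hE.
  rewrite !(split2 _ _ _ (mi _ _) (mi _ _) (mi _ _) (dis _) (sub _)).
  - move: (I2 _ _) (I2 _ _) (I2 _ _) (I2 _ _) => i1 i2 i3 i4; ring.
  - exact: subr.
  - exact: subl.
rewrite IS !I1_add// !I1B//.
move: (I2 _ _) (I2 _ _) (I2 _ _) (I2 _ _) => i1 i2 i3 i4.
move: I1 => I; rewrite !addrA; ring.
Qed.

(** Pigeonhole: four quarters with a defect below a fourth of the total could not add up to it. *)
Lemma defect_child a h : 0 <= h -> exists b, [/\ `|defect a h| <= 4 * `|defect b (h / 2)|,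
  a.1 <= b.1, b.1 + h / 2 <= a.1 + h, a.2 <= b.2 & b.2 + h / 2 <= a.2 + h].
Proof.
move=> h0; have k0 : 0 <= h / 2 by rewrite divr_ge0.
have := defect_split a k0; rewrite -splitr => E.
apply: contrapT => /forallNP H.
have K b : a.1 <= b.1 -> b.1 + h / 2 <= a.1 + h -> a.2 <= b.2 -> b.2 + h / 2 <= a.2 + h ->
    `|defect b (h / 2)| < `|defect a h| / 4.
  move=> h1 h2 h3 h4; rewrite ltNge ler_pdivrMr// mulrC; apply/negP => h5.
  exact: (H b).
have k1 := K a ltac:(lra) ltac:(lra) ltac:(lra) ltac:(lra).
have k2 := K (a.1 + h / 2, a.2) ltac:(simpl; lra) ltac:(simpl; lra) ltac:(simpl; lra) ltac:(simpl; lra).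
have k3 := K (a.1, a.2 + h / 2) ltac:(simpl; lra) ltac:(simpl; lra) ltac:(simpl; lra) ltac:(simpl; lra).
have k4 := K (a.1 + h / 2, a.2 + h / 2) ltac:(simpl; lra) ltac:(simpl; lra) ltac:(simpl; lra) ltac:(simpl; lra).
have : `|defect a h| < `|defect a h|; last by rewrite ltxx.
rewrite {1}E; apply: (le_lt_trans (ler_normD _ _)).
have := ler_normD (defect a (h / 2) + defect (a.1 + h / 2, a.2) (h / 2)) (defect (a.1, a.2 + h / 2) (h / 2)).
have := ler_normD (defect a (h / 2)) (defect (a.1 + h / 2, a.2) (h / 2)).
lra.
Qed.

(** The affine parts of the fields at [p] contribute exactly the divergence at [p] times the area.
    The errors, in units of [e * h ^ 2], are 2 for each pair of opposite sides and 1 for the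
    integral. *)
Lemma defect_small p (e : R) : 0 < e -> exists2 d, 0 < d & forall a h, 0 <= h -> h < d ->
  a.1 <= p.1 <= a.1 + h -> a.2 <= p.2 <= a.2 + h -> `|defect a h| <= 5 * e * h ^+ 2.
Proof.
move=> e0.
have [d1 d10 H1] := eps_diff2 (dX1 p) e0.
have [d2 d20 H2] := eps_diff2 (dX2 p) e0.
have /cvgrPdist_le/(_ _ e0)/nbhs_ballP[d3 /= d30 H3] := cc (x := p).
exists (Num.min d1 (Num.min d2 d3)); first by rewrite !lt_min d10 d20.
move=> a h h0; rewrite !lt_min => /andP[hd1 /andP[hd2 hd3]] /andP[p1 p2] /andP[p3 p4].
have near_p x y : a.1 <= x <= a.1 + h -> a.2 <= y <= a.2 + h -> `|(x, y) - p| <= h.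
  move=> /andP[x1 x2] /andP[y1 y2].
  by rewrite prod_normE ge_max /= !ler_norml; apply/andP; split; apply/andP; split; lra.
have R1 x y : a.1 <= x <= a.1 + h -> a.2 <= y <= a.2 + h ->
    `|X1 (x, y) - X1 p - lin2 (dx X1 p) (dy X1 p) ((x, y) - p)| <= e * h.
  move=> hx hy; have n := near_p _ _ hx hy.
  have := H1 ((x, y) - p) (le_lt_trans n hd1); rewrite [p + _]addrC subrK => /le_trans; apply.
  by rewrite ler_wpM2l// ltW.
have R2 x y : a.1 <= x <= a.1 + h -> a.2 <= y <= a.2 + h ->
    `|X2 (x, y) - X2 p - lin2 (dx X2 p) (dy X2 p) ((x, y) - p)| <= e * h.
  move=> hx hy; have n := near_p _ _ hx hy.
  have := H2 ((x, y) - p) (le_lt_trans n hd2); rewrite [p + _]addrC subrK => /le_trans; apply.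
  by rewrite ler_wpM2l// ltW.
have T1 : `|I1 (fun y => X1 (a.1 + h, y) - X1 (a.1, y)) a.2 h - dx X1 p * h * h| <= 2 * e * h * h.
  apply: I1_near => // y /andP[y1 /ltW y2].
  have A := R1 (a.1 + h) y ltac:(lra) ltac:(lra).
  have B := R1 a.1 y ltac:(lra) ltac:(lra).
  have -> : X1 (a.1 + h, y) - X1 (a.1, y) - dx X1 p * h =
    (X1 (a.1 + h, y) - X1 p - lin2 (dx X1 p) (dy X1 p) ((a.1 + h, y) - p)) -
    (X1 (a.1, y) - X1 p - lin2 (dx X1 p) (dy X1 p) ((a.1, y) - p)).
    rewrite /lin2 /=; move: (X1 _) (X1 _) (X1 _) (dx _ _) (dy _ _) => u v w s t; ring.
  apply: (le_trans (ler_normB _ _)); lra.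
have T2 : `|I1 (fun x => X2 (x, a.2 + h) - X2 (x, a.2)) a.1 h - dy X2 p * h * h| <= 2 * e * h * h.
  apply: I1_near => // x /andP[y1 /ltW y2].
  have A := R2 x (a.2 + h) ltac:(lra) ltac:(lra).
  have B := R2 x a.2 ltac:(lra) ltac:(lra).
  have -> : X2 (x, a.2 + h) - X2 (x, a.2) - dy X2 p * h =
    (X2 (x, a.2 + h) - X2 p - lin2 (dx X2 p) (dy X2 p) ((x, a.2 + h) - p)) -
    (X2 (x, a.2) - X2 p - lin2 (dx X2 p) (dy X2 p) ((x, a.2) - p)).
    rewrite /lin2 /=; move: (X2 _) (X2 _) (X2 _) (dx _ _) (dy _ _) => u v w s t; ring.
  apply: (le_trans (ler_normB _ _)); lra.
have aS : fine (area (square a h)) = h * h.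
  rewrite /square area_rect// !lebesgue_measure_itv /= !lte_fin !ltrDl.
  case: ltP => [_|h0'] /=; first by rewrite ![_ + h]addrC !addrK.
  have -> : h = 0 by apply/le_anti; rewrite h0 h0'.
  by rewrite !mulr0.
have Sp : square a h `<=` box p h by apply: square_sub_box => //; apply/andP.
have mS := pmset_square a h.
have iS : intg (square a h) c by exact: intg_rect Sp.
have icst (k : R) : intg (square a h) (fun=> k).
  apply: (@intg_bounded _ _ _ `|k|) => //; first exact: area_bounded Sp.
  exact: measurable_cst.
have T3 : `|I2 (square a h) c - c p * h * h| <= e * h * h.
  rewrite -!mulrA -!aS -!I2_cst// -I2B//.
  have iB := intgB mS iS (icst (c p)).
  apply: (le_trans (norm_I2 mS iB)); apply: le_I2 => //; first exact: intg_norm.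
  move=> q /Sp qp; rewrite distrC; apply: H3; rewrite -ball_normE /= distrC.
  exact: le_lt_trans hd3.
have -> : defect a h = (I1 (fun y => X1 (a.1 + h, y) - X1 (a.1, y)) a.2 h - dx X1 p * h * h) +
  (I1 (fun x => X2 (x, a.2 + h) - X2 (x, a.2)) a.1 h - dy X2 p * h * h)
  - (I2 (square a h) c - c p * h * h).
  rewrite /defect [in RHS]/c; move: (I1 _ _ _) (I1 _ _ _) (I2 _ _) (dx _ _) (dy _ _) => u v w s t; ring.
apply: (le_trans (ler_normB _ _)).
have := ler_normD (I1 (fun y => X1 (a.1 + h, y) - X1 (a.1, y)) a.2 h - dx X1 p * h * h)
  (I1 (fun x => X2 (x, a.2 + h) - X2 (x, a.2)) a.1 h - dy X2 p * h * h).
rewrite expr2; lra.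
Qed.

(** Nested squares retaining a fraction at least [4 ^ -n] of the defect shrink to a point, where
    differentiability makes the defect negligible against the area [4 ^ -n * h ^ 2]. *)
Lemma defect0 a h : 0 < h -> defect a h = 0.
Proof.
move=> h0; apply/eqP; rewrite -normr_eq0 eq_le normr_ge0 andbT leNgt; apply/negP => E0.
have hn0 n : 0 < h / 2 ^+ n by rewrite divr_gt0// exprn_gt0.
pose next n b := sval (cid (defect_child b (ltW (hn0 n)))).
pose b := fix b n := if n is n'.+1 then next n' (b n') else a.
have hS n : h / 2 ^+ n.+1 = h / 2 ^+ n / 2 by rewrite exprSr invfM mulrA.
have bS n : [/\ `|defect (b n) (h / 2 ^+ n)| <= 4 * `|defect (b n.+1) (h / 2 ^+ n.+1)|,
  (b n).1 <= (b n.+1).1, (b n.+1).1 + h / 2 ^+ n.+1 <= (b n).1 + h / 2 ^+ n,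
  (b n).2 <= (b n.+1).2 & (b n.+1).2 + h / 2 ^+ n.+1 <= (b n).2 + h / 2 ^+ n].
  by rewrite !hS; exact: svalP (cid (defect_child (b n) (ltW (hn0 n)))).
have bE n : `|defect a h| <= 4 ^+ n * `|defect (b n) (h / 2 ^+ n)|.
  elim: n => [|n IH]; first by rewrite !expr0 divr1 mul1r.
  apply: (le_trans IH); rewrite exprSr -mulrA ler_wpM2l ?exprn_ge0//.
  by have [] := bS n.
have lim (u : nat -> R) : (forall n, u n <= u n.+1) ->
    (forall n, u n.+1 + h / 2 ^+ n.+1 <= u n + h / 2 ^+ n) ->
    exists l, forall n, u n <= l <= u n + h / 2 ^+ n.
  move=> u1 u2.
  have ui : nondecreasing_seq u by apply/nondecreasing_seqP.
  have vd : nonincreasing_seq (fun n => u n + h / 2 ^+ n) by apply/nonincreasing_seqP.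
  have uv n m : u n <= u m + h / 2 ^+ m.
    have [nm|/ltnW mn] := leqP n m.
      by apply: (le_trans (ui _ _ nm)); rewrite lerDl ltW.
    by apply: le_trans (vd _ _ mn); rewrite lerDl ltW.
  have cu : cvgn u by apply: nondecreasing_is_cvgn => //; exists (u 0%N + h / 2 ^+ 0) => _ [n _ <-]; exact: uv.
  exists (limn u) => n; rewrite nondecreasing_cvgn_le//=.
  by apply: limr_le => //; near=> m; exact: uv.
have [p1 P1] := lim (fun n => (b n).1) (fun n => let: And5 _ h1 _ _ _ := bS n in h1) (fun n => let: And5 _ _ h1 _ _ := bS n in h1).
have [p2 P2] := lim (fun n => (b n).2) (fun n => let: And5 _ _ _ h1 _ := bS n in h1) (fun n => let: And5 _ _ _ _ h1 := bS n in h1).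
(* Chosen so that [5 * e * h ^ 2] is half of the initial defect. *)
pose e := `|defect a h| / (10 * h ^+ 2).
have e0 : 0 < e by rewrite divr_gt0// mulr_gt0// exprn_gt0.
have [d d0 Hd] := defect_small (p1, p2) e0.
have [n nd] : exists n, h / 2 ^+ n < d.
  have : (fun n => h * (2^-1 : R) ^+ n) @ \oo --> (0 : R).
    rewrite -(mulr0 h); apply: cvgM; first exact: cvg_cst.
    by apply: cvg_expr; rewrite ger0_norm ?invr_ge0// invf_lt1// ltr1n.
  move=> /cvgrPdist_lt/(_ _ d0)[n _ /(_ n (leqnn n))].
  rewrite sub0r normrN ger0_norm; last by rewrite mulr_ge0 ?(ltW h0)// exprn_ge0// invr_ge0.
  by exists n; rewrite -exprVn.
have := bE n; apply/negP; rewrite -ltNge.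
have := Hd (b n) _ (ltW (hn0 n)) nd (P1 n) (P2 n).
move=> /(ler_wpM2l (exprn_ge0 n (ltW (ltr0Sn R 3)))) /le_lt_trans; apply.
have -> : 4 ^+ n * (5 * e * (h / 2 ^+ n) ^+ 2) = 5 * e * h ^+ 2.
  have -> : 4 ^+ n = (2 ^+ n) ^+ 2 :> R by rewrite -exprM mulnC exprM expr2 -natrM.
  by field; rewrite expf_neq0// pnatr_eq0.
have -> : 5 * e * h ^+ 2 = `|defect a h| / 2.
  by rewrite /e; field; exact: lt0r_neq0.
by rewrite ltr_pdivrMr// ltr_pMr// ltr1n.
Unshelve. all: by end_near. Qed.

(* Only the divergence is assumed continuous, not the partial derivatives: the
   defect of the divergence theorem is bounded by bisection, as in Goursat's
   lemma.  This covers functions that are merely complex differentiable. *)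
Theorem divergence_integral0 (M : R) :
  (forall p, M < `|p| -> X1 p = 0) -> (forall p, M < `|p| -> X2 p = 0) ->
  I2 setT c = 0.
Proof.
wlog M0 : M / 0 <= M.
  move=> H z1 z2; apply: (H `|M|) => // p Mp; [apply: z1|apply: z2];
    exact: le_lt_trans (ler_norm M) Mp.
move=> z1 z2.
(* A square with margin 1 around the support: both fields vanish on its sides. *)
pose a : R * R := (- (M + 1), - (M + 1)); pose h := 2 * (M + 1).
have h0 : 0 < h by rewrite mulr_gt0// ltr_wpDl.
have out1 x y : `|x| = M + 1 -> M < `|((x, y) : R * R)|.
  by move=> xM; apply: lt_le_trans (norm_fst_le _); rewrite /= xM ltrDl.
have out2 x y : `|y| = M + 1 -> M < `|((x, y) : R * R)|.
  by move=> xM; apply: lt_le_trans (norm_snd_le _); rewrite /= xM ltrDl.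
have nM : `|M + 1| = M + 1 by rewrite ger0_norm// addr_ge0.
have ah : - (M + 1) + h = M + 1 by rewrite /h; ring.
have := defect0 a h0; rewrite /defect /= ah.
have -> : (fun y => X1 (M + 1, y) - X1 (- (M + 1), y)) = cst 0.
  by apply/funext => y; rewrite !z1 ?subrr//; apply: out1; rewrite ?normrN nM.
have -> : (fun x => X2 (x, M + 1) - X2 (x, - (M + 1))) = cst 0.
  by apply/funext => y; rewrite !z2 ?subrr//; apply: out2; rewrite ?normrN nM.
rewrite /I1 !Rintegral_cst// !mul0r add0r sub0r => /eqP; rewrite oppr_eq0 => /eqP <-.
apply: I2_restrict => //; [exact: measurableT|exact: pmset_square|].
move=> p _ pS.
have Mp : M < `|p|.
  rewrite ltNge; apply/negP => pM; apply: pS.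
  have := le_trans (norm_fst_le p) pM; have := le_trans (norm_snd_le p) pM.
  rewrite !ler_norml => /andP[? ?] /andP[? ?].
  by split; rewrite /= in_itv /= ah; apply/andP; split; lra.
have oM : \near p, M < `|p|.
  have : open [set q : R * R | M < `|q|].
    apply: (@open_comp _ _ (fun q : R * R => `|q|) [set x | M < x]); last exact: open_gt.
    by move=> q _; exact: norm_continuous.
  by rewrite openE; apply.
have [_ [E1 _]] : has_partials X1 p 0 0.
  by apply: near_has_partials (has_partials_cst 0 p); apply: filterS oM => q /z1 ->.
have [_ [_ E2]] : has_partials X2 p 0 0.
  by apply: near_has_partials (has_partials_cst 0 p); apply: filterS oM => q /z2 ->.
by rewrite /c E1 E2 addr0.
Qed.

End Divergence.

(** * Convolution *)

Section Convolution.
Context {R : realType} d (T : measurableType d) (mu : {sigma_finite_measure set T -> \bar R}).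
Local Notation P2 := (measurableTypeR R * measurableTypeR R)%type.
Variables (g : T -> R * R) (m : T -> R).
Hypothesis mg : measurable_fun setT (g : T -> P2).
Hypothesis im : mu.-integrable setT (EFin \o m).
Implicit Types (phi a : R * R -> R) (z h : R * R).

(* The convolution of [phi] with the image under [g] of the measure [m dmu]. *)
Definition mconv phi z : R := \int[mu]_t (phi (z - g t) * m t).

Let L1m : R := \int[mu]_t `|m t|.

Lemma measurable_translate phi z : continuous phi ->
  measurable_fun setT (fun t => phi (z - g t)).
Proof.
move=> cphi; have mphi : pmfun setT phi.
  by apply: continuous_pmfun => [|p _]; [exact: openT|exact: cphi].
apply: (@measurableT_comp _ _ _ _ _ _ (phi : P2 -> R) _ (fun t => z - g t : P2)) => //.
have [m1 m2] : measurable_fun setT (fun t => (g t).1) /\ measurable_fun setT (fun t => (g t).2).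
  by split; [exact: (measurableT_comp measurable_fst mg)|exact: (measurableT_comp measurable_snd mg)].
apply: (@measurable_fun_pair _ _ _ _ _ _ (fun t => z.1 - (g t).1) (fun t => z.2 - (g t).2)).
  by apply: measurable_funB => //; exact: measurable_cst.
by apply: measurable_funB => //; exact: measurable_cst.
Qed.

Lemma integrable_bounded_mul (f : T -> R) (M : R) : measurable_fun setT f ->
  (forall t, `|f t| <= M) -> mu.-integrable setT (EFin \o (fun t => f t * m t)).
Proof.
move=> mf fM.
have iM : mu.-integrable setT (EFin \o (fun t => M * `|m t|)).
  exact (integrableZl measurableT M (integrable_norm im)).
apply: le_integrable iM => //.
  by apply/measurable_EFinP/measurable_funM => //; move/measurable_int: im => /measurable_EFinP.
move=> t _ /=; rewrite lee_fin normrM (le_trans _ (ler_norm _))// ler_wpM2r//.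
Qed.

Lemma mconv_integrable phi (M : R) z : continuous phi -> (forall p, `|phi p| <= M) ->
  mu.-integrable setT (EFin \o (fun t => phi (z - g t) * m t)).
Proof. by move=> cphi phiM; apply: integrable_bounded_mul; first exact: measurable_translate. Qed.

Lemma norm_integral_bounded (f : T -> R) (M : R) : measurable_fun setT f ->
  (forall t, `|f t| <= M) -> `|\int[mu]_t (f t * m t)| <= M * L1m.
Proof.
move=> mf fM; have if_ := integrable_bounded_mul mf fM.
apply: (le_trans (le_normr_Rintegral _ _)) => //.
rewrite -RintegralZl//; last exact: integrable_norm.
apply: le_Rintegral => //; first exact: integrable_norm.
  exact (integrableZl measurableT M (integrable_norm im)).
by move=> t _; rewrite normrM ler_wpM2r.
Qed.

Lemma mconv_bounded phi (M : R) z : continuous phi -> (forall p, `|phi p| <= M) ->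
  `|mconv phi z| <= M * L1m.
Proof. by move=> cphi phiM; apply: norm_integral_bounded; first exact: measurable_translate. Qed.

Lemma integral_lin4 (k l : R) (f0 f1 f2 f3 : T -> R) :
  mu.-integrable setT (EFin \o f0) -> mu.-integrable setT (EFin \o f1) ->
  mu.-integrable setT (EFin \o f2) -> mu.-integrable setT (EFin \o f3) ->
  \int[mu]_t f0 t - \int[mu]_t f1 t - (\int[mu]_t f2 t * k + \int[mu]_t f3 t * l) =
  \int[mu]_t (f0 t - f1 t - (f2 t * k + f3 t * l)).
Proof.
move=> i0 i1 i2 i3.
have Z (f : T -> R) r : mu.-integrable setT (EFin \o f) ->
    mu.-integrable setT (EFin \o (fun t => f t * r)).
  by move=> if_; exact (integrableZr measurableT r if_).
rewrite -!RintegralZr// -RintegralD//; [|exact: Z|exact: Z].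
rewrite -RintegralB// -RintegralB//; first exact (integrableB measurableT i0 i1).
exact (integrableD measurableT (Z _ k i2) (Z _ l i3)).
Qed.

(** The uniform Taylor remainder integrates to a quadratic one, with constant [M * L1m]. *)
Lemma mconv_partials Omega phi z : test_function Omega phi ->
  has_partials (mconv phi) z (mconv (dx phi) z) (mconv (dy phi) z).
Proof.
move=> tp; have [M M0 HM] := test_taylor tp.
have [B _ HB] := test_bounded tp.
have [B1 _ HB1] := test_bounded (test_dx tp).
have [B2 _ HB2] := test_bounded (test_dy tp).
have c0 := test_continuous tp; have c1 := test_continuous (test_dx tp).
have c2 := test_continuous (test_dy tp).
apply: (@quadratic_diff2 _ _ _ _ _ (M * L1m)) => h.
have i0 := mconv_integrable (z + h) c0 HB; have i1 := mconv_integrable z c0 HB.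
have i2 := mconv_integrable z c1 HB1; have i3 := mconv_integrable z c2 HB2.
have E : mconv phi (z + h) - mconv phi z - lin2 (mconv (dx phi) z) (mconv (dy phi) z) h =
  \int[mu]_t ((phi (z - g t + h) - phi (z - g t) - lin2 (dx phi (z - g t)) (dy phi (z - g t)) h) * m t).
  apply: etrans (integral_lin4 h.1 h.2 i0 i1 i2 i3) _.
  apply: eq_Rintegral => t _; rewrite [z + h - _]addrAC.
  have alg (u v w x n k l : R) : u * n - v * n - (w * n * k + x * n * l) =
    (u - v - (w * k + x * l)) * n by ring.
  exact: alg.
rewrite E mulrAC; apply: norm_integral_bounded; last by move=> t; exact: HM.
apply: measurable_funB; first apply: measurable_funB.
- have := measurable_translate (z + h) c0; congr (measurable_fun _ _).
  by apply/funext => t; rewrite addrAC.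
- exact: measurable_translate.
- apply: measurable_funD; apply: measurable_funM; try exact: measurable_cst; exact: measurable_translate.
Qed.

Lemma mconv_smooth phi : test_function setT phi -> smooth_on setT (mconv phi).
Proof.
move=> tp; pose A := [set f | exists2 psi, test_function setT psi & f = mconv psi].
apply: (@smooth_partials _ A); [exact: openT| |by exists phi].
move=> _ [psi tpsi ->]; exists (mconv (dx psi)), (mconv (dy psi)); split.
- by exists (dx psi) => //; exact: test_dx.
- by exists (dy psi) => //; exact: test_dy.
- by move=> z _; exact: mconv_partials tpsi.
Qed.

(** Moves the convolution to the other factor; the double integral converges absolutely because
    [phi] is bounded while [a] and [m] are integrable. *)
Lemma mconv_fubini phi (M : R) a : continuous phi -> (forall p, `|phi p| <= M) ->
  intg setT a ->
  I2 setT (fun z => a z * mconv phi z) =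
  \int[mu]_t (I2 setT (fun z => a z * phi (z - g t)) * m t).
Proof.
move=> cphi phiM ia.
have M0 : 0 <= M by apply: le_trans (phiM 0).
pose F (zt : P2 * T) : \bar R := (a zt.1 * phi (zt.1 - g zt.2) * m zt.2)%:E.
have ma : measurable_fun setT (a : P2 -> R) by exact: intg_pmfun.
have mm : measurable_fun setT m by move/measurable_int: im => /measurable_EFinP.
have mF : measurable_fun setT F.
  apply/measurable_EFinP/measurable_funM; last exact: (measurableT_comp mm measurable_snd).
  apply: measurable_funM; first exact: (measurableT_comp ma measurable_fst).
  have mphi : pmfun setT phi.
    by apply: continuous_pmfun => [|p _]; [exact: openT|exact: cphi].
  apply: (@measurableT_comp _ _ _ _ _ _ (phi : P2 -> R) _ (fun zt : P2 * T => zt.1 - g zt.2 : P2)) => //.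
  have f1 : measurable_fun setT (fun zt : P2 * T => (zt.1.1 : R)).
    exact: (measurableT_comp measurable_fst measurable_fst).
  have f2 : measurable_fun setT (fun zt : P2 * T => (zt.1.2 : R)).
    exact: (measurableT_comp measurable_snd measurable_fst).
  have mg2 := measurableT_comp mg (measurable_snd (T1 := P2)).
  have g1 : measurable_fun setT (fun zt : P2 * T => ((g zt.2).1 : R)).
    exact: (measurableT_comp measurable_fst mg2).
  have g2 : measurable_fun setT (fun zt : P2 * T => ((g zt.2).2 : R)).
    exact: (measurableT_comp measurable_snd mg2).
  apply: (@measurable_fun_pair _ _ _ _ _ _ (fun zt : P2 * T => zt.1.1 - (g zt.2).1) (fun zt => zt.1.2 - (g zt.2).2)).
    exact: measurable_funB.
  exact: measurable_funB.
have iF : (@lambda2 R \x mu)%E.-integrable setT F.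
  apply/integrable12ltyP => //.
  apply: (@le_lt_trans _ _ (\int[@lambda2 R]_z (M * L1m * `|a z|)%:E)%E); last first.
    have : intg setT (fun z => M * L1m * `|a z|).
      by apply: intgZ; [exact: measurableT|apply: intg_norm => //; exact: measurableT].
    by move/integrable_lty => H; apply: H; exact: measurableT.
  apply: ge0_le_integral => //.
  - by move=> z _; apply: integral_ge0.
  - have maF : measurable_fun setT (abse \o F) by exact: measurableT_comp.
    exact (@measurable_fun_fubini_tonelli_F _ _ P2 T R mu (abse \o F) maF (fun zt => abse_ge0 _)).
  - by apply/measurable_EFinP/measurable_funM => //; exact: measurableT_comp.
  - move=> z _ /=.
    have iz := integrableZl measurableT (M * `|a z|) (integrable_norm im).
    apply: (@le_trans _ _ (\int[mu]_t ((M * `|a z|)%:E * `|m t|%:E))%E).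
      apply: ge0_le_integral => //.
      + have mFz : measurable_fun setT (fun t => F (z, t)) by exact: (measurable_fun_pair2 z mF).
        apply/measurable_EFinP; apply: measurableT_comp => //.
        exact/measurable_EFinP.
      + have -> : (fun t => (M * `|a z|)%:E * `|m t|%:E)%E = EFin \o (fun t => M * `|a z| * `|m t|) by [].
        by apply/measurable_EFinP; apply: measurable_funM => //; exact: measurableT_comp.
      + by move=> t _; rewrite -EFinM lee_fin !normrM ler_wpM2r// mulrC ler_wpM2r.
    rewrite integralZl//; last exact: integrable_norm.
    rewrite [M * L1m * _]mulrAC [leRHS]EFinM /L1m /Rintegral fineK//.
    by apply: integrable_fin_num => //; exact: integrable_norm.
have := Fubini iF.
have E1 z : (\int[mu]_t F (z, t))%E = (a z * mconv phi z)%:E.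
  have ic := mconv_integrable z cphi phiM.
  rewrite /mconv -RintegralZl// /Rintegral fineK; last first.
    by apply: integrable_fin_num => //; exact (integrableZl measurableT (a z) ic).
  by apply: eq_integral => t _; rewrite /F /= mulrA.
have E2 t : (\int[@lambda2 R]_z F (z, t))%E = (I2 setT (fun z => a z * phi (z - g t)) * m t)%:E.
  have ic : intg setT (fun z => a z * phi (z - g t)).
    apply: (@intgM_bounded _ _ _ _ M) => //; first exact: measurableT.
    apply: continuous_pmfun => [|p _]; first exact: openT.
    apply: (@continuous_comp _ _ _ (fun z => z - g t) phi); last exact: cphi.
    by apply: (@continuousB _ _ _ id (cst (g t))); [exact: cvg_id|exact: cvg_cst].
  rewrite -[I2 _ _ * _]mulrC -I2Z//; last exact: measurableT.
  rewrite /I2 /Rintegral fineK; last first.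
    by apply: integrable_fin_num => //; exact (integrableZl measurableT (m t) ic).
  by apply: eq_integral => z _; rewrite /F /= mulrC.
under eq_integral do rewrite E1.
under [X in _ = X -> _]eq_integral do rewrite E2.
by move=> H; rewrite /I2 /Rintegral H.
Qed.

End Convolution.

(** * The common mass of the mollifiers *)

Section Mass.
Context {R : realType}.
Local Notation P2 := (measurableTypeR R * measurableTypeR R)%type.
Implicit Types (phi : R * R -> R) (z p q : R * R) (A B Omega : set (R * R)).

Lemma pmsetT : pmset (@setT (R * R)%type). Proof. exact: measurableT. Qed.

Lemma area_box_fin z (r : R) : (area (box z r) < +oo)%E.
Proof. by apply: (@area_bounded _ _ z r) => //; exact: pmset_box. Qed.

Lemma continuous_intg_compact A phi : compact A -> continuous phi -> intg A phi.
Proof.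
move=> cA cphi; have [M _ HM] := compact_norm_bounded cA (fun z _ => cphi z).
apply: (@intg_bounded _ _ _ M) => //; [exact: compact_pmset|exact: area_compact|].
apply: (@pmfun_sub _ setT) => //; first exact: pmsetT.
by apply: continuous_pmfun => [|z _]; [exact: openT|exact: cphi].
Qed.

Lemma intg_support A B phi : pmset A -> pmset B -> B `<=` A ->
  (forall p, A p -> ~ B p -> phi p = 0) -> intg B phi -> intg A phi.
Proof.
move=> mA mB BA p0 iB.
have iT : intg setT (phi \_ B).
  move: iB => /(iffLR (integrable_mkcond _ mB)); rewrite /intg.
  by congr (integrable _ _ _); rewrite restrict_EFin.
apply: (@intg_eq _ _ (phi \_ B)) => //.
  move=> p Ap; rewrite patchE; case: ifPn => // /negP; rewrite inE => nB.
  by rewrite p0.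
by apply: intg_sub iT => //; exact: pmsetT.
Qed.

Lemma test_intg Omega phi : test_function Omega phi -> intg setT phi.
Proof.
move=> tp; have [K [cK _ K0]] := test_functionE tp.
apply: (@intg_support _ K) => //; [exact: pmsetT|exact: compact_pmset|by move=> p _; exact: K0|].
by apply: continuous_intg_compact => //; exact: test_continuous tp.
Qed.

Lemma continuousD2 phi psi : continuous phi -> continuous psi ->
  continuous (fun z => phi z + psi z).
Proof. by move=> c1 c2 z; apply: cvgD; [exact: c1|exact: c2]. Qed.

Lemma test_divergence0 Omega phi psi : test_function Omega phi -> test_function Omega psi ->
  I2 setT (fun z => dx phi z + dy psi z) = 0.
Proof.
move=> t1 t2.
have [K1 [c1 _ K10]] := test_functionE t1; have [K2 [c2 _ K20]] := test_functionE t2.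
have [r1 r10 H1] := compact_sub_box c1; have [r2 r20 H2] := compact_sub_box c2.
apply: (@divergence_integral0 _ phi psi _ _ _ (r1 + r2)).
- by move=> p; have [] := test_has_partials p t1.
- by move=> p; have [] := test_has_partials p t2.
- by apply: continuousD2; apply: test_continuous; [exact: test_dx t1|exact: test_dy t2].
- move=> p pr; apply: K10 => /H1; rewrite /box /= subr0 leNgt => /negP; apply.
  by apply: lt_trans pr; rewrite ltrDl.
- move=> p pr; apply: K20 => /H2; rewrite /box /= subr0 leNgt => /negP; apply.
  by apply: lt_trans pr; rewrite ltrDr.
Qed.

Lemma test0 Omega : test_function Omega (fun _ : R * R => 0 : R).
Proof.
apply: (@test_functionP _ _ _ set0) => //; last exact: compact0.
by move=> k; exact: (Ck_on_cst k 0 openT).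
Qed.

Lemma test_dx_integral0 Omega phi : test_function Omega phi -> I2 setT (dx phi) = 0.
Proof.
move=> tp; rewrite -(test_divergence0 tp (test0 Omega)); apply: eq_I2 => p _.
by have [_ [_ ->]] := has_partials_cst (0 : R) p; rewrite addr0.
Qed.

Lemma test_dy_integral0 Omega phi : test_function Omega phi -> I2 setT (dy phi) = 0.
Proof.
move=> tp; rewrite -(test_divergence0 (test0 Omega) tp); apply: eq_I2 => p _.
by have [_ [-> _]] := has_partials_cst (0 : R) p; rewrite add0r.
Qed.

Lemma test_reflectT phi z : test_function setT phi ->
  test_function setT (fun q => phi (z - q)).
Proof.
move=> tp; have [K [cK _ K0]] := test_functionE tp.
have [r r0 Kr] := compact_sub_box cK.
apply: (@test_reflect _ _ _ _ r) => // v vr; apply: K0 => /Kr.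
by rewrite /box /= subr0 leNgt vr.
Qed.

Lemma reflect_partials phi z q : test_function setT phi ->
  has_partials (fun q => phi (z - q)) q (- dx phi (z - q)) (- dy phi (z - q)).
Proof. by move=> tp; apply: has_partials_reflect; exact: test_has_partials tp. Qed.

Lemma reflect_dx_integral0 phi z : test_function setT phi ->
  I2 setT (fun q => dx phi (z - q)) = 0.
Proof.
move=> tp; have t := test_reflectT z tp.
have <- : -1 * I2 setT (dx (fun q => phi (z - q))) = I2 setT (fun q => dx phi (z - q)).
  rewrite -I2Z; [|exact: pmsetT|exact: test_intg (test_dx t)].
  apply: eq_I2 => q _.
  by have [_ [-> _]] := reflect_partials z q tp; rewrite mulN1r opprK.
by rewrite (test_dx_integral0 t) mulr0.
Qed.

Lemma reflect_dy_integral0 phi z : test_function setT phi ->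
  I2 setT (fun q => dy phi (z - q)) = 0.
Proof.
move=> tp; have t := test_reflectT z tp.
have <- : -1 * I2 setT (dy (fun q => phi (z - q))) = I2 setT (fun q => dy phi (z - q)).
  rewrite -I2Z; [|exact: pmsetT|exact: test_intg (test_dy t)].
  apply: eq_I2 => q _.
  by have [_ [_ ->]] := reflect_partials z q tp; rewrite mulN1r opprK.
by rewrite (test_dy_integral0 t) mulr0.
Qed.

(** As a function of [z] the left side has zero gradient, derivatives of test functions having
    integral 0. Since [mconv] takes an integrable weight, the constant 1 is replaced by the
    indicator of a box large enough for every centre [p] with [|p| <= |z|]. *)
Lemma translate_integral phi z : test_function setT phi ->
  I2 setT (fun q => phi (z - q)) = I2 setT (fun q => phi (- q)).
Proof.
move=> tp; have [K [cK _ K0]] := test_functionE tp.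
have [d d0 Kd] := compact_sub_box cK.
have far f : test_function setT f -> (forall v, ~ K v -> f v = 0) ->
  forall p, `|p| <= `|z| ->
    @mconv R _ P2 (@lambda2 R) id \1_(box 0 (`|z| + d)) f p = I2 setT (fun q => f (p - q)).
  move=> tf f0 p pz; apply: eq_Rintegral => q _; rewrite indicE.
  have [_|] := boolP (q \in _); first by rewrite mulr1.
  rewrite notin_setE /box /= subr0 => /negP; rewrite -ltNge => zq.
  rewrite f0 ?mul0r// => /Kd; rewrite /box /= subr0 leNgt => /negP; apply.
  have := ler_normB p (p - q); rewrite opprB addrC subrK => h.
  lra.
have im : (@lambda2 R).-integrable setT (EFin \o \1_(box 0 (`|z| + d))).
  have : intg setT (\1_(box 0 (`|z| + d)) : R * R -> R).
    have mb : pmset (box (0 : R * R) (`|z| + d)) by exact: pmset_box.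
    apply: (@intg_support _ (box 0 (`|z| + d))) => //; first exact: pmsetT.
      by move=> p _ np; rewrite indicE memNset.
    apply: (@intg_bounded _ _ _ 1) => //.
      exact: area_box_fin.
    exact: measurable_indic.
    by move=> p _; rewrite indicE; case: (_ \in _); rewrite ?normr1 ?normr0.
  by [].
have mid : measurable_fun setT (id : P2 -> P2) by exact: measurable_id.
pose G := @mconv R _ P2 (@lambda2 R) id \1_(box 0 (`|z| + d)) phi.
have PG p := mconv_partials mid im p tp.
have dG p : differentiable G p by have [] := PG p.
have d0' f : (forall p, ~ closure [set p | phi p != 0] p -> f p = 0) -> forall p, ~ K p -> f p = 0.
  move=> f0 p Kp; apply: f0 => cp; apply: Kp.
  have /closure_id -> := compact_closed (@norm_hausdorff _ _) cK.
  by apply: closureS cp => y /= /eqP; apply: contra_notP; exact: K0.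
have H0 p : ~ closure [set p | phi p != 0] p -> has_partials phi p 0 0.
  move=> /(test_near0 tp) n0; apply: near_has_partials (has_partials_cst 0 p).
  by apply: filterS n0 => y ->.
have Gx p : `|p| <= `|z| -> dx G p = 0.
  move=> pz; have [_ [-> _]] := PG p; rewrite far//; first exact: reflect_dx_integral0.
    exact: test_dx.
  by apply: d0' => q /H0 [_ []].
have Gy p : `|p| <= `|z| -> dy G p = 0.
  move=> pz; have [_ [_ ->]] := PG p; rewrite far//; first exact: reflect_dy_integral0.
    exact: test_dy.
  by apply: d0' => q /H0 [_ []].
have <- : G z = I2 setT (fun q => phi (z - q)) by exact: far.
have -> : I2 setT (fun q => phi (- q)) = I2 setT (fun q => phi (0 - q)).
  by apply: eq_I2 => q _; rewrite sub0r.
have <- : G 0 = I2 setT (fun q => phi (0 - q)) by apply: far => //; rewrite normr0.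
(* The path from 0 to [z] through [(z.1, 0)] stays where the gradient of [G] is known to vanish. *)
have [c c1 c2] := MVT_x 0 z.1 dG.
have [e e1 e2] := MVT_y (z.1, 0) z.2 dG.
move: c1 c2 e1 e2; rewrite /= !subr0 !add0r -surjective_pairing => c1 c2 e1 e2.
apply/eqP; rewrite -subr_eq0 -[G z](subrK (G (z.1, 0))) -addrA e2 c2.
rewrite Gx; last by rewrite [leLHS]prod_normE ge_max /= normr0 normr_ge0 andbT (le_trans c1)// norm_fst_le.
rewrite Gy; last by rewrite [leLHS]prod_normE ge_max /= norm_fst_le (le_trans e1)// norm_snd_le.
by rewrite !mul0r addr0.
Qed.

(** Equal to 2 pi, the flux of [v / |v|^2] through a circle around the origin. *)
Definition mass : R := I2 setT (moll 1).

(** After a translation, the difference with [moll 1] is the divergence of the compactly supported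
    field [(kern1, kern2)]. *)
Lemma moll_mass (s : R) z : 0 < s -> I2 setT (fun q => moll s (q - z)) = mass.
Proof.
move=> s0.
have -> : I2 setT (fun q => moll s (q - z)) = I2 setT (fun q => moll s (z - q)).
  by apply: eq_I2 => q _; rewrite -moll_sym opprB.
rewrite translate_integral; last exact: test_moll.
have -> : I2 setT (fun q => moll s (- q)) = I2 setT (moll s).
  by apply: eq_I2 => q _; rewrite moll_sym.
apply/eqP; rewrite -subr_eq0 /mass -I2B; [|exact: pmsetT|exact: test_intg (test_moll s0)|exact: test_intg (test_moll ltr01)].
have [t1 t2] := test_kern s0 (@ltr01 R).
rewrite -(test_divergence0 t1 t2); apply/eqP; apply: eq_I2 => v _.
by have [->] := kern_partials v s0 (@ltr01 R).
Qed.

Lemma mass_gt0 : 0 < mass.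
Proof.
have [v v0] := @moll_gt0 R.
have cm : continuous (@moll R 1) := test_continuous (test_moll (@ltr01 R)).
have v2 : 0 < moll 1 v / 2 by rewrite divr_gt0.
have /cvgrPdist_le/(_ _ v2)/nbhs_ballP[r /= r0 Hr] := cm v.
have r2 : 0 < r / 2 by rewrite divr_gt0.
have mB := @pmset_box R v (r / 2).
have aB : (area (box v (r / 2)) < +oo)%E by exact: area_box_fin.
have ic : intg (box v (r / 2)) (fun=> moll 1 v / 2).
  by apply: (@intg_bounded _ _ _ `|moll 1 v / 2|) => //; exact: measurable_cst.
have iB : intg (box v (r / 2)) (moll 1).
  by apply: continuous_intg_compact => //; exact: compact_box.
apply: (@lt_le_trans _ _ (I2 (box v (r / 2)) (fun=> moll 1 v / 2))).
  rewrite I2_cst// area_box ?(ltW r2)//= mulr_gt0//.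
  by rewrite exprn_gt0// mulr_gt0.
apply: (@le_trans _ _ (I2 (box v (r / 2)) (moll 1))).
  apply: le_I2 => // p pv.
  have /Hr : ball v r p.
    rewrite -ball_normE /= distrC; apply: (le_lt_trans pv).
    by rewrite ltr_pdivrMr// ltr_pMr// ltr1n.
  rewrite ler_distl => /andP[h1 h2]; lra.
have -> : I2 (box v (r / 2)) (moll 1) = I2 setT ((moll 1) \_ (box v (r / 2))).
  exact: Rintegral_mkcond.
apply: le_I2.
- exact: pmsetT.
- apply: (@intg_support _ (box v (r / 2))) => //; first exact: pmsetT.
    by move=> p _ np; rewrite patchE memNset.
  by apply: intg_eq iB => // p pB; rewrite patchE mem_set.
- exact: test_intg (test_moll ltr01).
- by move=> p _; rewrite patchE; case: ifPn => // _; exact: moll_ge0.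
Qed.

(** The mollifier is nonnegative and vanishes beyond distance [d], so only the oscillation of [a]
    within [d] of [z] counts. *)
Lemma moll_approx (s d e : R) (a : R * R -> R) z : 0 < s -> 0 < d -> 2 <= s * d ^+ 2 ->
  intg setT a -> (forall q, `|q - z| <= d -> `|a q - a z| <= e) ->
  `|I2 setT (fun q => a q * moll s (q - z)) - mass * a z| <= e * mass.
Proof.
move=> s0 d0 sd ia He.
have tm := test_moll s0.
have [M _ HM] := test_bounded tm.
have E q : moll s (q - z) = moll s (z - q) by rewrite -moll_sym opprB.
have tr := test_reflectT z tm.
have im : intg setT (fun q => moll s (q - z)).
  by apply: intg_eq (test_intg tr) => [|q _]; [exact: pmsetT|rewrite E].
have iam : intg setT (fun q => a q * moll s (q - z)).
  apply: (@intgM_bounded _ _ _ _ M) => //; first exact: pmsetT.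
  exact: intg_pmfun im.
have icm : intg setT (fun q => a z * moll s (q - z)) by apply: intgZ => //; exact: pmsetT.
have -> : mass * a z = I2 setT (fun q => a z * moll s (q - z)).
  by rewrite I2Z ?moll_mass//; [rewrite mulrC|exact: pmsetT].
have -> : e * mass = I2 setT (fun q => e * moll s (q - z)).
  by rewrite I2Z ?moll_mass//; exact: pmsetT.
rewrite -I2B//; last exact: pmsetT.
have iB := intgB pmsetT iam icm.
apply: (le_trans (norm_I2 pmsetT iB)); apply: le_I2; first exact: pmsetT.
- by apply: intg_norm => //; exact: pmsetT.
- by apply: intgZ => //; exact: pmsetT.
- move=> q _; rewrite -mulrBl normrM (ger0_norm (moll_ge0 _ (ltW s0))).
  have [qz|qz] := leP `|q - z| d; first by apply: ler_wpM2r; [exact: moll_ge0 (ltW s0)|exact: He].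
  by rewrite (moll_far s0 d0 sd qz) !mulr0.
Qed.

End Mass.

(** * The fundamental lemma of the calculus of variations *)

Section Fundamental.
Context {R : realType}.
Local Notation P2 := (measurableTypeR R * measurableTypeR R)%type.
Implicit Types (g phi : R * R -> R) (z p q : R * R) (A B Omega : set (R * R)).

(** Since [flat 0 (k * t)] is [exp (- 1 / (k * t))] for positive [t], these converge pointwise to
    the indicator of []a, b[], with values in [[0, 1]]. *)
Definition bump (k : nat) (a b x : R) : R :=
  flat 0 (k.+1%:R * (x - a)) * flat 0 (k.+1%:R * (b - x)).

Lemma bump_ge0 k a b x : 0 <= bump k a b x.
Proof. by rewrite mulr_ge0 ?flat_ge0. Qed.

Lemma bump_le1 k a b x : bump k a b x <= 1.
Proof. by rewrite mulr_ile1 ?flat_ge0 ?flat0_le1. Qed.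

Lemma bump_eq0 k a b x : ~ (a < x < b) -> bump k a b x = 0.
Proof.
move=> /negP; rewrite negb_and -!leNgt => /orP[xa|bx].
  by rewrite /bump flat_eq0 ?mul0r// mulr_ge0_le0// subr_le0.
by rewrite /bump (@flat_eq0 _ _ (_ * (b - x))) ?mulr0// mulr_ge0_le0// subr_le0.
Qed.

Lemma flat_cvg1 (t : R) : 0 < t -> flat 0 (k.+1%:R * t) @[k --> \oo] --> (1 : R).
Proof.
move=> t0.
have -> : (fun k => flat 0 (k.+1%:R * t)) = (fun k : nat => expR (- (k.+1%:R^-1 * t^-1))).
  by apply/funext => k; rewrite /flat mulr_gt0// expr0 mul1r invfM.
have h : (fun k : nat => - (k.+1%:R^-1 * t^-1)) @ \oo --> (0 : R).
  rewrite -oppr0 -(mul0r t^-1); apply: cvgN; apply: (@cvgM _ _ _ _ (@harmonic R) (cst t^-1)).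
    exact: cvg_harmonic.
  exact: cvg_cst.
by have := cvg_comp _ _ h (@continuous_expR R 0); rewrite expR0.
Qed.

Lemma bump_cvg (a b x : R) : bump k a b x @[k --> \oo] --> ((a < x < b)%R%:R : R).
Proof.
have [/andP[ax xb]|xab] := boolP (a < x < b).
  rewrite -[1%:R]mulr1 /bump; apply: cvgM; apply: flat_cvg1; by rewrite subr_gt0.
have -> : (fun k => bump k a b x) = cst 0.
  by apply/funext => k; apply: bump_eq0; exact/negP.
exact: cvg_cst.
Qed.

Definition bump2 k (a b c d : R) p : R := bump k a b p.1 * bump k c d p.2.

Lemma bump2_eq0 k (a b c d : R) p : ~ (`]a, b[ `*` `]c, d[) p -> bump2 k a b c d p = 0.
Proof.
move=> np; rewrite /bump2.
have [p1|/negP p1] := boolP (a < p.1 < b); last by rewrite (bump_eq0 k p1) mul0r.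
have [p2|/negP p2] := boolP (c < p.2 < d); last by rewrite (bump_eq0 k p2) mulr0.
by exfalso; apply: np; split; rewrite /= in_itv.
Qed.

Lemma norm_bump2_le1 k (a b c d : R) p : `|bump2 k a b c d p| <= 1.
Proof.
have g0 := @bump_ge0; have l1 := @bump_le1.
by rewrite /bump2 ger0_norm; [exact: mulr_ile1|exact: mulr_ge0].
Qed.

Lemma smooth_bump2 k a b c d : smooth_on setT (bump2 k a b c d).
Proof.
move=> n.
have H (f : R * R -> R) (u v : R) : Ck_on setT n f -> Ck_on setT n (fun p => flat 0 (u * (f p + v))).
  move=> cf; apply: (Ck_on_flat _ openT); apply: Ck_onM; [exact: openT|exact: (Ck_on_cst _ _ openT)|].
  by apply: Ck_onD; [exact: openT|exact: cf|exact: (Ck_on_cst _ _ openT)].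
have H' (f : R * R -> R) (u v : R) : Ck_on setT n f -> Ck_on setT n (fun p => flat 0 (u * (v - f p))).
  move=> cf; apply: (Ck_on_flat _ openT); apply: Ck_onM; [exact: openT|exact: (Ck_on_cst _ _ openT)|].
  by apply: Ck_onB; [exact: openT|exact: (Ck_on_cst _ _ openT)|exact: cf].
have c1 := Ck_on_fst n (@openT (R * R)%type); have c2 := Ck_on_snd n (@openT (R * R)%type).
apply: Ck_onM; first exact: openT; apply: Ck_onM; try exact: openT.
- exact: H.
- exact: H'.
- exact: H.
- exact: H'.
Qed.

Lemma test_bump2 Omega k a b c d : `[a, b] `*` `[c, d] `<=` Omega ->
  test_function Omega (bump2 k a b c d).
Proof.
move=> sub; apply: (test_functionP (@smooth_bump2 k a b c d) _ sub).
  by apply: compact_setX; exact: segment_compact.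
move=> p np; apply: bump2_eq0 => -[p1 p2]; apply: np; split; move: p1 p2; rewrite /= !in_itv /=.
  by move=> /andP[h1 h2] _; rewrite !ltW.
by move=> _ /andP[h1 h2]; rewrite !ltW.
Qed.

(** The sets over whose preimage the integral vanishes form a Dynkin system. The map [f] will be a
    coordinate or the identity. *)
Lemma dynkin_integral0 d (T : measurableType d) (G : set (set T)) (f : P2 -> T)
    (D : set (R * R)) g :
  @measurable _ T = <<s G >> -> setI_closed G -> pmset D -> intg D g ->
  measurable_fun setT f -> I2 D g = 0 ->
  (forall S, G S -> I2 (D `&` f @^-1` S) g = 0) ->
  forall S, measurable S -> I2 (D `&` f @^-1` S) g = 0.
Proof.
move=> GE GI mD ig mf g0 HG S mS.
have mpre U : measurable U -> pmset (D `&` f @^-1` U).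
  move=> mU; apply: measurableI => //; rewrite -[_ @^-1` _]setTI; exact: mf.
have iS U : measurable U -> intg (D `&` f @^-1` U) g.
  by move=> mU; apply: intg_sub ig => //; exact: mpre.
have E0 U : measurable U -> I2 (D `&` f @^-1` U) g = 0 ->
    (\int[@lambda2 R]_(p in D `&` f @^-1` U) (g p)%:E = 0)%E.
  move=> mU; rewrite /I2 /Rintegral => h.
  by rewrite -[LHS]fineK ?h//; apply: integrable_fin_num; [exact: mpre|exact: iS].
suff : I2 (D `&` f @^-1` S) g = 0 by [].
apply: (dynkin_induction (P := fun U => I2 (D `&` f @^-1` U) g = 0) GE GI) => //.
- by rewrite preimage_setT setIT.
- move=> U mU U0.
  have := g0; rewrite -{1}(setIT D) -(setvU (f @^-1` U)) setIUr /I2 Rintegral_setU.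
  + by rewrite -/(I2 _ _) -/(I2 (D `&` f @^-1` U) g) U0 addr0 preimage_setC.
  + by have := mpre _ (measurableC mU); rewrite preimage_setC.
  + exact: mpre.
  + by rewrite -setIUr setvU setIT.
  + by apply/disj_setPS => p [[_ h1] [_ h2]].
- move=> F mF tF F0.
  rewrite preimage_bigcup setI_bigcupr /I2 /Rintegral integral_bigcup.
  + by rewrite eseries0// => n _ _; apply: E0.
  + apply/trivIsetP => i j _ _ ij; apply/disj_set2P/disj_setPS => p [[_ h1] [_ h2]].
    by move/trivIsetP: tF => /(_ i j I I ij) /disj_set2P/disj_setPS/(_ (f p)); apply.
  + by move=> n; exact: mpre.
  + rewrite -setI_bigcupr -preimage_bigcup; apply: iS.
    exact: bigcupT_measurable.
- by rewrite -GE.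
Qed.

(** The functions [bump2] tend boundedly to the indicator of the open rectangle; dominated
    convergence applies with bound [|g|]. *)
Lemma box_test_integral0 Omega g z r : pmset Omega -> 0 < r -> box z r `<=` Omega ->
  intg (box z r) g ->
  (forall phi, test_function Omega phi -> I2 Omega (fun p => g p * phi p) = 0) ->
  forall a b c d, `[a, b] `*` `[c, d] `<=` box z r -> I2 (`]a, b[ `*` `]c, d[) g = 0.
Proof.
move=> mO r0 zO ig Hg a b c d sub.
have mb := @pmset_box R z r.
have mQ : pmset (`]a, b[ `*` `]c, d[) by apply: pmset_rect.
have Qsub : `]a, b[ `*` `]c, d[ `<=` box z r.
  move=> p [p1 p2]; apply: sub; split; move: p1 p2; rewrite /= !in_itv /=.
    by move=> /andP[h1 h2] _; rewrite !ltW.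
  by move=> _ /andP[h1 h2]; rewrite !ltW.
have F0 k : I2 (box z r) (fun p => g p * bump2 k a b c d p) = 0.
  rewrite -(Hg (bump2 k a b c d)); last by apply: test_bump2; apply: subset_trans zO.
  apply/esym; apply: I2_restrict => // p _ np.
  by rewrite bump2_eq0 ?mulr0// => /Qsub.
have mg := intg_pmfun ig.
have := @dominated_convergence _ _ _ (@lambda2 R) (box z r) mb
  (fun k p => (g p * bump2 k a b c d p)%:E)
  (fun p => (g p * (\1_(`]a, b[ `*` `]c, d[) p))%:E) (fun p => `|g p|%:E).
case.
- move=> k; apply/measurable_EFinP/measurable_funM => //.
  apply: (@pmfun_sub _ setT) => //; first exact: measurableT.
  by apply: continuous_pmfun => [|p _]; [exact: openT|exact: smooth_continuous (@smooth_bump2 k a b c d) _].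
- apply/measurable_EFinP/measurable_funM => //; exact: measurable_indic.
- apply: aeW => p _ /=; apply: cvg_EFin; first by near=> k.
  apply: cvgM; first exact: cvg_cst.
  have -> : \1_(`]a, b[ `*` `]c, d[) p = (a < p.1 < b)%R%:R * (c < p.2 < d)%R%:R :> R.
    by rewrite indicE in_setX !mem_setE !in_itv /= -natrM mulnb.
  by apply: cvgM; exact: bump_cvg.
- exact: intg_norm.
- apply: aeW => p k _; rewrite /= lee_fin normrM ler_piMr//.
  exact: norm_bump2_le1.
move=> _ _ H.
have iQ : intg (box z r) (fun p => g p * \1_(`]a, b[ `*` `]c, d[) p).
  apply: (@intgM_bounded _ _ _ _ 1) => //; first exact: measurable_indic.
  by move=> p _; rewrite indicE; case: (_ \in _); rewrite ?normr1 ?normr0.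
have E : (\int[@lambda2 R]_(p in box z r) (g p * \1_(`]a, b[ `*` `]c, d[) p)%:E = 0)%E.
  apply: (cvg_unique _ H) => //=.
  rewrite (_ : (fun _ => _) = cst 0%E); first exact: cvg_cst.
  apply/funext => k /=; have := F0 k; rewrite /I2 /Rintegral => h.
  rewrite -[LHS]fineK ?h//; apply: integrable_fin_num => //.
  have : intg (box z r) (fun p => g p * bump2 k a b c d p).
    apply: (@intgM_bounded _ _ _ _ 1) => //.
      apply: (@pmfun_sub _ setT) => //; first exact: measurableT.
      by apply: continuous_pmfun => [|p _]; [exact: openT|exact: smooth_continuous (@smooth_bump2 k a b c d) _].
    by move=> p _; exact: norm_bump2_le1.
  by [].
have -> : I2 (`]a, b[ `*` `]c, d[) g = I2 (`]a, b[ `*` `]c, d[) (fun p => g p * \1_(`]a, b[ `*` `]c, d[) p).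
  by apply: eq_I2 => p Qp; rewrite indicE mem_set// mulr1.
rewrite -(@I2_restrict _ (box z r))//; first by rewrite /I2 /Rintegral E.
by move=> p _ np; rewrite indicE memNset// mulr0.
Unshelve. all: by end_near. Qed.

(** The integral vanishes on open rectangles, then on products of measurable sets by freeing one
    factor at a time, then on all measurable sets. All this happens in the open box [C a0 b0 c0 d0],
    which contains the closed box of half the radius. *)
Lemma box_ae_eq0 Omega g z r : pmset Omega -> 0 < r -> box z r `<=` Omega ->
  intg (box z r) g ->
  (forall phi, test_function Omega phi -> I2 Omega (fun p => g p * phi p) = 0) ->
  ae_eq (@lambda2 R) (box z (r / 2)) g (cst 0).
Proof.
move=> mO r0 zO ig Hg.
have r2 : 0 < r / 2 by rewrite divr_gt0.
pose rect := box_test_integral0 mO r0 zO ig Hg.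
pose C a b c d : set (R * R) := `]a, b[ `*` `]c, d[.
pose a0 := z.1 - r; pose b0 := z.1 + r; pose c0 := z.2 - r; pose d0 := z.2 + r.
have GE : @measurable _ (measurableTypeR R) = <<s @RGenOpens.G R >> := RGenOpens.measurableE R.
have GI : setI_closed (@RGenOpens.G R).
  move=> _ _ [a [b ->]] [c [d ->]]; exists (Num.max a c), (Num.min b d).
  apply/seteqP; split => x /=; rewrite !in_itv /= gt_max lt_min.
    by move=> [/andP[-> ->] /andP[-> ->]].
  by move=> /andP[/andP[-> ->] /andP[-> ->]].
have mC a b c d : pmset (C a b c d) by apply: pmset_rect.
have subC a b c d : a0 <= a -> b <= b0 -> c0 <= c -> d <= d0 -> `[a, b] `*` `[c, d] `<=` box z r.
  move=> h1 h2 h3 h4 p; rewrite boxE => -[]; rewrite /= !in_itv /= => /andP[x1 x2] /andP[x3 x4].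
  rewrite /a0 /b0 /c0 /d0 in h1 h2 h3 h4.
  by split; apply/andP; split; lra.
have iC a b c d : a0 <= a -> b <= b0 -> c0 <= c -> d <= d0 -> intg (C a b c d) g.
  move=> h1 h2 h3 h4; apply: (intg_sub _ _ _ ig) => //; first exact: pmset_box.
  apply: subset_trans (subC _ _ _ _ h1 h2 h3 h4) => p [p1 p2]; move: p1 p2; rewrite /= !in_itv /=.
  by move=> /andP[x1 x2] /andP[x3 x4]; split; rewrite !ltW.
have rectC a b c d : a0 <= a -> b <= b0 -> c0 <= c -> d <= d0 -> I2 (C a b c d) g = 0.
  by move=> h1 h2 h3 h4; apply: rect; exact: subC.
have step1 c d : c0 <= c -> d <= d0 -> forall S : set (measurableTypeR R), measurable S ->
    I2 (C a0 b0 c d `&` fst @^-1` S) g = 0.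
  move=> h3 h4; apply: (dynkin_integral0 GE GI (f := fst)) => //.
  - exact: iC.
  - exact: rectC.
  - move=> _ [a [b ->]]; have := rectC (Num.max a0 a) (Num.min b0 b) c d.
    rewrite le_max lexx ge_min lexx => /(_ isT isT h3 h4) <-; congr I2.
    rewrite /C; apply/seteqP; split => p /=; rewrite !in_itv /= gt_max lt_min.
      by move=> [[/andP[-> ->] ->] /andP[-> ->]].
    by move=> [/andP[/andP[-> ->] /andP[-> ->]] ->].
have step2 S : measurable (S : set (measurableTypeR R)) -> forall S' : set (measurableTypeR R), measurable S' ->
    I2 ((C a0 b0 c0 d0 `&` fst @^-1` S) `&` snd @^-1` S') g = 0.
  move=> mS.
  have mD : pmset (C a0 b0 c0 d0 `&` fst @^-1` S).
    apply: measurableI; first exact: mC.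
    by rewrite -[X in measurable X]setTI; exact: (@measurable_fst _ _ (measurableTypeR R) (measurableTypeR R)).
  apply: (dynkin_integral0 GE GI (f := snd)) => //.
  - apply: intg_sub (iC a0 b0 c0 d0 _ _ _ _) => //.
  - exact: step1.
  - move=> _ [a [b ->]]; have := step1 (Num.max c0 a) (Num.min d0 b).
    rewrite le_max lexx ge_min lexx => /(_ isT isT S mS) <-; congr I2.
    rewrite /C; apply/seteqP; split => p /=; rewrite !in_itv /= gt_max lt_min.
      by move=> [[[-> /andP[-> ->]] ?] /andP[-> ->]].
    by move=> [[-> /andP[/andP[-> ->] /andP[-> ->]]] ?].
have step3 : forall S : set P2, measurable S -> I2 (C a0 b0 c0 d0 `&` id @^-1` S) g = 0.
  apply: (dynkin_integral0 (measurable_prod_measurableType _ _)) => //.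
  - move=> _ _ [A1 mA1 [B1 mB1 <-]] [A2 mA2 [B2 mB2 <-]].
    exists (A1 `&` A2); first exact: measurableI.
    by exists (B1 `&` B2); [exact: measurableI|rewrite setXI].
  - exact: iC.
  - exact: rectC.
  - move=> _ [A1 mA1 [B1 mB1 <-]]; rewrite -(step2 A1 mA1 B1 mB1); congr I2.
    by apply/seteqP; split => p /=; [move=> [? [? ?]]|move=> [[? ?] ?]].
suff : ae_eq (@lambda2 R) (box z (r / 2)) (EFin \o g) (cst 0%E).
  by apply: filterS => p H pz; apply: EFin_inj; exact: H.
have mb2 := @pmset_box R z (r / 2).
have sb : box z (r / 2) `<=` box z r.
  by move=> p; rewrite /box /= => /le_trans; apply; rewrite ler_pdivrMr// ler_pMr// ler1n.
have ib2 : intg (box z (r / 2)) g by apply: (intg_sub _ _ sb ig) => //; exact: pmset_box.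
apply: (integral_ae_eq mb2 ib2) => //.
move=> E Eb mE; rewrite [RHS]integral0_eq//.
have EC : E = C a0 b0 c0 d0 `&` id @^-1` E.
  apply/seteqP; split => p //=; last by case.
  move=> /[dup] Ep /Eb; rewrite boxE => -[]; rewrite /= !in_itv /= => /andP[x1 x2] /andP[x3 x4].
  split => //; split; rewrite /= in_itv /=; apply/andP; split; rewrite /a0 /b0 /c0 /d0; lra.
have := step3 E mE; rewrite -EC /I2 /Rintegral => h.
have fin := integrable_fin_num mE (intg_sub mb2 mE Eb ib2).
exact: (etrans (esym (fineK fin)) (congr1 EFin h)).
Qed.

Lemma test_ae_eq0 Omega g : open Omega ->
  (forall z r, 0 < r -> box z r `<=` Omega -> intg (box z r) g) ->
  (forall phi, test_function Omega phi -> I2 Omega (fun p => g p * phi p) = 0) ->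
  ae_eq (@lambda2 R) Omega g (cst 0).
Proof.
move=> oO ig Hg.
have [F [HF HU]] := open_box_cover oO.
have H n : ae_eq (@lambda2 R) (F n) g (cst 0).
  have [->|[z [r [r0 -> rO]]]] := HF n; first by apply: aeW => p [].
  exact: box_ae_eq0 (open_pmset oO) r0 rO (ig _ _ r0 rO) Hg.
have := ae_foralln H.
by apply: filterS => p Hp; rewrite HU => -[n _]; exact: Hp.
Qed.

End Fundamental.

(** * Weyl's lemma *)

Section Weyl.
Context {R : realType}.
Local Notation P2 := (measurableTypeR R * measurableTypeR R)%type.
Variable Omega : set (R * R).
Hypothesis oO : open Omega.
Implicit Types (phi h k : R * R -> R) (z p q : R * R) (s r d : R).

Let mO : pmset Omega := open_pmset oO.

Definition mollify h s z : R := @mconv R _ P2 (@lambda2 R) id (h \_ Omega) (moll s) z.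

Lemma I2_patch h (a : R * R -> R) : I2 setT (fun q => a q * (h \_ Omega) q) = I2 Omega (fun q => a q * h q).
Proof.
rewrite [RHS]Rintegral_mkcond; apply: eq_I2 => q _.
by rewrite !patchE; case: ifP => // _; rewrite mulr0.
Qed.

Lemma mconv_patch h (phi : R * R -> R) z :
  @mconv R _ P2 (@lambda2 R) id (h \_ Omega) phi z = I2 Omega (fun q => phi (z - q) * h q).
Proof. exact: I2_patch. Qed.

Lemma intg_patch h : intg Omega h -> intg setT (h \_ Omega).
Proof.
move=> ih; apply: (@intg_support _ _ Omega) => //; first exact: pmsetT.
  by move=> q _ nq; rewrite patchE memNset.
by apply: intg_eq ih => // q Oq; rewrite patchE mem_set.
Qed.

(* The mollifier of scale [s] has radius of order [s^(-1/2)] and, centered at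
   [z], lives in [Omega]. *)
Definition good s z := 0 < s /\ exists d, [/\ 0 < d, 2 <= s * d ^+ 2 & box z d `<=` Omega].

Lemma good_near z : Omega z -> exists s d, [/\ 0 < d & forall p, ball z d p -> good s p].
Proof.
move=> /(open_box oO)[d d0 zd]; exists (2 / (d / 2) ^+ 2), (d / 2).
have d2 : 0 < d / 2 by rewrite divr_gt0.
split => // p zp; split; first by rewrite divr_gt0// exprn_gt0.
exists (d / 2); split => //; first by rewrite divfK// expf_neq0// lt0r_neq0.
move=> q; rewrite /box /= => qp; apply: zd; rewrite /box /= -(subrK p q) -addrA.
rewrite (le_trans (ler_normD _ _))// [leRHS]splitr lerD//.
by move: zp; rewrite -ball_normE /= distrC => /ltW.
Qed.

Lemma exists_good z : Omega z -> exists s, good s z.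
Proof. by move=> /good_near[s [d [d0 H]]]; exists s; apply: H; exact: ballxx. Qed.

(** An arbitrary admissible scale, without any regularity in [z]; for harmonic pairs [mollify_scale]
    shows that the result does not depend on this choice. *)
Definition scale z : R := xget 1 [set s | good s z].

Lemma good_scale z : Omega z -> good (scale z) z.
Proof.
move=> /exists_good[s gs]; have : exists s, [set s | good s z] s by exists s.
by move=> /(xgetPex 1).
Qed.

Definition weyl h z : R := mollify h (scale z) z / mass.

Definition weak_closed h k := forall phi, test_function Omega phi ->
  I2 Omega (fun p => h p * dy phi p - k p * dx phi p) = 0.

Definition weak_coclosed h k := forall phi, test_function Omega phi ->
  I2 Omega (fun p => h p * dx phi p + k p * dy phi p) = 0.

Lemma intg_mul_test h phi Omega' : intg Omega h -> test_function Omega' phi ->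
  intg Omega (fun p => h p * phi p).
Proof.
move=> ih tp; have [M _ HM] := test_bounded tp.
apply: (@intgM_bounded _ _ _ _ M) => //.
apply: (@pmfun_sub _ setT) => //; first exact: pmsetT.
by apply: continuous_pmfun => [|p _]; [exact: openT|exact: (test_continuous tp)].
Qed.

Lemma reflect_test phi z d : test_function setT phi -> (forall v, d < `|v| -> phi v = 0) ->
  box z d `<=` Omega -> test_function Omega (fun q => phi (z - q)).
Proof. by move=> tp p0 zd; exact: test_reflect tp p0 zd. Qed.

(* [moll s - moll r] is the divergence of the curl-free test field
   [(kern1, kern2)], against which closed and coclosed pairs integrate to 0. *)
Lemma mollify_scale h k s r z : intg Omega h -> intg Omega k -> weak_closed h k -> weak_coclosed h k ->
  good s z -> good r z -> mollify h s z = mollify h r z.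
Proof.
move=> ih ik hc hcc [s0 [d [d0 sd zd]]] [r0 [e [e0 re ze]]].
pose m := Num.max d e.
have m0 : 0 < m by rewrite lt_max d0.
have zm : box z m `<=` Omega by rewrite /m; case: leP => _.
have sq x : 0 < x -> x <= m -> x ^+ 2 <= m ^+ 2.
  by move=> x0 xm; rewrite ler_sqr// nnegrE ltW.
have sm : 2 <= s * m ^+ 2.
  by apply: (le_trans sd); rewrite ler_wpM2l ?(ltW s0)// sq// le_max lexx.
have rm : 2 <= r * m ^+ 2.
  by apply: (le_trans re); rewrite ler_wpM2l ?(ltW r0)// sq// le_max lexx orbT.
have [t1 t2] := test_kern s0 r0.
have far v : m < `|v| -> kern s r v = 0 by exact: kern_far.
have tk1 : test_function Omega (fun q => kern1 s r (z - q)).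
  by apply: (reflect_test t1 _ zm) => v /far; rewrite /kern1 => ->; rewrite mulr0.
have tk2 : test_function Omega (fun q => kern2 s r (z - q)).
  by apply: (reflect_test t2 _ zm) => v /far; rewrite /kern2 => ->; rewrite mulr0.
have E x : mollify h x z = I2 Omega (fun q => moll x (z - q) * h q) by exact: I2_patch.
have im x : 0 < x -> intg Omega (fun q => moll x (z - q) * h q).
  move=> x0; have := intg_mul_test ih (test_reflectT z (test_moll x0)).
  by apply: intg_eq => // q _; rewrite mulrC.
rewrite !E; apply/eqP; rewrite -subr_eq0 -I2B//; try exact: im; apply/eqP.
have := hcc _ tk1; have := hc _ tk2.
have i1 := intg_mul_test ih (test_dx tk1); have i2 := intg_mul_test ik (test_dy tk1).
have i3 := intg_mul_test ih (test_dy tk2); have i4 := intg_mul_test ik (test_dx tk2).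
rewrite (I2B mO i3 i4) (I2D mO i1 i2) => e1 e2.
(* The factor -1 comes from the reflection [q |-> z - q]. Coclosedness and closedness turn the two
   terms into terms in [k], which cancel because the kernel is curl-free ([e3]). *)
have -> : I2 Omega (fun p => moll s (z - p) * h p - moll r (z - p) * h p) =
  I2 Omega (fun p => -1 * (h p * dx (fun q => kern1 s r (z - q)) p + h p * dy (fun q => kern2 s r (z - q)) p)).
  apply: eq_I2 => p _.
  have [_ [-> _]] := reflect_partials z p t1; have [_ [_ ->]] := reflect_partials z p t2.
  rewrite -mulrBl; have [<- _] := kern_partials (z - p) s0 r0.
  by move: (dx _ _) (dy _ _) => u v; ring.
rewrite (I2Z _ mO (intgD mO i1 i3)) (I2D mO i1 i3).
have e3 : I2 Omega (fun p => k p * dy (fun q => kern1 s r (z - q)) p) = I2 Omega (fun p => k p * dx (fun q => kern2 s r (z - q)) p).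
  apply: eq_I2 => p _.
  have [_ [_ ->]] := reflect_partials z p t1; have [_ [-> _]] := reflect_partials z p t2.
  by have [_ ->] := kern_partials (z - p) s0 r0.
by rewrite (subr0_eq e1) -e3 e2 mulr0.
Qed.

Lemma weylE h k s z : intg Omega h -> intg Omega k -> weak_closed h k -> weak_coclosed h k ->
  Omega z -> good s z -> weyl h z = mollify h s z / mass.
Proof.
move=> ih ik hc hcc Oz gs.
have E : mollify h (scale z) z = mollify h s z := mollify_scale ih ik hc hcc (good_scale Oz) gs.
by rewrite /weyl E.
Qed.

Lemma mollify_partials h s z : intg Omega h -> 0 < s ->
  has_partials (mollify h s) z
    (I2 Omega (fun q => dx (moll s) (z - q) * h q)) (I2 Omega (fun q => dy (moll s) (z - q) * h q)).
Proof.
move=> ih s0.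
have mid : measurable_fun setT (id : P2 -> P2) by exact: measurable_id.
have H := mconv_partials mid (intg_patch ih) z (test_moll s0).
have E1 := mconv_patch h (dx (moll s)) z; have E2 := mconv_patch h (dy (moll s)) z.
have cong a b a' b' : has_partials (mollify h s) z a b -> a = a' -> b = b' ->
  has_partials (mollify h s) z a' b' by move=> + <- <-.
exact: (cong _ _ _ _ H E1 E2).
Qed.

Lemma smooth_mollify h s : intg Omega h -> 0 < s -> smooth_on setT (mollify h s).
Proof.
move=> ih s0.
have mid : measurable_fun setT (id : P2 -> P2) by exact: measurable_id.
exact: (mconv_smooth mid (intg_patch ih) (test_moll s0)).
Qed.

Opaque mollify weyl mass moll.

Lemma near_has_partialsZ (F G : R * R -> R) z a b c : (\near z, F z * c = G z) ->
  has_partials F z a b -> has_partials G z (a * c) (b * c).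
Proof.
move=> FG /has_partialsM/(_ (has_partials_cst c z)) H; apply: near_has_partials FG _.
have -> : a * c = F z * 0 + c * a by ring.
have -> : b * c = F z * 0 + c * b by ring.
exact: H.
Qed.

Section harmonic.
Variables h k : R * R -> R.
Hypotheses (ih : intg Omega h) (ik : intg Omega k).
Hypotheses (hc : weak_closed h k) (hcc : weak_coclosed h k).

(** One scale serves a whole ball, so near each point [weyl h] is a single convolution and inherits
    its smoothness. *)
Lemma weyl_local z : Omega z -> exists s d, [/\ 0 < s, 0 < d & forall p, ball z d p ->
  Omega p /\ mollify h s p * mass^-1 = weyl h p].
Proof.
move=> /good_near[s [d [d0 H]]]; exists s, d.
have s0 : 0 < s by have [] := H z (ballxx _ d0).
split; [exact: s0|exact: d0|move=> p /H gp].
have Op : Omega p by have [_ [e [e0 _]]] := gp; apply; exact: box_center (ltW e0).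
by split; [exact: Op|rewrite (weylE ih ik hc hcc Op gp)].
Qed.

Lemma smooth_weyl : smooth_on Omega (weyl h).
Proof.
move=> n; apply: Ck_on_local => z /weyl_local[s [d [s0 d0 H]]].
exists (ball z d); first exact: ballxx.
have oB : open (ball z d) by exact: ball_open.
have cm : Ck_on (ball z d) n (mollify h s \* cst mass^-1).
  apply: Ck_onM; [exact: oB| |exact: Ck_on_cst].
  exact: (Ck_on_sub (@subsetT _ _) (smooth_mollify ih s0 n)).
by apply: (Ck_on_eq oB _ cm) => p /set_mem/H[].
Qed.

Lemma weyl_partials s d z : 0 < d -> (forall p, ball z d p -> good s p) -> has_partials (weyl h) z
  (I2 Omega (fun q => dx (moll s) (z - q) * h q) / mass)
  (I2 Omega (fun q => dy (moll s) (z - q) * h q) / mass).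
Proof.
move=> d0 H; have s0 : 0 < s by have [] := H z (ballxx _ d0).
apply: (near_has_partialsZ _ (mollify_partials z ih s0)).
apply/nbhs_ballP; exists d; [exact: d0|move=> p /H gp].
have Op : Omega p by have [_ [e [e0 _]]] := gp; apply; exact: box_center (ltW e0).
by rewrite (weylE ih ik hc hcc Op gp).
Qed.

(** Fubini moves the mollification from [h] to [phi], and mollifying [phi] at radius [d] changes
    [mass * phi] by O(d), while the difference to be estimated does not involve [d]. *)
Lemma weyl_weak phi : test_function Omega phi ->
  I2 Omega (fun p => weyl h p * phi p) = I2 Omega (fun p => h p * phi p).
Proof.
move=> tp; have [K [cK KO K0]] := test_functionE tp.
have [r r0 Kr] := compact_margin oO cK KO.
have [M1 M10 H1] := test_bounded (test_dx tp); have [M2 M20 H2] := test_bounded (test_dy tp).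
pose L := 2 * (M1 + M2).
have L0 : 0 <= L by rewrite mulr_ge0// addr_ge0.
have Lip z v : `|phi (z + v) - phi z| <= L * `|v|.
  apply: lipschitz_of_partials => p; first by have [] := test_has_partials p tp.
    by apply: (le_trans (H1 p)); rewrite lerDl.
  by apply: (le_trans (H2 p)); rewrite lerDr.
pose N := I2 setT (fun q => `|(h \_ Omega) q|).
have N0 : 0 <= N by apply: I2_ge0.
have mid : measurable_fun setT (id : P2 -> P2) by exact: measurable_id.
have iH := intg_patch ih.
have iphi := test_intg tp.
(* Every radius up to the margin [r] of [K] is admissible at each point where [phi] is nonzero. *)
have key d : 0 < d -> d <= r ->
    `|I2 Omega (fun p => weyl h p * phi p) - I2 Omega (fun p => h p * phi p)| <= L * N * d.
  move=> d0 dr; pose s := 2 / d ^+ 2.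
  have sd : 2 <= s * d ^+ 2 by rewrite divfK// expf_neq0// lt0r_neq0.
  have s0 : 0 < s by rewrite divr_gt0// exprn_gt0.
  have [M _ HM] := test_bounded (test_moll s0).
  have cm := test_continuous (test_moll s0).
  have mass0 := @mass_gt0 R.
  pose A q := I2 setT (fun z => phi z * moll s (z - q)).
  have cA : continuous A.
    have -> : A = @mconv R _ P2 (@lambda2 R) id phi (moll s).
      apply/funext => q; apply: eq_Rintegral => z _.
      by rewrite -moll_sym opprB mulrC.
    by move=> q; exact: smooth_continuous (mconv_smooth mid iphi (test_moll s0)) _.
  have cM : continuous (mollify h s) by move=> z; exact: smooth_continuous (smooth_mollify ih s0) _.
  have Aphi q : `|A q - mass * phi q| <= L * d * mass.
    apply: (moll_approx s0 d0 sd iphi) => z zq.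
    by have := Lip q (z - q); rewrite [q + _]addrC subrK => /le_trans; apply; rewrite ler_wpM2l.
  have E1 : mass * I2 Omega (fun p => weyl h p * phi p) = I2 setT (fun z => phi z * mollify h s z).
    rewrite (@I2_restrict _ setT Omega); [|exact: pmsetT|exact: mO|by []|]; last first.
      by move=> p _ np; rewrite K0 ?mul0r// => /KO.
    rewrite -I2Z//.
      apply: eq_I2 => p Op; have [Kp|/K0->] := pselect (K p); last by rewrite mul0r !mulr0.
      rewrite (weylE ih ik hc hcc Op (s := s)).
        by field; exact: lt0r_neq0.
      split => //; exists d; split => // q qp; apply: (Kr p Kp).
      by rewrite /box /=; apply: le_trans dr.
    have iw : intg Omega (fun p => mass^-1 * (phi p * mollify h s p)).
      apply: intgZ => //; apply: (@intgM_bounded _ _ _ _ (M * N)) => //.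
      - apply: (@pmfun_sub _ setT) => //; first exact: pmsetT.
        by apply: continuous_pmfun => [|z _]; [exact: openT|exact: cM].
      - by move=> p _; apply: (mconv_bounded mid iH).
      - by apply: (intg_sub _ _ _ iphi) => //; exact: pmsetT.
    apply: intg_eq iw => // p Op; have [Kp|/K0->] := pselect (K p); last by rewrite mul0r !mulr0.
    rewrite (weylE ih ik hc hcc Op (s := s)); first by field; exact: lt0r_neq0.
    split => //; exists d; split => // q qp; apply: (Kr p Kp).
    by rewrite /box /=; apply: le_trans dr.
  have E2 : I2 setT (fun z => phi z * mollify h s z) = I2 setT (fun q => A q * (h \_ Omega) q).
    exact: (mconv_fubini mid iH cm HM iphi).
  have E3 : mass * I2 Omega (fun p => h p * phi p) = I2 setT (fun q => mass * phi q * (h \_ Omega) q).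
    rewrite I2_patch -I2Z//; last exact: intg_mul_test tp.
    by apply: eq_I2 => q _; rewrite -mulrA [phi q * _]mulrC.
  have [B _ HB] := test_bounded tp.
  have iAH : intg setT (fun q => A q * (h \_ Omega) q).
    have : intg setT (fun q => (h \_ Omega) q * A q).
      apply: (@intgM_bounded _ _ _ _ (L * d * mass + mass * B)) => //; first exact: pmsetT.
        by apply: continuous_pmfun => [|z _]; [exact: openT|exact: cA].
      move=> q _; rewrite -(subrK (mass * phi q) (A q)); apply: (le_trans (ler_normD _ _)).
      apply: lerD; first exact: Aphi.
      by rewrite normrM gtr0_norm// ler_wpM2l// ltW.
    by apply: intg_eq => [|q _]; [exact: pmsetT|rewrite mulrC].
  have ipH : intg setT (fun q => mass * phi q * (h \_ Omega) q).
    have : intg setT (fun q => (h \_ Omega) q * (mass * phi q)).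
      apply: (@intgM_bounded _ _ _ _ (mass * B)) => //; first exact: pmsetT.
        apply: continuous_pmfun => [|z _]; first exact: openT.
        by apply: cvgM; [exact: cvg_cst|exact: (test_continuous tp)].
      by move=> q _; rewrite normrM gtr0_norm// ler_wpM2l// ltW.
    by apply: intg_eq => [|q _]; [exact: pmsetT|rewrite mulrC].
  rewrite -(ler_pM2l mass0) -{1}(gtr0_norm mass0) -normrM mulrBr E1 E2 E3.
  rewrite -I2B//; last exact: pmsetT.
  have iB := intgB pmsetT iAH ipH.
  apply: (le_trans (norm_I2 pmsetT iB)).
  have -> : mass * (L * N * d) = I2 setT (fun q => L * d * mass * `|(h \_ Omega) q|).
    rewrite I2Z -/N; [ring|exact: pmsetT|by apply: intg_norm => //; exact: pmsetT].
  apply: le_I2; [exact: pmsetT|by apply: intg_norm => //; exact: pmsetT| |].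
    by apply: intgZ; [exact: pmsetT|apply: intg_norm => //; exact: pmsetT].
  by move=> q _; rewrite -mulrBl normrM ler_wpM2r.
apply/eqP; rewrite -subr_eq0 -normr_eq0 eq_le normr_ge0 andbT.
apply/ler_addgt0Pl => e e0; rewrite addr0.
pose d := Num.min r (e / (L * N + 1)).
have LN : 0 < L * N + 1 by rewrite ltr_wpDl// mulr_ge0.
have d0 : 0 < d by rewrite lt_min r0 divr_gt0.
have dr : d <= r by rewrite /d ge_min lexx.
have de : d <= e / (L * N + 1) by rewrite /d ge_min lexx orbT.
apply: (le_trans (key d d0 dr)).
apply: (@le_trans _ _ ((L * N + 1) * d)); first by rewrite ler_wpM2r ?(ltW d0)// lerDl.
by rewrite mulrC -ler_pdivlMr.
Qed.

Lemma weyl_ae_eq : ae_eq (@lambda2 R) Omega (weyl h) h.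
Proof.
have cw p : Omega p -> {for p, continuous (weyl h)} by exact: smooth_continuous smooth_weyl.
have mw : pmfun Omega (weyl h) by exact: continuous_pmfun.
have iw z r : 0 < r -> box z r `<=` Omega -> intg (box z r) (weyl h).
  move=> r0 zO; have [M _ HM] := compact_norm_bounded (@compact_box _ z r) (fun p zp => cw p (zO p zp)).
  apply: (@intg_bounded _ _ _ M) => //; [exact: pmset_box|exact: area_box_fin|].
  exact: pmfun_sub mw.
have ihb z r : box z r `<=` Omega -> intg (box z r) h.
  by move=> zO; apply: (intg_sub _ _ zO ih) => //; exact: pmset_box.
have : ae_eq (@lambda2 R) Omega (fun p => weyl h p - h p) (cst 0).
  apply: test_ae_eq0 => // [z r r0 zO|phi tp].
    by apply: intgB; [exact: pmset_box|exact: iw|exact: ihb].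
  have [K [cK KO K0]] := test_functionE tp.
  have [M _ HM] := compact_norm_bounded cK (fun p Kp => cw p (KO p Kp)).
  have iwp : intg Omega (fun p => weyl h p * phi p).
    apply: (@intg_support _ _ K) => //; first exact: compact_pmset.
      by move=> p _ /K0->; rewrite mulr0.
    apply: (@intg_eq _ _ (fun p => phi p * weyl h p)); first exact: compact_pmset.
      by move=> p _; rewrite mulrC.
    apply: (@intgM_bounded _ _ _ _ M) => //; first exact: compact_pmset.
      by apply: (@pmfun_sub _ Omega).
    by apply: continuous_intg_compact => //; exact: test_continuous tp.
  have -> : I2 Omega (fun p => (weyl h p - h p) * phi p) =
      I2 Omega (fun p => weyl h p * phi p - h p * phi p).
    by apply: eq_I2 => p _; rewrite mulrBl.
  by rewrite I2B// ?weyl_weak ?subrr//; exact: intg_mul_test tp.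
by apply: filterS => p H Op; apply/eqP; rewrite -subr_eq0; apply/eqP; exact: H.
Qed.

End harmonic.

Lemma weak_closed_swap h k : weak_coclosed h k -> weak_closed k (fun p => - h p).
Proof.
move=> H phi /H <-; apply: eq_I2 => p _; rewrite mulNr opprK addrC //.
Qed.

Lemma weak_coclosed_swap h k : intg Omega h -> intg Omega k -> weak_closed h k ->
  weak_coclosed k (fun p => - h p).
Proof.
move=> ih ik H phi tp; have := H _ tp.
have i1 := intg_mul_test ih (test_dy tp); have i2 := intg_mul_test ik (test_dx tp).
rewrite (I2B mO i1 i2) => e.
have -> : I2 Omega (fun p => k p * dx phi p + - h p * dy phi p) =
  I2 Omega (fun p => k p * dx phi p - h p * dy phi p).
  by apply: eq_I2 => p _; rewrite mulNr.
by rewrite (I2B mO i2 i1) -[LHS]opprB e oppr0.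
Qed.

(** The partial derivatives are integrals against derivatives of the mollifier; closedness and
    coclosedness, tested on [moll s (z - q)], are the two Cauchy-Riemann relations between them. *)
Lemma weyl_CR h k z : intg Omega h -> intg Omega k -> weak_closed h k -> weak_coclosed h k ->
  Omega z -> exists a b, has_partials (weyl h) z a b /\ has_partials (weyl k) z b (- a).
Proof.
move=> ih ik hc hcc /good_near[s [d [d0 H]]].
have ihN : intg Omega (fun p => - h p).
  by apply: (intg_eq mO _ (intgZ (-1) mO ih)) => p _; rewrite ?mulN1r.
have [s0 [e [e0 se ze]]] := H z (ballxx _ d0).
have hp := weyl_partials ih ik hc hcc d0 H.
(* For [k] the argument is run on the rotated pair [(k, - h)], again closed and coclosed. *)
have kp := weyl_partials ik ihN (weak_closed_swap hcc) (weak_coclosed_swap ih ik hc) d0 H.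
have tm := test_moll s0.
have far v : e < `|v| -> moll s v = 0 by exact: moll_far s0 e0 se.
have tp : test_function Omega (fun q => moll s (z - q)) by exact: (reflect_test tm far ze).
have Rx p : dx (fun q => moll s (z - q)) p = - dx (moll s) (z - p) by have [_ []] := reflect_partials z p tm.
have Ry p : dy (fun q => moll s (z - q)) p = - dy (moll s) (z - p) by have [_ []] := reflect_partials z p tm.
have := hc _ tp; have := hcc _ tp.
have i1 := intg_mul_test ih (test_dx tp); have i2 := intg_mul_test ik (test_dy tp).
have i3 := intg_mul_test ih (test_dy tp); have i4 := intg_mul_test ik (test_dx tp).
rewrite (I2B mO i3 i4) (I2D mO i1 i2).
have conv f g g' : (forall p, g p = - g' p) -> intg Omega (fun p => f p * g p) ->
    I2 Omega (fun p => f p * g p) = - I2 Omega (fun p => g' p * f p).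
  move=> gg ig; rewrite -[RHS]mulN1r -I2Z.
  - by apply: eq_I2 => p _; rewrite gg; ring.
  - exact: mO.
  - by apply: (intg_eq mO _ (intgZ (-1) mO ig)) => p _; rewrite gg; ring.
have alg (a b c f a' b' c' f' : R) : a' + b' = 0 -> c' - f' = 0 ->
    a' = - a -> b' = - b -> c' = - c -> f' = - f -> f = c /\ b = - a by lra.
move=> e1 e2; have [e3 e4] := alg _ _ _ _ _ _ _ _ e1 e2
  (conv _ _ _ Rx i1) (conv _ _ _ Ry i2) (conv _ _ _ Ry i3) (conv _ _ _ Rx i4).
have cong (a b a' b' : R) : has_partials (weyl k) z (a / mass) (b / mass) -> a = a' -> b = - b' ->
    has_partials (weyl k) z (a' / mass) (- (b' / mass)) by move=> + <- bb; rewrite -mulNr -bb.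
do 2 eexists; split; [exact: hp|exact: (cong _ _ _ _ kp e3 e4)].
Qed.

End Weyl.

(** * Mollified currents of integration *)

Section Curve.
Context {R : realType}.
Local Notation P2 := (measurableTypeR R * measurableTypeR R)%type.
Local Notation mu := (@lebesgue_measure R).
Implicit Types (F phi h k : R * R -> R) (z p q : R * R) (s r d t : R).

Lemma is_derive_along F (a b : R -> R) t a' b' A B : is_derive t 1 a a' -> is_derive t 1 b b' ->
  has_partials F (a t, b t) A B -> is_derive t 1 (fun s => F (a s, b s)) (A * a' + B * b').
Proof.
move=> da db HF; have [dF _] := HF; have [eA eB] := has_partials_is_derive HF.
have ta : differentiable a t by apply/derivable1_diffP/ex_derive.
have tb : differentiable b t by apply/derivable1_diffP/ex_derive.
have dab : differentiable (fun s => (a s, b s)) t by exact: differentiable_pair.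
have dc : differentiable (F \o (fun s => (a s, b s))) t by exact: differentiable_comp.
apply: DeriveDef; first exact/derivable1_diffP.
have -> : 'D_1 (fun s => F (a s, b s)) t = 'd (F \o (fun s => (a s, b s))) t 1 by exact: deriveE.
rewrite diff_comp//= diff_pair//=.
have -> : 'd a t 1 = a' by rewrite -deriveE//; exact: derive_val.
have -> : 'd b t 1 = b' by rewrite -deriveE//; exact: derive_val.
have -> : (a', b') = a' *: ((1, 0) : R * R) + b' *: (0, 1).
  by congr (_, _) => /=; rewrite /GRing.scale /=; ring.
rewrite linearD !linearZ /= -!deriveE// (@derive_val _ _ _ _ _ _ _ eA) (@derive_val _ _ _ _ _ _ _ eB).
by rewrite /GRing.scale /= mulrC [b' * _]mulrC.
Qed.

Variable g : R -> R * R.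
Hypothesis cg : smooth_closed_curve g.

Lemma curve_is_derive t : is_derive t 1 (fun s => (g s).1) (velocity g t).1 /\
  is_derive t 1 (fun s => (g s).2) (velocity g t).2.
Proof. by have [d1 d2] := cg.2 0%N t; split; apply: DeriveDef => //; rewrite /velocity /= derive1E. Qed.

Lemma continuous_velocity :
  continuous (fun t => (velocity g t).1) /\ continuous (fun t => (velocity g t).2).
Proof.
split=> t; have [d1 d2] := cg.2 1%N t.
  exact: (@differentiable_continuous _ _ _ _ _ (iffLR (derivable1_diffP _ _) d1)).
exact: (@differentiable_continuous _ _ _ _ _ (iffLR (derivable1_diffP _ _) d2)).
Qed.

Lemma continuous_curve : continuous g.
Proof.
move=> t; have [d1 d2] := cg.2 0%N t.
have c1 : {for t, continuous (fun s => (g s).1)} by apply/differentiable_continuous/derivable1_diffP.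
have c2 : {for t, continuous (fun s => (g s).2)} by apply/differentiable_continuous/derivable1_diffP.
have -> : g = fun s => ((g s).1, (g s).2) by apply/funext => s; case: (g s).
exact: (cvg_pair c1 c2).
Qed.

Lemma measurable_curve : measurable_fun setT (g : measurableTypeR R -> P2).
Proof.
have -> : g = fun s => ((g s).1, (g s).2) by apply/funext => s; case: (g s).
apply: (@measurable_fun_pair _ _ _ _ _ _ (fun s => (g s).1) (fun s => (g s).2));
  apply: continuous_measurable_fun => t; have [d1 d2] := cg.2 0%N t;
  by apply/differentiable_continuous/derivable1_diffP.
Qed.

(** Extended by 0 so that integration along the curve is integration over the whole line with an
    integrable weight, as in [mconv]. *)
Definition vel1 : R -> R := (fun t => (velocity g t).1) \_ `[0, 1].
Definition vel2 : R -> R := (fun t => (velocity g t).2) \_ `[0, 1].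

Lemma integrable_patch01 (f : R -> R) : continuous f ->
  mu.-integrable setT (EFin \o (f \_ `[0, 1])).
Proof.
move=> cf; have : mu.-integrable `[0, 1] (EFin \o f).
  apply: continuous_compact_integrable; first exact: segment_compact.
  exact: continuous_subspaceT.
have mI : measurable (`[0, 1]%classic : set (measurableTypeR R)) by exact: measurable_itv.
by move=> H; have := iffLR (integrable_mkcond (mu := mu) _ mI) H; rewrite restrict_EFin.
Qed.

Lemma integrable_vel : mu.-integrable setT (EFin \o vel1) /\ mu.-integrable setT (EFin \o vel2).
Proof. by have [c1 c2] := continuous_velocity; split; apply: integrable_patch01. Qed.

(* [(J1 s, J2 s)] is the current of integration along [g], mollified at scale [s]. *)
Definition J1 s : R * R -> R := @mconv R _ _ mu g vel1 (moll s).
Definition J2 s : R * R -> R := @mconv R _ _ mu g vel2 (moll s).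

(** The integrand is the derivative of [- phi (z - g t)], which has equal values at 0 and 1 because
    the curve is closed. It makes mollified currents divergence-free. *)
Lemma closed_curve_integral phi z : test_function setT phi ->
  @mconv R _ _ mu g vel1 (dx phi) z + @mconv R _ _ mu g vel2 (dy phi) z = 0.
Proof.
move=> tp; have [i1 i2] := integrable_vel.
have [M1 _ H1] := test_bounded (test_dx tp); have [M2 _ H2] := test_bounded (test_dy tp).
have c1 := test_continuous (test_dx tp); have c2 := test_continuous (test_dy tp).
have I1 := mconv_integrable measurable_curve i1 z c1 H1.
have I2 := mconv_integrable measurable_curve i2 z c2 H2.
pose f t := dx phi (z - g t) * (velocity g t).1 + dy phi (z - g t) * (velocity g t).2.
have cf : continuous f.
  have [v1 v2] := continuous_velocity.
  have cz t : {for t, continuous (fun t => z - g t)}.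
    by apply: cvgB; [exact: cvg_cst|exact: continuous_curve].
  have d1 t : {for t, continuous (fun t => dx phi (z - g t))} := continuous_comp (cz t) (c1 _).
  have d2 t : {for t, continuous (fun t => dy phi (z - g t))} := continuous_comp (cz t) (c2 _).
  by move=> t; exact: (cvgD (cvgM (d1 t) (v1 t)) (cvgM (d2 t) (v2 t))).
rewrite /mconv -(RintegralD measurableT I1 I2).
transitivity (\int[mu]_(t in `[0, 1]) f t).
  rewrite [RHS]Rintegral_mkcond; apply: eq_Rintegral => t _.
  by rewrite /vel1 /vel2 !patchE; case: ifP => // _; rewrite !mulr0 addr0.
pose G t := - phi (z - g t).
have dG t : is_derive t 1 G (f t).
  have [/= d1 d2] := curve_is_derive t.
  have e1 : is_derive t 1 (fun s => z.1 - (g s).1) (- (velocity g t).1).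
    by rewrite -[X in is_derive _ _ _ X]add0r; exact: is_deriveB.
  have e2 : is_derive t 1 (fun s => z.2 - (g s).2) (- (velocity g t).2).
    by rewrite -[X in is_derive _ _ _ X]add0r; exact: is_deriveB.
  have := is_deriveN (is_derive_along e1 e2 (test_has_partials (z - g t) tp)).
  by rewrite /f; move: (dx _ _) (dy _ _) => u v; congr is_derive; rewrite !mulrN -opprD opprK.
rewrite /Rintegral (@continuous_FTC2 _ f G 0 1)//=.
- by have := cg.1 0; rewrite add0r /G => ->; rewrite subrr.
- exact: continuous_subspaceT.
- have cG : continuous G by move=> t; apply/differentiable_continuous/derivable1_diffP/ex_derive.
  split; first by move=> t _; exact: ex_derive.
    by apply: cvg_at_right_filter; exact: cG.
  by apply: cvg_at_left_filter; exact: cG.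
- by move=> t _; rewrite derive1E; exact: derive_val.
Qed.

End Curve.

Opaque moll mass kern.

(** * Support, size and scale independence of the mollified currents *)

Section Periods.
Context {R : realType}.
Local Notation mu := (@lebesgue_measure R).
Implicit Types (F phi h k : R * R -> R) (z p q : R * R) (s r d t : R) (g : R -> R * R) (Omega : set (R * R)).
Local Notation cv1 g := (@mconv R _ _ mu g (vel1 g)).
Local Notation cv2 g := (@mconv R _ _ mu g (vel2 g)).

(** More than uniform continuity on [K]: the point [q] ranges over a full neighbourhood, as required
    for averages around the points of a curve. *)
Lemma compact_modulus F (K : set (R * R)) (e : R) : compact K -> 0 < e ->
  (forall z, K z -> {for z, continuous F}) ->
  exists2 d, 0 < d & forall z q, K z -> `|q - z| <= d -> `|F q - F z| <= e.
Proof.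
move=> cK e0 cF.
have := iffLR (compact_near_coveringP K) cK R (0^'+)
  (fun r z => forall q, `|q - z| <= r -> `|F q - F z| <= e) _.
move=> /(_ _)[].
  move=> z Kz; have e2 : 0 < e / 2 by rewrite divr_gt0.
  have /cvgrPdist_lt/(_ _ e2)/nbhs_ballP[r /= r0 Hr] := cF z Kz.
  exists (ball z (r / 2), [set x | 0 < x /\ x < r / 2]) => /=.
    split; first by apply: nbhsx_ballx; rewrite divr_gt0.
    near=> x; split; near: x; first exact: nbhs_right_gt.
    by apply: nbhs_right_lt; rewrite divr_gt0.
  have near_z y : `|z - y| < r -> `|F z - F y| < e / 2.
    by move=> zy; apply: Hr; rewrite -ball_normE.
  move=> [z' x] /= [zz' [x0 xr]] q qz'.
  have dz' : `|z - z'| < r / 2 by move: zz'; rewrite -ball_normE.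
  have dq : `|z - q| < r.
    rewrite -(subrK z' z) -addrA (le_lt_trans (ler_normD _ _))// [ltRHS](splitr r) ltrD//.
    by rewrite distrC (le_lt_trans qz').
  have dz'2 : `|z - z'| < r by rewrite (lt_trans dz')// ltr_pdivrMr// ltr_pMr// ltr1n.
  rewrite -(subrK (F z) (F q)) -addrA (le_trans (ler_normD _ _))// [leRHS](splitr e) lerD//.
    by rewrite distrC ltW// near_z.
  by rewrite ltW// near_z.
move=> x [/= x0] H; exists (x / 2); first by rewrite divr_gt0.
move=> z q Kz; apply: (H (x / 2)) => //=; last by rewrite divr_gt0.
by rewrite sub0r normrN gtr0_norm ?divr_gt0// ltr_pdivrMr// ltr_pMr// ltr1n.
Unshelve. all: by end_near. Qed.

Section OneCurve.
Variable g : R -> R * R.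
Hypothesis cg : smooth_closed_curve g.

Let mg := measurable_curve cg.
Let i1 := (integrable_vel cg).1.
Let i2 := (integrable_vel cg).2.

Lemma smooth_J s : 0 < s -> smooth_on setT (J1 g s) /\ smooth_on setT (J2 g s).
Proof.
by move=> s0; split; [exact: (mconv_smooth mg i1 (test_moll s0))|exact: (mconv_smooth mg i2 (test_moll s0))].
Qed.

Lemma J_bounded : exists2 M, 0 <= M & forall s z, 0 < s -> `|J1 g s z| <= s * M /\ `|J2 g s z| <= s * M.
Proof.
have [M M0 HM] := @moll_scale R.
exists (M * (\int[mu]_t `|vel1 g t| + \int[mu]_t `|vel2 g t|)).
  by rewrite mulr_ge0// addr_ge0//; apply: Rintegral_ge0.
have n0 (f : R -> R) : 0 <= \int[mu]_t `|f t| by apply: Rintegral_ge0.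
move=> s z s0; have cm := test_continuous (test_moll s0).
have B p : `|moll s p| <= s * M.
  by have /ger0_norm -> := moll_ge0 p (ltW s0); exact: HM (ltW s0).
have sM : 0 <= s * M by rewrite mulr_ge0// ltW.
split.
  by apply: (le_trans (mconv_bounded mg i1 z cm B)); rewrite -mulrA ler_wpM2l ?(ltW s0)// ler_wpM2l// lerDl.
by apply: (le_trans (mconv_bounded mg i2 z cm B)); rewrite -mulrA ler_wpM2l ?(ltW s0)// ler_wpM2l// lerDr.
Qed.

Lemma J_divergence0 s z : 0 < s -> dx (J1 g s) z + dy (J2 g s) z = 0.
Proof.
move=> s0; have tm := test_moll s0.
have [_ [-> _]] := mconv_partials mg i1 z tm; have [_ [_ ->]] := mconv_partials mg i2 z tm.
exact: (closed_curve_integral cg z tm).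
Qed.

Definition tube d : set (R * R) := [set q | exists t, [/\ 0 <= t, t <= 1 & box (g t) d q]].

Lemma compact_tube d : 0 <= d -> compact (tube d).
Proof.
move=> d0.
have -> : tube d = (fun tv : R * (R * R) => g tv.1 + tv.2) @` (`[0, 1]%classic `*` box 0 d).
  apply/seteqP; split => [q [t [t0 t1 qt]]|_ [[t v] /= [tI vd] <-]].
    by exists (t, q - g t); rewrite /box /= ?subr0 ?in_itv /= ?t0 ?t1 // addrC subrK.
  move: tI; rewrite in_itv /= => /andP[t0 t1]; exists t; split => //.
  by move: vd; rewrite /box /= subr0 addrC addKr.
apply: continuous_compact; last by apply: compact_setX; [exact: segment_compact|exact: (@compact_box _ 0 d)].
apply: continuous_subspaceT => tv; apply: cvgD; last exact: cvg_snd.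
apply: (@continuous_comp _ _ _ fst g); [exact: cvg_fst|exact: continuous_curve].
Qed.

Lemma vel_out t : ~ (0 <= t /\ t <= 1) -> vel1 g t = 0 /\ vel2 g t = 0.
Proof.
move=> nt; have nI : ~ (`[0, 1]%classic : set R) t.
  by rewrite /= in_itv /= => /andP.
by rewrite /vel1 /vel2 !patchE memNset.
Qed.

Lemma conv_out phi d z : (forall v, d < `|v| -> phi v = 0) -> ~ tube d z ->
  cv1 g phi z = 0 /\ cv2 g phi z = 0.
Proof.
move=> p0 nz.
have H t : phi (z - g t) * vel1 g t = 0 /\ phi (z - g t) * vel2 g t = 0.
  have [[t0 t1]|/vel_out[-> ->]] := pselect (0 <= t /\ t <= 1); last by rewrite !mulr0.
  rewrite p0 ?mul0r// ltNge; apply/negP => zt; apply: nz; exists t; split => //.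
have I0 (f : R -> R) : (forall t, f t = 0) -> \int[mu]_t f t = 0.
  move=> f0; have -> : f = cst 0 by apply/funext.
  by rewrite Rintegral_cst// mul0r.
by split; apply: I0 => t; have [] := H t.
Qed.

Lemma test_conv Omega phi d : 0 <= d -> tube d `<=` Omega -> test_function setT phi ->
  (forall v, d < `|v| -> phi v = 0) ->
  test_function Omega (cv1 g phi) /\ test_function Omega (cv2 g phi).
Proof.
move=> d0 dO tp p0; have cK := compact_tube d0; split.
  apply: (test_functionP (mconv_smooth mg i1 tp) cK dO) => z nz.
  exact: (conv_out p0 nz).1.
apply: (test_functionP (mconv_smooth mg i2 tp) cK dO) => z nz.
exact: (conv_out p0 nz).2.
Qed.

(** The analogue of [good] for a curve: the mollified current is supported in a compact tube inside
    [Omega]. *)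
Definition fine_scale Omega s :=
  0 < s /\ exists d, [/\ 0 < d, 2 <= s * d ^+ 2 & tube d `<=` Omega].

Lemma fine_scaleT s : 0 < s -> fine_scale setT s.
Proof. by move=> s0; split => //; have [d d0 sd] := exists_radius s0; exists d. Qed.

Lemma fine_scale_exists Omega d : open Omega -> (forall t, Omega (g t)) -> 0 < d ->
  exists s e, [/\ 0 < e, e <= d, 0 < s, 2 <= s * e ^+ 2 & fine_scale Omega s].
Proof.
move=> oO gO d0.
have KO : tube 0 `<=` Omega.
  by move=> q [t [_ _]]; rewrite /box /= normr_le0 subr_eq0 => /eqP ->.
have [r r0 Hr] := compact_margin oO (compact_tube (lexx 0)) KO.
pose e := Num.min r d.
have e0 : 0 < e by rewrite lt_min r0.
have se : 2 <= 2 / e ^+ 2 * e ^+ 2 by rewrite divfK// expf_neq0// lt0r_neq0.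
exists (2 / e ^+ 2), e; split => //; first by rewrite /e ge_min lexx orbT.
  by rewrite divr_gt0// exprn_gt0.
split; first by rewrite divr_gt0// exprn_gt0.
exists e; split => // q [t [t0 t1 qt]]; apply: (Hr (g t)).
  by exists t; split => //; exact: box_center.
by move: qt; rewrite /box /= => /le_trans; apply; rewrite /e ge_min lexx.
Qed.

(** The period of [h dx + k dy] seen through the mollified current, before division by [mass]. *)
Definition Lam Omega s h k : R := I2 Omega (fun p => h p * J1 g s p + k p * J2 g s p).

Section InOmega.
Variable Omega : set (R * R).
Hypothesis oO : open Omega.
Let mO : pmset Omega := open_pmset oO.

Lemma test_J s : fine_scale Omega s -> test_function Omega (J1 g s) /\ test_function Omega (J2 g s).
Proof.
move=> [s0 [d [d0 sd dO]]]; apply: (test_conv (ltW d0) dO (test_moll s0)) => v.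
exact: moll_far.
Qed.

Lemma intg_mul_J s h k : 0 < s -> intg Omega h -> intg Omega k ->
  intg Omega (fun p => h p * J1 g s p) /\ intg Omega (fun p => k p * J2 g s p).
Proof.
move=> s0 ih ik; have [M M0 HM] := J_bounded; have [c1 c2] := smooth_J s0.
by split; apply: (@intgM_bounded _ _ _ _ (s * M)) => // [|p _]; try (by have [] := HM s p s0);
  (apply: (@pmfun_sub _ setT) => //; [exact: pmsetT|apply: continuous_pmfun => [|p _]; [exact: openT|]]);
  [exact: (smooth_continuous c1)|exact: (smooth_continuous c2)].
Qed.

End InOmega.
End OneCurve.
End Periods.

Section PeriodFunctional.
Context {R : realType}.
Local Notation mu := (@lebesgue_measure R).
Implicit Types (F phi h k : R * R -> R) (z p q : R * R) (s r d t : R) (Omega : set (R * R)).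
Local Notation cv1 g := (@mconv R _ _ mu g (vel1 g)).
Local Notation cv2 g := (@mconv R _ _ mu g (vel2 g)).
Variable g : R -> R * R.
Hypothesis cg : smooth_closed_curve g.

Let mg := measurable_curve cg.
Let i1 := (integrable_vel cg).1.
Let i2 := (integrable_vel cg).2.

Lemma test_out Omega phi p : test_function Omega phi -> ~ Omega p -> phi p = 0.
Proof. by move=> /test_functionE[K [_ KO K0]] np; apply: K0 => /KO. Qed.

Lemma testB Omega phi psi : test_function Omega phi -> test_function Omega psi ->
  test_function Omega (phi \- psi).
Proof.
move=> t1 t2; have [K1 [c1 O1 z1]] := test_functionE t1; have [K2 [c2 O2 z2]] := test_functionE t2.
apply: (@test_functionP _ _ _ (K1 `|` K2)).
- by move=> n; apply: Ck_onB; [exact: openT|case: t1|case: t2].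
- exact: compactU.
- by move=> p [/O1|/O2].
- by move=> p /not_orP[/z1 /= -> /z2 ->]; rewrite subrr.
Qed.

Lemma mconvD (v : R -> R) f1 f2 f3 f4 z Omega : mu.-integrable setT (EFin \o v) ->
  test_function Omega f1 -> test_function Omega f2 -> test_function Omega f3 -> test_function Omega f4 ->
  (forall p, f1 p + f2 p = f3 p - f4 p) ->
  @mconv R _ _ mu g v f1 z + @mconv R _ _ mu g v f2 z = @mconv R _ _ mu g v f3 z - @mconv R _ _ mu g v f4 z.
Proof.
move=> iv t1 t2 t3 t4 E.
have H f : test_function Omega f -> mu.-integrable setT (EFin \o (fun t => f (z - g t) * v t)).
  by move=> tf; have [M _ HM] := test_bounded tf; exact: (mconv_integrable mg iv z (test_continuous tf) HM).
rewrite /mconv -(RintegralD measurableT (H _ t1) (H _ t2)) -(RintegralB measurableT (H _ t3) (H _ t4)).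
by apply: eq_Rintegral => t _; rewrite -mulrDl E mulrBl.
Qed.

(* Hence the mollified currents of two scales differ by the rotated gradient of
   a test function, which closed forms do not see. *)
Lemma J_diff_partials s r z : 0 < s -> 0 < r ->
  has_partials (fun z => cv2 g (kern1 s r) z - cv1 g (kern2 s r) z) z
    (J2 g s z - J2 g r z) (- (J1 g s z - J1 g r z)).
Proof.
have alg (a b c e a' e' j1 j2 : R) : a + b = 0 -> c + e = 0 -> j1 = a + a' -> j2 = e' + e ->
  e' - c = j2 /\ b - a' = - j1 by lra.
move=> s0 r0; have [t1 t2] := test_kern s0 r0.
have := has_partialsB (mconv_partials mg i2 z t1) (mconv_partials mg i1 z t2).
have e1 := closed_curve_integral cg z t1; have e2 := closed_curve_integral cg z t2.
have kd p : dx (kern1 s r) p + dy (kern2 s r) p = moll s p - moll r p by have [] := kern_partials p s0 r0.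
have m1 : J1 g s z - J1 g r z = cv1 g (dx (kern1 s r)) z + cv1 g (dy (kern2 s r)) z.
  exact: esym (mconvD z i1 (test_dx t1) (test_dy t2) (test_moll s0) (test_moll r0) kd).
have m2 : J2 g s z - J2 g r z = cv2 g (dx (kern1 s r)) z + cv2 g (dy (kern2 s r)) z.
  exact: esym (mconvD z i2 (test_dx t1) (test_dy t2) (test_moll s0) (test_moll r0) kd).
have [a1 a2] := alg _ _ _ _ _ _ _ _ e1 e2 m1 m2.
have cong (f : R * R -> R) (a b a' b' : R) : a = a' -> b = b' -> has_partials f z a b -> has_partials f z a' b'.
  by move=> -> ->.
exact: cong.
Qed.

Opaque J1 J2.

Section InOmega.
Variable Omega : set (R * R).
Hypothesis oO : open Omega.
Let mO : pmset Omega := open_pmset oO.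

Lemma Lam_scale s r h k : intg Omega h -> intg Omega k -> weak_closed Omega h k ->
  fine_scale g Omega s -> fine_scale g Omega r -> Lam g Omega s h k = Lam g Omega r h k.
Proof.
have alg (u v x y a b c e : R) : x = a - b -> y = - (c - e) ->
    u * y - v * x = (u * e + v * b) - (u * c + v * a) by move=> -> ->; ring.
move=> ih ik hc [s0 [d [d0 sd dO]]] [r0 [e [e0 re eO]]].
pose m := Num.max d e.
have m0 : 0 < m by rewrite lt_max d0.
have mO' : tube g m `<=` Omega by rewrite /m; case: leP => _.
have sq x : 0 < x -> x <= m -> x ^+ 2 <= m ^+ 2.
  by move=> x0 xm; rewrite ler_sqr// nnegrE ltW.
have sm : 2 <= s * m ^+ 2.
  by apply: (le_trans sd); rewrite ler_wpM2l ?(ltW s0)// sq// le_max lexx.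
have rm : 2 <= r * m ^+ 2.
  by apply: (le_trans re); rewrite ler_wpM2l ?(ltW r0)// sq// le_max lexx orbT.
have far v : m < `|v| -> kern s r v = 0 by exact: kern_far.
have far1 v : m < `|v| -> kern1 s r v = 0 by move=> /far; rewrite /kern1 => ->; rewrite mulr0.
have far2 v : m < `|v| -> kern2 s r v = 0 by move=> /far; rewrite /kern2 => ->; rewrite mulr0.
have [t1 t2] := test_kern s0 r0.
have [_ u2] := test_conv cg (ltW m0) mO' t1 far1; have [u1 _] := test_conv cg (ltW m0) mO' t2 far2.
have := hc _ (testB u2 u1).
have P z := J_diff_partials z s0 r0.
have [a1 a2] := intg_mul_J cg oO s0 ih ik; have [b1 b2] := intg_mul_J cg oO r0 ih ik.
rewrite /Lam.
have a := intgD mO a1 a2; have b := intgD mO b1 b2.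
have -> : I2 Omega (fun p => h p * dy (cv2 g (kern1 s r) \- cv1 g (kern2 s r)) p -
    k p * dx (cv2 g (kern1 s r) \- cv1 g (kern2 s r)) p) =
  I2 Omega (fun p => (h p * J1 g r p + k p * J2 g r p) - (h p * J1 g s p + k p * J2 g s p)).
  apply: eq_I2 => p _; have [_ [Ex Ey]] := P p.
  exact: alg Ex Ey.
rewrite (I2B mO b a) => /subr0_eq H; exact: esym H.
Qed.

(** The current is divergence-free, so the integrand is the divergence of [phi] times the current, a
    field of compact support. *)
Lemma Lam_exact s phi : 0 < s -> test_function Omega phi -> Lam g Omega s (dx phi) (dy phi) = 0.
Proof.
move=> s0 tp; have [K [cK KO K0]] := test_functionE tp.
have [sj1 sj2] := smooth_J cg s0; have sp : smooth_on setT phi by case: tp.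
have T J : smooth_on setT J -> test_function Omega (phi \* J).
  move=> sJ; apply: (test_functionP _ cK KO) => [n|p /K0 /= ->]; last by rewrite mul0r.
  by apply: Ck_onM; [exact: openT|exact: sp|exact: sJ].
rewrite -[RHS](test_divergence0 (T _ sj1) (T _ sj2)) /Lam.
have e0 p : ~ Omega p -> dx phi p * J1 g s p + dy phi p * J2 g s p = 0.
  move=> np; have alg (a b c d : R) : a = 0 -> b = 0 -> a * c + b * d = 0 by move=> -> ->; ring.
  exact: alg (test_out (test_dx tp) np) (test_out (test_dy tp) np).
rewrite -(I2_restrict pmsetT mO (@subsetT _ _) (fun p _ => e0 p)).
apply: eq_I2 => p _.
have hp := test_has_partials p tp.
have P J : smooth_on setT J -> has_partials J p (dx J p) (dy J p).
  by move=> sJ; apply: has_partials_diff; exact: smooth_diff sJ _.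
have [_ [-> _]] := has_partialsM hp (P _ sj1); have [_ [_ ->]] := has_partialsM hp (P _ sj2).
have alg (a b c d u v w : R) : v + w = 0 -> a * c + b * d = u * v + c * a + (u * w + d * b).
  by move=> vw; rewrite -[w](addKr v) vw; ring.
exact: alg (J_divergence0 cg p s0).
Qed.

End InOmega.
End PeriodFunctional.

Section PeriodIntegral.
Context {R : realType}.
Local Notation mu := (@lebesgue_measure R).
Implicit Types (F phi h k : R * R -> R) (z p q : R * R) (s r d t : R) (Omega : set (R * R)) (g : R -> R * R).

Lemma weak_coclosed_J g Omega s : smooth_closed_curve g -> open Omega -> 0 < s ->
  weak_coclosed Omega (J1 g s) (J2 g s).
Proof.
move=> cg oO s0 phi tp; rewrite -(Lam_exact cg oO s0 tp); apply: eq_I2 => p _.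
have alg (a b c d : R) : a * b + c * d = b * a + d * c by ring.
exact: alg.
Qed.

Lemma weak_closed_J g Omega s : smooth_closed_curve g -> open Omega -> 0 < s ->
  weak_closed Omega (J2 g s) (fun p => - J1 g s p).
Proof. by move=> cg oO s0; apply: weak_closed_swap; exact: weak_coclosed_J. Qed.

Lemma intg_J g s : smooth_closed_curve g -> 0 < s -> intg setT (J1 g s) /\ intg setT (J2 g s).
Proof.
move=> cg s0; have [t1 t2] := test_J cg (fine_scaleT g s0).
by split; [exact: (test_intg t1)|exact: (test_intg t2)].
Qed.

(* Over the whole plane all scales are admissible, and the mollified current of scale s is O(s). *)
Lemma Lam_J_cross g g' s r : smooth_closed_curve g -> smooth_closed_curve g' -> 0 < s -> 0 < r ->
  Lam g' setT r (J2 g s) (fun p => - J1 g s p) = 0.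
Proof.
move=> cg cg' s0 r0; have [iJ1 iJ2] := intg_J cg s0.
have iJ1N : intg setT (fun p => - J1 g s p).
  by apply: (intg_eq pmsetT _ (intgZ (-1) pmsetT iJ1)) => p _; rewrite ?mulN1r.
have wc := weak_closed_J cg openT s0.
have [M M0 HM] := J_bounded cg'.
pose C := I2 setT (fun p => `|J2 g s p|) * M + I2 setT (fun p => `|- J1 g s p|) * M.
have n1 := intg_norm pmsetT iJ1N; have n2 := intg_norm pmsetT iJ2.
have C0 : 0 <= C by apply: addr_ge0; apply: mulr_ge0 => //; exact: I2_ge0.
apply/eqP; rewrite -normr_eq0 eq_le normr_ge0 andbT.
apply/ler_addgt0Pl => e e0; rewrite addr0.
(* A small parameter means a wide mollifier; scale independence allows [r] to be replaced by [x]. *)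
pose x := e / (C + 1).
have x0 : 0 < x by rewrite divr_gt0// ltr_wpDl.
rewrite (Lam_scale cg' openT iJ2 iJ1N wc (fine_scaleT g' r0) (fine_scaleT g' x0)).
have [a b] := intg_mul_J cg' openT x0 iJ2 iJ1N.
apply: (le_trans (norm_I2 pmsetT (intgD pmsetT a b))).
apply: (@le_trans _ _ (x * C)).
  have -> : x * C = I2 setT (fun p => x * M * `|J2 g s p| + x * M * `|- J1 g s p|).
    have E := etrans (I2D pmsetT (intgZ (x * M) pmsetT n2) (intgZ (x * M) pmsetT n1))
      (congr2 +%R (I2Z (x * M) pmsetT n2) (I2Z (x * M) pmsetT n1)).
    have alg (u v : R) : x * (u * M + v * M) = x * M * u + x * M * v by ring.
    exact: etrans (alg _ _) (esym E).
  apply: le_I2.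
  - exact: pmsetT.
  - by apply: (intg_norm pmsetT); exact: (intgD pmsetT a b).
  - exact: (intgD pmsetT (intgZ (x * M) pmsetT n2) (intgZ (x * M) pmsetT n1)).
  - move=> p _; have [b1 b2] := HM x p x0.
    have alg (u v K : R) : `|v| <= K -> `|u * v| <= K * `|u|.
      by move=> vK; rewrite normrM mulrC ler_wpM2r.
    exact: le_trans (ler_normD _ _) (lerD (alg _ _ _ b1) (alg _ _ _ b2)).
by rewrite /x -mulrA ler_piMr ?(ltW e0)// mulrC ler_pdivrMr ?ltr_wpDl// mul1r lerDl.
Qed.

Lemma integrable_curve_mul (f v : R -> R) : continuous f -> continuous v ->
  mu.-integrable setT (EFin \o (fun t => f t * (v \_ `[0, 1]) t)).
Proof.
move=> cf cv.
have -> : (fun t => f t * (v \_ `[0, 1]) t) = (fun t => f t * v t) \_ `[0, 1].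
  by apply/funext => t; rewrite !patchE; case: ifP => // _; rewrite mulr0.
by apply: integrable_patch01 => t; apply: cvgM; [exact: cf|exact: cv].
Qed.

(* [A t] approximates [mass * f t] on [0, 1]. *)
Lemma patch_integral_le (A f v : R -> R) (e : R) : continuous A -> continuous f -> continuous v ->
  (forall t, 0 <= t -> t <= 1 -> `|A t - mass * f t| <= e) ->
  `|\int[mu]_t (A t * (v \_ `[0, 1]) t) - mass * \int[mu]_t (f t * (v \_ `[0, 1]) t)| <=
    e * \int[mu]_t `|(v \_ `[0, 1]) t|.
Proof.
move=> cA cf cv He.
have iA := integrable_curve_mul cA cv; have if_ := integrable_curve_mul cf cv.
have iv := integrable_patch01 cv.
have imf : mu.-integrable setT (EFin \o (fun t => mass * (f t * (v \_ `[0, 1]) t))).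
  exact (integrableZl measurableT mass if_).
rewrite -(RintegralZl mass measurableT if_) -(RintegralB measurableT iA imf).
have iB := integrableB measurableT iA imf.
apply: (le_trans (le_normr_Rintegral measurableT iB)).
have ine : mu.-integrable setT (EFin \o (fun t => e * `|(v \_ `[0, 1]) t|)).
  exact (integrableZl measurableT e (integrable_norm iv)).
rewrite -(RintegralZl e measurableT (integrable_norm iv)).
apply: (le_Rintegral measurableT (integrable_norm iB) ine) => t _.
rewrite [leLHS]/comp mulrA -mulrBl normrM patchE; case: ifP => [/set_mem|_]; last by rewrite normr0 !mulr0.
by rewrite /= in_itv /= => /andP[t0 t1]; rewrite ler_wpM2r// He.
Qed.

End PeriodIntegral.

(** * Mollified currents compute line integrals *)

Section LineIntegral.
Context {R : realType}.
Local Notation P2 := (measurableTypeR R * measurableTypeR R)%type.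
Local Notation mu := (@lebesgue_measure R).
Implicit Types (F phi h k : R * R -> R) (z p q : R * R) (s r d t : R).
Variables (g : R -> R * R) (Omega : set (R * R)).
Hypothesis cg : smooth_closed_curve g.
Hypothesis oO : open Omega.
Hypothesis gO : forall t, Omega (g t).
Let mO : pmset Omega := open_pmset oO.
Let mg := measurable_curve cg.
Let i1 := (integrable_vel cg).1.
Let i2 := (integrable_vel cg).2.

Lemma continuous_smear h r : intg Omega h -> 0 < r ->
  continuous (fun t => I2 setT (fun z => (h \_ Omega) z * moll r (z - g t))).
Proof.
move=> ih r0.
have mid : measurable_fun setT (id : P2 -> P2) by exact: measurable_id.
pose A := @mconv R _ P2 (@lambda2 R) id (h \_ Omega) (moll r).
have cA : continuous A.
  move=> q; exact: smooth_continuous (mconv_smooth mid (intg_patch oO ih) (test_moll r0)) _.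
have -> : (fun t => I2 setT (fun z => (h \_ Omega) z * moll r (z - g t))) = A \o g.
  apply/funext => t; apply: eq_I2 => z _ /=.
  by rewrite -[moll r (z - g t)]moll_sym opprB mulrC.
by move=> t; exact: continuous_comp (continuous_curve cg (x := t)) (cA _).
Qed.

Lemma line_integralE h k : (forall p, Omega p -> {for p, continuous h}) ->
  (forall p, Omega p -> {for p, continuous k}) ->
  line_integral g (h, k) =
    \int[mu]_t (h (g t) * vel1 g t) + \int[mu]_t (k (g t) * vel2 g t).
Proof.
move=> ch ck; have [v1 v2] := continuous_velocity cg.
have c1 t : {for t, continuous (fun t => h (g t))} := continuous_comp (continuous_curve cg (x := t)) (ch _ (gO t)).
have c2 t : {for t, continuous (fun t => k (g t))} := continuous_comp (continuous_curve cg (x := t)) (ck _ (gO t)).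
have j1 := integrable_curve_mul c1 v1; have j2 := integrable_curve_mul c2 v2.
rewrite -(RintegralD measurableT j1 j2) /line_integral Rintegral_mkcond.
apply: eq_Rintegral => t _; rewrite !patchE; case: ifP => // _.
by rewrite !mulr0 addr0.
Qed.

Lemma Lam_smear h k r : intg Omega h -> intg Omega k -> 0 < r ->
  Lam g Omega r h k =
    \int[mu]_t (I2 setT (fun z => (h \_ Omega) z * moll r (z - g t)) * vel1 g t) +
    \int[mu]_t (I2 setT (fun z => (k \_ Omega) z * moll r (z - g t)) * vel2 g t).
Proof.
move=> ih ik r0; have [a b] := intg_mul_J cg oO r0 ih ik.
have [M _ HM] := test_bounded (test_moll r0); have cm := test_continuous (test_moll r0).
have F1 := mconv_fubini mg i1 cm HM (intg_patch oO ih).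
have F2 := mconv_fubini mg i2 cm HM (intg_patch oO ik).
have P (f J : R * R -> R) : I2 Omega (fun p => f p * J p) = I2 setT (fun p => (f \_ Omega) p * J p).
  rewrite [LHS]Rintegral_mkcond; apply: eq_I2 => q _.
  by rewrite !patchE; case: ifP => // _; rewrite mul0r.
exact: etrans (I2D mO a b) (congr2 +%R (etrans (P _ _) F1) (etrans (P _ _) F2)).
Qed.

(** The left side is the same at all fine scales, and its distance to the right side tends to 0 with
    the radius; so equality holds at every fine scale. *)
Lemma Lam_line_integral h k s : intg Omega h -> intg Omega k -> weak_closed Omega h k ->
  (forall p, Omega p -> {for p, continuous h}) -> (forall p, Omega p -> {for p, continuous k}) ->
  fine_scale g Omega s -> Lam g Omega s h k = mass * line_integral g (h, k).
Proof.
have alg (y a b c f u v : R) : `|a - mass * c| <= y * u -> `|b - mass * f| <= y * v ->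
    `|a + b - mass * (c + f)| <= y * (u + v).
  move=> A B; have -> : a + b - mass * (c + f) = (a - mass * c) + (b - mass * f) by ring.
  by rewrite (le_trans (ler_normD _ _))// mulrDr lerD.
have fin (m V x : R) : 0 < m -> 0 <= V -> 0 < x -> x / (m * V + 1) * m * V <= x.
  move=> m0 V0 x0; have p0 : 0 <= m * V by rewrite mulr_ge0// ltW.
  rewrite -mulrA mulrAC ler_pdivrMr ?ltr_wpDl// ler_wpM2l// ?lerDl//.
  exact: ltW.
move=> ih ik hc ch ck fs.
have n0 (f : R -> R) : 0 <= \int[mu]_t `|f t| by apply: Rintegral_ge0.
pose V := \int[mu]_t `|vel1 g t| + \int[mu]_t `|vel2 g t|.
have V0 : 0 <= V by rewrite addr_ge0.
have m0 := @mass_gt0 R.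
have K0 : compact (tube g 0) := compact_tube cg (lexx 0).
have KO q : tube g 0 q -> Omega q.
  by move=> [t [_ _]]; rewrite /box /= normr_le0 subr_eq0 => /eqP ->.
apply/eqP; rewrite -subr_eq0 -normr_eq0 eq_le normr_ge0 andbT.
apply/ler_addgt0Pl => x x0; rewrite addr0.
pose e := x / (mass * V + 1).
have e0 : 0 < e by rewrite divr_gt0// ltr_wpDl// mulr_ge0// ltW.
have [d1 d10 H1] := compact_modulus K0 e0 (fun z Kz => ch z (KO z Kz)).
have [d2 d20 H2] := compact_modulus K0 e0 (fun z Kz => ck z (KO z Kz)).
have [d3 d30 H3] := compact_margin oO K0 KO.
(* The radius respects three bounds: the oscillation of [h], that of [k], and the margin of the
   curve in [Omega]. *)
have [r [d [d0 dm r0 rd fr]]] := fine_scale_exists cg oO gO (d := Num.min d1 (Num.min d2 d3)) ltac:(by rewrite !lt_min d10 d20).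
move: dm; rewrite !le_min => /and3P[dd1 dd2 dd3].
rewrite (Lam_scale cg oO ih ik hc fs fr) (Lam_smear ih ik r0) (line_integralE ch ck).
have near_h f : intg Omega f -> (forall z q, tube g 0 z -> `|q - z| <= d -> `|f q - f z| <= e) ->
    forall t, 0 <= t -> t <= 1 ->
    `|I2 setT (fun z => (f \_ Omega) z * moll r (z - g t)) - mass * f (g t)| <= e * mass.
  move=> if_ Hf t t0 t1.
  have Kg : tube g 0 (g t) by exists t; split => //; exact: box_center.
  have E q : Omega q -> (f \_ Omega) q = f q by move=> Oq; rewrite patchE mem_set.
  rewrite -(E _ (gO t)); apply: (moll_approx r0 d0 rd (intg_patch oO if_)) => q qd.
  rewrite (E _ (gO t)) E; first exact: Hf.
  by apply: (H3 _ Kg); rewrite /box /=; exact: le_trans dd3.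
have [v1 v2] := continuous_velocity cg.
have c1 t : {for t, continuous (fun t => h (g t))} := continuous_comp (continuous_curve cg (x := t)) (ch _ (gO t)).
have c2 t : {for t, continuous (fun t => k (g t))} := continuous_comp (continuous_curve cg (x := t)) (ck _ (gO t)).
have L1 : `|\int[mu]_t (I2 setT (fun z => (h \_ Omega) z * moll r (z - g t)) * vel1 g t) -
    mass * \int[mu]_t (h (g t) * vel1 g t)| <= e * mass * \int[mu]_t `|vel1 g t|
  := patch_integral_le (continuous_smear ih r0) c1 v1 (near_h _ ih (fun z q Kz zq => H1 z q Kz (le_trans zq dd1))).
have L2 : `|\int[mu]_t (I2 setT (fun z => (k \_ Omega) z * moll r (z - g t)) * vel2 g t) -
    mass * \int[mu]_t (k (g t) * vel2 g t)| <= e * mass * \int[mu]_t `|vel2 g t|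
  := patch_integral_le (continuous_smear ik r0) c2 v2 (near_h _ ik (fun z q Kz zq => H2 z q Kz (le_trans zq dd2))).
have L := alg _ _ _ _ _ _ _ L1 L2.
apply: (le_trans L).
exact: fin m0 V0 x0.
Qed.

End LineIntegral.

(** * The Hilbert space of square-integrable forms *)

Lemma quadratic_discriminant {R : realFieldType} (b c k : R) : 0 <= k ->
  (forall t, 2 * t * b <= t ^+ 2 * k + c) -> b ^+ 2 <= k * c.
Proof.
rewrite le_eqVlt => /predU1P[<- H|k0 H].
  rewrite mul0r; have [->|b0] := eqVneq b 0; first by rewrite expr0n.
  (* For [k = 0] the left side is linear in [t], and this [t] makes it exceed [c]. *)
  have := H ((c + 1) / (2 * b)).
  have -> : 2 * ((c + 1) / (2 * b)) * b = c + 1 by field.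
  by rewrite mulr0 add0r; lra.
have := H (b / k); rewrite -(ler_pM2l k0).
have -> : k * (2 * (b / k) * b) = 2 * b ^+ 2 by field; exact: lt0r_neq0.
have -> : k * ((b / k) ^+ 2 * k + c) = b ^+ 2 + k * c by field; exact: lt0r_neq0.
lra.
Qed.

(* [lin a x y] stands for [a x + y]. *)
Section Projection.
Context {R : realType} {V : Type}.
Variables (L S : set V) (lin : R -> V -> V -> V) (ip : V -> V -> R).
Hypothesis L_lin : forall a x y, L x -> L y -> L (lin a x y).
Hypothesis ipC : forall x y, ip x y = ip y x.
Hypothesis ip_lin : forall a x y z, L x -> L y -> L z -> ip (lin a x y) z = a * ip x z + ip y z.
Hypothesis ip_ge0 : forall x, 0 <= ip x x.

Lemma ip_linr a x y z : L x -> L y -> L z -> ip z (lin a x y) = a * ip z x + ip z y.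
Proof. by move=> Lx Ly Lz; rewrite ipC ip_lin// !(ipC z). Qed.

Lemma ip_lin2 a x y : L x -> L y ->
  ip (lin a x y) (lin a x y) = a ^+ 2 * ip x x + 2 * a * ip x y + ip y y.
Proof.
move=> Lx Ly; have Lxy := L_lin a Lx Ly.
by rewrite ip_lin// !ip_linr// (ipC y x); ring.
Qed.

Lemma cauchy_schwarz x y : L x -> L y -> ip x y ^+ 2 <= ip x x * ip y y.
Proof.
move=> Lx Ly; apply: quadratic_discriminant => // t.
by have := ip_ge0 (lin (- t) x y); rewrite ip_lin2// sqrrN; lra.
Qed.

(** The squared distance, [lin (-1) y x] being [x - y]. *)
Definition dist2 x y := ip (lin (-1) y x) (lin (-1) y x).

Hypothesis complete : forall u : nat -> V, (forall n, L (u n)) ->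
  (forall e, 0 < e -> exists N, forall m n, (N <= m)%N -> (N <= n)%N -> dist2 (u m) (u n) <= e) ->
  exists2 l, L l & dist2 (u n) l @[n --> \oo] --> 0.
Hypothesis SL : S `<=` L.
Hypothesis S_lin : forall a x y, S x -> S y -> S (lin a x y).
Hypothesis S0 : S !=set0.

Lemma dist2E x y : L x -> L y -> dist2 x y = ip x x - 2 * ip x y + ip y y.
Proof. by move=> Lx Ly; rewrite /dist2 ip_lin2// (ipC y x); ring. Qed.

(** A subspace [S] that is not closed may contain no nearest point to [w]. The result is therefore
    the component [h] orthogonal to [S], with elements of [S] that approach [w - h]. *)
Theorem projection w : L w -> exists h (s : nat -> V),
  [/\ L h, forall n, S (s n), dist2 (lin (-1) (s n) w) h @[n --> \oo] --> 0 &
      forall x, S x -> ip h x = 0].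
Proof.
move=> Lw.
pose A := [set dist2 w s | s in S].
have Alb : has_lbound A by exists 0 => _ [s _ <-]; exact: ip_ge0.
have A0 : A !=set0 by have [s Ss] := S0; exists (dist2 w s); exists s.
pose d := inf A.
have dle s : S s -> d <= dist2 w s by move=> Ss; apply: ge_inf => //; exists s.
have ex n : exists s, S s /\ dist2 w s <= d + n.+1%:R^-1.
  have e0 : 0 < n.+1%:R^-1 :> R by rewrite invr_gt0.
  have [_ [s Ss <-] H] := inf_adherent e0 (conj A0 Alb).
  by exists s; split => //; exact: ltW.
pose s n := projT1 (cid (ex n)).
have Ss n : S (s n) by rewrite /s; case: cid => x [].
have ds n : dist2 w (s n) <= d + n.+1%:R^-1 by rewrite /s; case: cid => x [].
have Ls n : L (s n) := SL (Ss n).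
pose u n := lin (-1) (s n) w.
have Lu n : L (u n) by exact: L_lin.
have cau m n : dist2 (u m) (u n) <= 2 * m.+1%:R^-1 + 2 * n.+1%:R^-1.
  (* The midpoint of [s m] and [s n]: its squared distance to [w] is at least [d], and the
     parallelogram identity bounds [dist2 (u m) (u n)]. *)
  pose mid := lin (2^-1) (lin (-1) (s n) (s m)) (s n).
  have Smid : S mid by apply: S_lin => //; exact: S_lin.
  have := dle _ Smid; have := ds m; have := ds n.
  have Ld : L (lin (-1) (s n) (s m)) by exact: L_lin.
  rewrite !dist2E//; last exact: SL.
  have E1 : ip mid mid = 2^-1 ^+ 2 * ip (lin (-1) (s n) (s m)) (lin (-1) (s n) (s m)) +
      2 * 2^-1 * ip (lin (-1) (s n) (s m)) (s n) + ip (s n) (s n) by exact: ip_lin2.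
  have E2 : ip w mid = 2^-1 * ip w (lin (-1) (s n) (s m)) + ip w (s n) by exact: ip_linr.
  have E3 : ip (u m) (u n) = -1 * (-1 * ip (s m) (s n) + ip (s m) w) + (-1 * ip w (s n) + ip w w).
    by rewrite (ip_lin (-1) (Ls m) Lw (Lu n)) (ip_linr (-1) (Ls n) Lw (Ls m)) (ip_linr (-1) (Ls n) Lw Lw).
  have E4 k : ip (u k) (u k) = (-1) ^+ 2 * ip (s k) (s k) + 2 * -1 * ip (s k) w + ip w w by exact: ip_lin2.
  rewrite E1 E2 E3 !E4 (ip_lin2 (-1) (Ls n) (Ls m)) (ip_lin (-1) (Ls n) (Ls m) (Ls n)) (ip_linr (-1) (Ls n) (Ls m) Lw).
  rewrite (ipC w (s m)) (ipC w (s n)) (ipC (s n) (s m)).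
  move: (n.+1%:R^-1) (m.+1%:R^-1) => e1 e2.
  move: (ip w w) (ip (s m) w) (ip (s n) w) (ip (s m) (s m)) (ip (s n) (s n)) (ip (s m) (s n)) => a1 a2 a3 a4 a5 a6.
  lra.
have [h Lh uh] : exists2 h, L h & dist2 (u n) h @[n --> \oo] --> 0.
  apply: complete => // e e0.
  have [N _ HN] := near_infty_natSinv_lt (PosNum (divr_gt0 e0 (@ltr0n R 4))).
  exists N => m n Nm Nn; apply: (le_trans (cau m n)).
  have H1 : m.+1%:R^-1 < e / 4 := HN m Nm; have H2 : n.+1%:R^-1 < e / 4 := HN n Nn.
  by move: H1 H2; move: (m.+1%:R^-1) (n.+1%:R^-1) => e1 e2; lra.
exists h, s; split => // x Sx; have Lx := SL Sx.
(* Moving [s n] by [t x] cannot bring the squared distance below [d]; the discriminant in [t] shows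
   that [u n] is almost orthogonal to [x]. *)
have us n : ip (u n) x ^+ 2 <= ip x x * n.+1%:R^-1.
  apply: quadratic_discriminant => // t.
  have := dle _ (S_lin t Sx (Ss n)); have := ds n.
  have Lt : L (lin t x (s n)) by exact: L_lin.
  rewrite !dist2E// ip_lin2// /u ip_lin// !ip_linr// (ipC w x) (ipC (s n) x).
  move: (n.+1%:R^-1) (ip w w) (ip x w) (ip x (s n)) (ip (s n) w) (ip (s n) (s n)) (ip x x) => e1 a1 a2 a3 a4 a5 a6.
  lra.
have hx n : ip h x ^+ 2 <= 2 * ip x x * (n.+1%:R^-1 + dist2 (u n) h).
  have := us n; have := cauchy_schwarz (L_lin (-1) Lh (Lu n)) Lx.
  rewrite -/(dist2 (u n) h) ip_lin//.
  move: (n.+1%:R^-1) (dist2 _ _) (ip h x) (ip (u n) x) (ip x x) => e1 D a b c.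
  move=> H1 H2; have : a ^+ 2 <= 2 * (-1 * a + b) ^+ 2 + 2 * b ^+ 2.
    rewrite -subr_ge0; have -> : 2 * (-1 * a + b) ^+ 2 + 2 * b ^+ 2 - a ^+ 2 = (2 * b - a) ^+ 2 by ring.
    exact: sqr_ge0.
  by move: H1 H2; move: ((-1 * a + b) ^+ 2) (b ^+ 2) => v1 v2; lra.
have lim0 : 2 * ip x x * (n.+1%:R^-1 + dist2 (u n) h) @[n --> \oo] --> (0 : R).
  rewrite -[X in _ --> X](mulr0 (2 * ip x x)); apply: cvgM; first exact: cvg_cst.
  by rewrite -[X in _ --> X]addr0; apply: cvgD => //; exact: cvg_harmonic.
apply/eqP; rewrite -sqrf_eq0 eq_le sqr_ge0 andbT.
rewrite -(cvg_lim (@Rhausdorff R) lim0); apply: limr_ge; first by apply/cvg_ex; exists 0.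
exact: nearW.
Qed.

End Projection.

(** * The Riesz-Fischer theorem on a set of finite measure *)

Section RieszFischer.
Context {R : realType} d (T : measurableType d) (mu : {measure set T -> \bar R}) (D : set T).
Hypothesis mD : measurable D.
Hypothesis finD : (mu D < +oo)%E.
Implicit Types (f g : T -> R).

Definition sq_integral f : \bar R := (\int[mu]_(x in D) (f x ^+ 2)%:E)%E.

Lemma measurable_sq f : measurable_fun D f -> measurable_fun D (fun x => (f x ^+ 2)%:E).
Proof. by move=> mf; apply/measurable_EFinP; exact: measurable_funX. Qed.

(** Integrates [|f| <= f ^ 2 / e + e]. With [e = 2 ^ -k] it turns rapid convergence in mean square
    into summable L1 norms. *)
Lemma integral_norm_le f (e : R) : 0 < e -> measurable_fun D f ->
  (\int[mu]_(x in D) `|f x|%:E <= e^-1%:E * sq_integral f + e%:E * mu D)%E.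
Proof.
move=> e0 mf; have ei : 0 <= e^-1 by rewrite invr_ge0 ltW.
have msq := measurable_sq mf.
rewrite -(integral_cst mu mD) -ge0_integralZl//=; last first.
  by move=> x _; rewrite lee_fin sqr_ge0.
rewrite -ge0_integralD//; first last.
- by move=> x _; rewrite lee_fin ltW.
- by apply: (measurable_funeM _ msq).
- by move=> x _; rewrite mule_ge0// lee_fin sqr_ge0.
apply: ge0_le_integral => //.
- by apply/measurable_EFinP; exact: measurableT_comp.
- by apply: emeasurable_funD => //; exact: (measurable_funeM _ msq).
- move=> x _; rewrite -EFinM -EFinD lee_fin -(ler_pM2l e0) mulrDr mulVKf ?lt0r_neq0//.
  by rewrite -[f x ^+ 2]real_normK ?num_real//; have := sqr_ge0 (`|f x| - e); have := sqr_ge0 (`|f x|); nra.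
Qed.

(** A rapidly convergent subsequence converges almost everywhere, and Fatou's lemma carries the
    Cauchy bound to its limit. *)
Lemma riesz_fischer (u : nat -> T -> R) : (forall n, measurable_fun D (u n)) ->
  (forall e : R, 0 < e -> exists N, forall m n, (N <= m)%N -> (N <= n)%N ->
    (sq_integral (fun x => (u m x - u n x)%R) <= e%:E)%E) ->
  exists2 l : T -> R, measurable_fun D l & forall e : R, 0 < e -> exists N, forall n, (N <= n)%N ->
    (sq_integral (fun x => (u n x - l x)%R) <= e%:E)%E.
Proof.
move=> mu_ cau.
have p0 k : 0 < (2^-1 : R) ^+ k by rewrite exprn_gt0.
have /choice[N HN] : forall k, exists N, forall m n, (N <= m)%N -> (N <= n)%N ->
    (sq_integral (fun x => (u m x - u n x)%R) <= ((2^-1 ^+ k) ^+ 2)%:E)%E.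
  by move=> k; apply: cau; rewrite exprn_gt0.
(* Partial sums are nondecreasing and dominate both [N k] and [k]. *)
pose K k := (\sum_(i < k.+1) (N i).+1)%N.
have NK k : (N k <= K k)%N by rewrite /K big_ord_recr /= (leq_trans (leqnSn _))// leq_addl.
have kK k : (k <= K k)%N by rewrite /K; elim: k => // k IH; rewrite big_ord_recr /= addnS ltnS (leq_trans IH)// leq_addr.
have KS k : (K k <= K k.+1)%N by rewrite /K [leqRHS]big_ord_recr /= leq_addr.
pose v k := u (K k).
pose w k x := v k.+1 x - v k x.
have mw k : measurable_fun D (w k) by apply: measurable_funB; exact: mu_.
have Iw k : (\int[mu]_(x in D) `|w k x|%:E <= (2^-1 ^+ k)%:E * (1 + mu D))%E.
  apply: (le_trans (integral_norm_le (p0 k) (mw k))).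
  rewrite (@ge0_muleDr _ (2^-1 ^+ k)%:E 1%E (mu D))//. apply: leeD => //; rewrite mule1.
  have := HN k _ _ (leq_trans (NK k) (KS k)) (NK k).
  have c0 : (0 <= ((2^-1 : R) ^+ k)^-1%:E)%E by rewrite lee_fin invr_ge0 ltW.
  move=> H; apply: (le_trans (lee_wpmul2l c0 H)).
  by rewrite -EFinM lee_fin expr2 mulKf// lt0r_neq0.
pose G x := (\sum_(k <oo) `|w k x|%:E)%E.
have mnw k : measurable_fun D (fun x => `|w k x|%:E).
  by apply/measurable_EFinP; exact: measurableT_comp.
have mG : measurable_fun D G by exact: ge0_emeasurable_sum.
have IG : (\int[mu]_(x in D) G x < +oo)%E.
  rewrite integral_nneseries//.
  have : (\sum_(k <oo) \int[mu]_(x in D) `|w k x|%:E <= \sum_(k <oo) (2^-1 ^+ k)%:E * (1 + mu D))%E.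
    by apply: lee_nneseries => [k _ _|k _]; [exact: integral_ge0|exact: Iw].
  move=> /le_lt_trans; apply.
  have fD : (1 + mu D)%E \is a fin_num by rewrite fin_numD/= ge0_fin_numE.
  pose c := fine (1 + mu D)%E; have c0 : 0 <= c by rewrite fine_ge0// adde_ge0.
  (* The geometric series is written with terms [2 * c / 2 ^ (k + 1)], of sum [2 * c]. *)
  have H := epsilon_trick0 xpredT (mulr_ge0 (ler0n R 2) c0).
  apply: le_lt_trans (ltry (2 * c)); apply: le_trans H.
  apply: lee_nneseries => [k _ _|k _]; first by rewrite mule_ge0 ?lee_fin ?(ltW (p0 k))// adde_ge0.
  rewrite -(fineK fD) -EFinM lee_fin -/c exprVn natrX exprS.
  have := p0 k; rewrite exprVn invr_gt0; move: (2 ^+ k) => x x0.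
  by rewrite le_eqVlt; apply/orP; left; apply/eqP; field; exact: lt0r_neq0.
have aeG : {ae mu, forall x, D x -> G x \is a fin_num}.
  apply: (@integrable_ae _ _ _ mu D mD); apply/integrableP; split => //.
  by under eq_integral do rewrite gee0_abs ?nneseries_ge0//.
(* An upper limit is measurable on all of [D]; [lim_v] identifies it with the limit wherever [G] is
   finite. *)
pose l x := fine (limn_esup (fun k => (v k x)%:E)).
have ml : measurable_fun D l.
  apply/measurableT_comp; first exact: fine_measurable.
  by apply: measurable_fun_limn_esup => k; apply/measurable_EFinP; exact: mu_.
have lim_v x : G x \is a fin_num -> v k x @[k --> \oo] --> l x.
  move=> Gx.
  have cw : cvgn (series (fun k => w k x)).
    apply: normed_cvg; apply: nondecreasing_is_cvgn.
      by apply: (@nondecreasing_series _ (fun k => `|w k x|) xpredT 0%N) => k _ _; exact: normr_ge0.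
    exists (fine (G x)) => _ [n _ <-].
    rewrite -lee_fin fineK// /series/= -sumEFin; exact: nneseries_lim_ge.
  have [c vc] : exists c : R, v k x @[k --> \oo] --> c.
    have /cvg_ex[c sc] := cw; exists (c + v 0 x).
    have -> : (fun k => v k x) = (fun k => series (fun k => w k x) k + v 0 x).
      by apply/funext => k; rewrite /series /= /w telescope_sumr// subrK.
    by apply: cvgD => //; exact: cvg_cst.
  have vcE : (v k x)%:E @[k --> \oo] --> c%:E by apply: cvg_EFin => //; exact: nearW.
  by rewrite /l (cvg_limn_einf_sup vcE).
exists l => // e e0; have [M HM] := cau e e0; exists M => n Mn.
pose f k x := ((u n x - v k x) ^+ 2)%:E.
have mf k : measurable_fun D (f k) by apply: measurable_sq; apply: measurable_funB => //; exact: mu_.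
have f0 k x : D x -> (0 <= f k x)%E by rewrite lee_fin sqr_ge0.
have E : sq_integral (fun x => u n x - l x) = (\int[mu]_(x in D) limn_einf (f^~ x))%E.
  apply: ge0_ae_eq_integral => //.
  - by apply: measurable_sq; apply: measurable_funB => //; exact: mu_.
  - apply: measurableT_comp => //.
    apply: (@measurable_fun_limn_esup _ _ _ D (fun k x => - f k x)%E) => k.
    by apply: measurableT_comp => //; exact: mf.
  - by move=> x _; rewrite lee_fin sqr_ge0.
  - move=> x Dx; rewrite limn_einf_lim; apply: lime_ge; first exact: is_cvg_einfs.
    by apply: nearW => k; apply: le_ereal_inf_tmp => _ [m _ <-]; exact: f0.
  - apply: filterS aeG => x + Dx; move=> /(_ Dx)/lim_v vl.
    have fl : f k x @[k --> \oo] --> ((u n x - l x) ^+ 2)%:E.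
      apply: cvg_EFin; first exact: nearW.
      have ul : u n x - v k x @[k --> \oo] --> u n x - l x by apply: cvgB => //; exact: cvg_cst.
      by rewrite expr2; exact: (cvgM ul ul).
    by rewrite (cvg_limn_einf_sup fl).
rewrite E (le_trans (fatou mu mD mf f0))//.
rewrite limn_einf_lim; apply: lime_le; first exact: is_cvg_einfs.
apply: nearW => k; apply: (@le_trans _ _ (\int[mu]_(x in D) f (maxn k M) x)%E).
  by apply: ereal_inf_lbound; exists (maxn k M) => //=; rewrite leq_maxl.
by apply: HM => //; apply: leq_trans (kK _); rewrite leq_maxr.
Qed.

End RieszFischer.

Section SquareIntegrableForms.
Context {R : realType}.
Local Notation P2 := (measurableTypeR R * measurableTypeR R)%type.
Variable Omega : set (R * R).
Hypothesis oO : open Omega.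
Hypothesis bO : Omega `<=` box 0 1.
Let mO : pmset Omega := open_pmset oO.
Implicit Types (f : R * R -> R) (w v : @Defs.form R).

Let finO : (area Omega < +oo)%E := area_bounded mO bO.

Lemma L2P f : L2_on Omega f <-> pmfun Omega f /\ intg Omega (fun p => f p ^+ 2).
Proof.
have E : (\int[@lambda2 R]_(p in Omega) `|(f p ^+ 2)%:E|)%E = (\int[@lambda2 R]_(p in Omega) (f p ^+ 2)%:E)%E.
  by apply: eq_integral => p _; rewrite gee0_abs// lee_fin sqr_ge0.
split=> [[mf fi]|[mf fi]]; split => //.
  by apply/integrableP; split; [exact: (measurable_sq mf)|rewrite E].
by move/integrableP: fi => [_]; rewrite E.
Qed.

Lemma L2_intgM f g : L2_on Omega f -> L2_on Omega g -> intg Omega (fun p => f p * g p).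
Proof.
move=> /L2P[mf fi] /L2P[mg gi].
apply: (intg_le mO _ _ (intgD mO fi gi)); first exact: measurable_funM.
move=> p _; rewrite normrM -[f p ^+ 2]real_normK ?num_real// -[g p ^+ 2]real_normK ?num_real//.
move: (normr_ge0 (f p)) (normr_ge0 (g p)); move: `|f p| `|g p| => a b; nra.
Qed.

Lemma L2_bounded f (M : R) : pmfun Omega f -> (forall p, Omega p -> `|f p| <= M) -> L2_on Omega f.
Proof.
move=> mf fM; apply/L2P; split => //; apply: (@intg_bounded _ _ _ (M ^+ 2)) => //.
  exact: measurable_funX.
by move=> p Op; rewrite normrX ler_sqr ?nnegrE ?fM// (le_trans _ (fM p Op)).
Qed.

(** The area of [Omega] is finite, so the constant 1 is square-integrable. *)
Lemma L2_intg f : L2_on Omega f -> intg Omega f.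
Proof.
move=> Lf; have L1 : L2_on Omega (cst 1 : R * R -> R).
  by apply: (@L2_bounded _ 1) => [|p _]; [exact: measurable_cst|rewrite normr1].
by apply: (intg_eq mO _ (L2_intgM Lf L1)) => p _ /=; rewrite mulr1.
Qed.

Lemma L2_lin (a : R) f g : L2_on Omega f -> L2_on Omega g -> L2_on Omega (fun p => a * f p + g p).
Proof.
move=> Lf Lg; have /L2P[mf fi] := Lf; have /L2P[mg gi] := Lg; apply/L2P; split.
  by apply: measurable_funD => //; exact: measurable_funM.
have := intgD mO (intgD mO (intgZ (a ^+ 2) mO fi) (intgZ (2 * a) mO (L2_intgM Lf Lg))) gi.
by apply: (intg_eq mO) => p _; ring.
Qed.

Lemma L2_sq_integral f : L2_on Omega f ->
  sq_integral (@lambda2 R) Omega f = (I2 Omega (fun p => f p ^+ 2))%:E.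
Proof.
move=> Lf; rewrite fineK// ge0_fin_numE; first by case: Lf.
by apply: integral_ge0 => p _; rewrite lee_fin sqr_ge0.
Qed.

Definition L2form : set (@Defs.form R) := [set w | L2_on Omega w.1 /\ L2_on Omega w.2].

Definition flin (a : R) w v : @Defs.form R := (fun p => a * w.1 p + v.1 p, fun p => a * w.2 p + v.2 p).

Definition fip w v : R := I2 Omega (fun p => w.1 p * v.1 p + w.2 p * v.2 p).

Lemma flin_L2 a w v : L2form w -> L2form v -> L2form (flin a w v).
Proof. by move=> [w1 w2] [v1 v2]; split; exact: L2_lin. Qed.

Lemma fipC w v : fip w v = fip v w.
Proof. by apply: eq_I2 => p _; rewrite mulrC [X in _ + X]mulrC. Qed.

Lemma fip_ge0 w : 0 <= fip w w.
Proof. by apply: I2_ge0 => p _; rewrite addr_ge0// -expr2 sqr_ge0. Qed.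

Lemma intg_fip w v : L2form w -> L2form v -> intg Omega (fun p => w.1 p * v.1 p + w.2 p * v.2 p).
Proof. by move=> [w1 w2] [v1 v2]; apply: (intgD mO); exact: L2_intgM. Qed.

Lemma fip_lin a w v u : L2form w -> L2form v -> L2form u ->
  fip (flin a w v) u = a * fip w u + fip v u.
Proof.
move=> Lw Lv Lu; have iw := intg_fip Lw Lu; have iv := intg_fip Lv Lu.
rewrite /fip -(I2Z a mO iw) -(I2D mO (intgZ a mO iw) iv).
by apply: eq_I2 => p _ /=; ring.
Qed.

Lemma fip_self w : L2form w ->
  fip w w = I2 Omega (fun p => w.1 p ^+ 2) + I2 Omega (fun p => w.2 p ^+ 2).
Proof.
move=> [/L2P[_ i1] /L2P[_ i2]]; rewrite -(I2D mO i1 i2).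
by apply: eq_I2 => p _; rewrite !expr2.
Qed.

Lemma form_normE w : form_norm Omega w = Num.sqrt (fip w w).
Proof. by congr Num.sqrt; apply: eq_I2 => p _; rewrite !expr2. Qed.

Lemma L2form_complete (u : nat -> @Defs.form R) : (forall n, L2form (u n)) ->
  (forall e : R, 0 < e -> exists N, forall m n, (N <= m)%N -> (N <= n)%N -> dist2 flin fip (u m) (u n) <= e) ->
  exists2 l, L2form l & dist2 flin fip (u n) l @[n --> \oo] --> 0.
Proof.
move=> Lu cau.
have Ld m n : L2form (flin (-1) (u n) (u m)) by exact: flin_L2.
have sq0 f : 0 <= I2 Omega (fun p => f p ^+ 2) by apply: I2_ge0 => p _; exact: sqr_ge0.
have RF (f : nat -> R * R -> R) : (forall n, L2_on Omega (f n)) ->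
    (forall m n, I2 Omega (fun p => (-1 * f n p + f m p) ^+ 2) <= dist2 flin fip (u m) (u n)) ->
    exists2 l, L2_on Omega l & forall e : R, 0 < e -> exists N, forall n, (N <= n)%N ->
      I2 Omega (fun p => (-1 * l p + f n p) ^+ 2) <= e.
  move=> Lf fu.
  have [||l ml Hl] := @riesz_fischer _ _ P2 (@lambda2 R) Omega mO finO f.
  - by move=> n; have [] := Lf n.
  - move=> e e0; have [N HN] := cau e e0; exists N => m n Nm Nn.
    have -> : (fun p => f m p - f n p) = (fun p => -1 * f n p + f m p).
      by apply/funext => p; ring.
    rewrite L2_sq_integral; last exact: L2_lin.
    by rewrite lee_fin (le_trans (fu m n))// HN.
  have Lfl n : L2_on Omega l.
    have [N HN] := Hl 1 ltr01; have := HN N (leqnn _).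
    move=> /le_lt_trans/(_ (ltry _)) H.
    have Ld' : L2_on Omega (fun p => f N p - l p).
      by split => //; apply: measurable_funB => //; have [] := Lf N.
    have -> : l = fun p => -1 * (f N p - l p) + f N p by apply/funext => p; ring.
    exact: L2_lin.
  exists l; first exact: Lfl 0%N.
  move=> e e0; have [N HN] := Hl e e0; exists N => n /HN.
  have -> : (fun p => f n p - l p) = (fun p => -1 * l p + f n p).
    by apply/funext => p; ring.
  by rewrite L2_sq_integral ?lee_fin//; apply: L2_lin => //; exact: Lfl 0%N.
have [l1 L1 H1] := RF (fun n => (u n).1) (fun n => (Lu n).1)
  (fun m n => ltac:(by rewrite /dist2 fip_self// lerDl)).
have [l2 L2 H2] := RF (fun n => (u n).2) (fun n => (Lu n).2)
  (fun m n => ltac:(by rewrite /dist2 fip_self// lerDr)).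
exists (l1, l2) => //.
apply/cvgrPdist_le => e e0.
have e2 : 0 < e / 2 by rewrite divr_gt0.
have [N1 HN1] := H1 _ e2; have [N2 HN2] := H2 _ e2.
exists (maxn N1 N2) => // n /=; rewrite geq_max => /andP[n1 n2].
rewrite sub0r normrN ger0_norm; last exact: fip_ge0.
rewrite /dist2 fip_self; last by apply: flin_L2.
by rewrite [leRHS]splitr lerD// ?HN1// HN2.
Qed.

Lemma form_projection (S : set (@Defs.form R)) w : S `<=` L2form ->
  (forall a x y, S x -> S y -> S (flin a x y)) -> S !=set0 -> L2form w ->
  exists h (s : nat -> @Defs.form R),
  [/\ L2form h, forall n, S (s n), dist2 flin fip (flin (-1) (s n) w) h @[n --> \oo] --> 0 &
      forall x, S x -> fip h x = 0].
Proof.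
move=> SL Sl S0 Lw.
exact: (projection flin_L2 fipC fip_lin fip_ge0 L2form_complete SL Sl S0 Lw).
Qed.

End SquareIntegrableForms.

(** * Periods of closed forms *)

Section ClosedForms.
Context {R : realType}.
Variable Omega : set (R * R).
Hypothesis oO : open Omega.
Hypothesis bO : Omega `<=` box 0 1.
Let mO : pmset Omega := open_pmset oO.
Implicit Types (f h k phi : R * R -> R) (w v : @Defs.form R).

Lemma test_L2 phi : test_function setT phi -> L2_on Omega phi.
Proof.
move=> tp; have [M _ HM] := test_bounded tp.
apply: (@L2_bounded _ _ oO bO _ M); last by move=> p _; exact: HM.
apply: (@pmfun_sub _ setT) => //; first exact: pmsetT.
by apply: continuous_pmfun => [|z _]; [exact: openT|exact: (test_continuous tp)].
Qed.

Lemma test_subT phi : test_function Omega phi -> test_function setT phi.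
Proof. exact: test_sub. Qed.

Definition grad phi : @Defs.form R := (dx phi, dy phi).
(** The rotated gradient: weak closedness is orthogonality to all of these, which makes it a closed
    condition in the Hilbert space. *)
Definition cograd phi : @Defs.form R := (dy phi, fun p => - dx phi p).

Lemma grad_L2 phi : test_function Omega phi -> L2form Omega (grad phi).
Proof.
move=> tp; have tT := test_subT tp.
by split; [exact: (test_L2 (test_dx tT))|exact: (test_L2 (test_dy tT))].
Qed.

Lemma L2_opp f : L2_on Omega f -> L2_on Omega (fun p => - f p).
Proof.
(* [- f] is the combination [-2 * f + f]. *)
move=> Lf; have := L2_lin oO (-2) Lf Lf; congr L2_on.
by apply/funext => p; ring.
Qed.

Lemma cograd_L2 phi : test_function Omega phi -> L2form Omega (cograd phi).
Proof.
move=> tp; have tT := test_subT tp.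
by split; [exact: (test_L2 (test_dy tT))|exact: (L2_opp (test_L2 (test_dx tT)))].
Qed.

Lemma weak_closedE w phi : I2 Omega (fun p => w.1 p * dy phi p - w.2 p * dx phi p) = fip Omega w (cograd phi).
Proof.
have alg (a b c e : R) : a * b - c * e = a * b + c * - e by ring.
apply: eq_I2 => p _; exact: alg.
Qed.

Lemma L21cP w : L21c Omega w <->
  L2form Omega w /\ forall phi, test_function Omega phi -> fip Omega w (cograd phi) = 0.
Proof.
split=> [[w1 w2 wc]|[[w1 w2] wc]]; split => //.
  by move=> phi tp; rewrite -weak_closedE; exact: wc.
by move=> phi tp; have := wc phi tp; rewrite -weak_closedE.
Qed.

Lemma L21c_L2 w : L21c Omega w -> L2form Omega w.
Proof. by move=> /L21cP[]. Qed.

Lemma L21c_weak_closed w : L21c Omega w -> weak_closed Omega w.1 w.2.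
Proof. by move=> [_ _ wc] phi tp; exact: wc. Qed.

Lemma L21c_lin a w v : L21c Omega w -> L21c Omega v -> L21c Omega (flin a w v).
Proof.
move=> /L21cP[Lw cw] /L21cP[Lv cv]; apply/L21cP; split; first exact: flin_L2.
move=> phi tp; rewrite (fip_lin oO a Lw Lv (cograd_L2 tp)) cw// cv//.
by rewrite mulr0 addr0.
Qed.

Lemma fip_diff w v u : L2form Omega w -> L2form Omega v -> L2form Omega u ->
  fip Omega (flin (-1) v w) u = fip Omega w u - fip Omega v u.
Proof. by move=> Lw Lv Lu; rewrite (fip_lin oO (-1) Lv Lw Lu) mulN1r addrC. Qed.

Lemma fip_cvg (u : nat -> @Defs.form R) w v : (forall n, L2form Omega (u n)) ->
  L2form Omega w -> L2form Omega v ->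
  dist2 flin (fip Omega) (u n) w @[n --> \oo] --> (0 : R) ->
  fip Omega (u n) v @[n --> \oo] --> fip Omega w v.
Proof.
move=> Lu Lw Lv uw.
have B n : `|fip Omega w v - fip Omega (u n) v| <=
    Num.sqrt (dist2 flin (fip Omega) (u n) w * fip Omega v v).
  have Ld : L2form Omega (flin (-1) w (u n)) by exact: flin_L2.
  rewrite distrC -(fip_diff (Lu n) Lw Lv) -sqrtr_sqr ler_wsqrtr//.
  exact: (cauchy_schwarz (flin_L2 oO) (@fipC _ _) (fip_lin oO) (@fip_ge0 _ _) Ld Lv).
have lim0 : Num.sqrt (dist2 flin (fip Omega) (u n) w * fip Omega v v) @[n --> \oo] --> (0 : R).
  rewrite -[X in _ --> X]sqrtr0 -(mul0r (fip Omega v v)).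
  apply: continuous_cvg; first exact: sqrt_continuous.
  by apply: cvgM => //; exact: cvg_cst.
apply/cvgrPdist_le => e e0; move/cvgrPdist_le/(_ _ e0): lim0; apply: filterS => n.
rewrite sub0r normrN ger0_norm ?sqrtr_ge0// => H.
exact: le_trans (B n) H.
Qed.

Lemma fip_cvg_eq0 (u : nat -> @Defs.form R) w v : (forall n, L2form Omega (u n)) ->
  L2form Omega w -> L2form Omega v ->
  dist2 flin (fip Omega) (u n) w @[n --> \oo] --> (0 : R) ->
  (forall n, fip Omega (u n) v = 0) -> fip Omega w v = 0.
Proof.
move=> Lu Lw Lv uw u0; have := fip_cvg Lu Lw Lv uw.
have -> : (fun n => fip Omega (u n) v) = cst 0 by apply/funext.
by move=> /cvg_lim => <-//; rewrite lim_cst.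
Qed.

Lemma L21c_closed (u : nat -> @Defs.form R) w : (forall n, L21c Omega (u n)) -> L2form Omega w ->
  dist2 flin (fip Omega) (u n) w @[n --> \oo] --> (0 : R) -> L21c Omega w.
Proof.
move=> cu Lw uw; apply/L21cP; split => // phi tp.
apply: (fip_cvg_eq0 (fun n => L21c_L2 (cu n)) Lw (cograd_L2 tp) uw) => n.
by have /L21cP[_] := cu n; exact.
Qed.

Lemma testM phi psi : test_function Omega phi -> test_function Omega psi ->
  test_function Omega (phi \* psi).
Proof.
move=> t1 t2; have [K1 [c1 O1 z1]] := test_functionE t1.
apply: (test_functionP _ c1 O1) => [n|p /z1 /= ->]; last by rewrite mul0r.
by apply: Ck_onM; [exact: openT|case: t1|case: t2].
Qed.

(** By the symmetry of the second derivatives of [psi], the integrand is the divergence of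
    [(phi * dy psi, - phi * dx psi)]. *)
Lemma grad_closed phi : test_function Omega phi -> L21c Omega (grad phi).
Proof.
move=> tp; apply/L21cP; split; first exact: grad_L2.
move=> psi ts; rewrite -weak_closedE /=.
have t1 := testM tp (test_dy ts).
have t2 : test_function Omega (fun p => - phi p * dx psi p).
  have := testB (test0 Omega) (testM tp (test_dx ts)); congr test_function.
  by apply/funext => p /=; rewrite sub0r mulNr.
have e0 p : ~ Omega p -> dx phi p * dy psi p - dy phi p * dx psi p = 0.
  have alg (a b c e : R) : a = 0 -> c = 0 -> a * b - c * e = 0 by move=> -> ->; ring.
  by move=> np; exact: alg (test_out (test_dx tp) np) (test_out (test_dy tp) np).
rewrite -(I2_restrict pmsetT mO (@subsetT _ _) (fun p _ => e0 p)) -[RHS](test_divergence0 t1 t2).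
have alg (a b c e f x y m n : R) : x = f * m + b * a -> y = - f * n + e * - c -> m = n ->
  a * b - c * e = x + y by move=> -> -> ->; ring.
apply: eq_I2 => p _.
have hp := test_has_partials p tp.
have [_ [Ex _]] := has_partialsM hp (test_has_partials p (test_dy ts)).
have [_ [_ Ey]] := has_partialsM (has_partialsN hp) (test_has_partials p (test_dx ts)).
have S : dx (dy psi) p = dy (dx psi) p by apply: schwarz_symmetry; case: ts.
exact: alg Ex Ey S.
Qed.

End ClosedForms.

(** * Density of smooth closed forms and the period formula *)

Section PeriodFormula.
Context {R : realType}.
Variable Omega : set (R * R).
Hypothesis oO : open Omega.
Hypothesis bO : Omega `<=` box 0 1.
Let mO : pmset Omega := open_pmset oO.
Implicit Types (f h k phi : R * R -> R) (w v : @Defs.form R).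
Local Notation D := (dist2 flin (fip Omega)).

Lemma I2_ae f g : pmfun Omega f -> pmfun Omega g -> ae_eq (@lambda2 R) Omega f g ->
  I2 Omega f = I2 Omega g.
Proof.
move=> mf mg fg; rewrite /I2 /Rintegral; congr fine; apply: ae_eq_integral.
- exact: mO.
- exact/measurable_EFinP.
- exact/measurable_EFinP.
- by apply: filterS fg => p H Op; rewrite (H Op).
Qed.

Lemma L2_ae f g : pmfun Omega g -> ae_eq (@lambda2 R) Omega f g -> L2_on Omega f -> L2_on Omega g.
Proof.
move=> mg fg [mf fi]; split; first exact: mg.
have <- // : (\int[@lambda2 R]_(p in Omega) (f p ^+ 2)%:E = \int[@lambda2 R]_(p in Omega) (g p ^+ 2)%:E)%E.
apply: ae_eq_integral; [exact: mO|exact: (measurable_sq mf)|exact: (measurable_sq mg)|].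
by apply: filterS fg => p H Op; rewrite (H Op).
Qed.

Definition ae_form w v := ae_eq (@lambda2 R) Omega w.1 v.1 /\ ae_eq (@lambda2 R) Omega w.2 v.2.

Lemma fip_ae w w' v : L2form Omega w -> L2form Omega w' -> L2form Omega v -> ae_form w w' ->
  fip Omega w v = fip Omega w' v.
Proof.
move=> Lw Lw' Lv [e1 e2]; apply: I2_ae.
- exact: intg_pmfun (intg_fip oO Lw Lv).
- exact: intg_pmfun (intg_fip oO Lw' Lv).
- by apply: (filterS2 _ _ e1 e2) => p H1 H2 Op; rewrite (H1 Op) (H2 Op).
Qed.

Lemma fip_ae2 w w' : L2form Omega w -> L2form Omega w' -> ae_form w w' ->
  fip Omega w w = fip Omega w' w'.
Proof.
by move=> Lw Lw' e; rewrite (fip_ae Lw Lw' Lw e) fipC (fip_ae Lw Lw' Lw' e).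
Qed.

Lemma L21c_ae w w' : L21c Omega w -> pmfun Omega w'.1 -> pmfun Omega w'.2 -> ae_form w w' ->
  L21c Omega w'.
Proof.
move=> /L21cP[Lw cw] m1 m2 e.
have Lw' : L2form Omega w'.
  by have [L1 L2] := Lw; have [e1 e2] := e; split; [exact: L2_ae L1|exact: L2_ae L2].
apply/L21cP; split => // phi tp.
by rewrite -(fip_ae Lw Lw' (cograd_L2 oO bO tp) e) cw.
Qed.

Definition harmonic_rep w : @Defs.form R := (weyl Omega w.1, weyl Omega w.2).

Lemma harmonic_repP w : L21c Omega w -> (forall phi, test_function Omega phi -> fip Omega w (grad phi) = 0) ->
  [/\ ae_form w (harmonic_rep w), smooth_form Omega (harmonic_rep w), L21c Omega (harmonic_rep w) &
    forall z, Omega z -> exists a b, has_partials (harmonic_rep w).1 z a b /\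
      has_partials (harmonic_rep w).2 z b (- a)].
Proof.
move=> cw hw; have [L1 L2] := L21c_L2 cw.
have hc := L21c_weak_closed cw.
have hcc : weak_coclosed Omega w.1 w.2 by move=> phi tp; exact: hw.
have ih := L2_intg oO bO L1; have ik := L2_intg oO bO L2.
have ihN := L2_intg oO bO (L2_opp oO L1).
have hs := weak_closed_swap hcc; have hcs := weak_coclosed_swap oO ih ik hc.
have a1 := weyl_ae_eq oO ih ik hc hcc; have a2 := weyl_ae_eq oO ik ihN hs hcs.
have s1 := smooth_weyl oO ih ik hc hcc; have s2 := smooth_weyl oO ik ihN hs hcs.
have ae : ae_form w (harmonic_rep w).
  split; [apply: filterS a1|apply: filterS a2] => p H Op; exact: esym (H Op).
split => //.
- by apply: (L21c_ae cw _ _ ae); apply: continuous_pmfun => // p Op;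
    [exact: (smooth_continuous s1)|exact: (smooth_continuous s2)].
- by move=> z Oz; exact: (weyl_CR oO ih ik hc hcc).
Qed.

Lemma grad_lin a phi psi : test_function Omega phi -> test_function Omega psi ->
  exists2 chi, test_function Omega chi & flin a (grad phi) (grad psi) = grad chi.
Proof.
move=> t1 t2; exists (fun p => cst a p * phi p + psi p).
  have [K1 [c1 O1 z1]] := test_functionE t1; have [K2 [c2 O2 z2]] := test_functionE t2.
  apply: (@test_functionP _ _ _ (K1 `|` K2)).
  - move=> n; apply: Ck_onD; [exact: openT| |by case: t2].
    by apply: Ck_onM; [exact: openT|exact: (Ck_on_cst _ _ openT)|case: t1].
  - exact: compactU.
  - by move=> p [/O1|/O2].
  - by move=> p /not_orP[/z1 -> /z2 ->]; rewrite mulr0 addr0.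
have E p := has_partialsD (has_partialsM (has_partials_cst a p) (test_has_partials p t1)) (test_has_partials p t2).
have alg (x y z u : R) : a * x + z * 0 + y = a * x + y by ring.
rewrite /grad /flin /=; congr (_, _); apply/funext => p; have [_ [E1 E2]] := E p.
  by apply/esym; apply: (etrans E1); exact: alg.
by apply/esym; apply: (etrans E2); exact: alg.
Qed.

(** Orthogonality to the gradients of test functions is coclosedness, so [h] falls under Weyl's
    lemma; it is closed as a limit of closed forms. *)
Lemma exact_projection w : L21c Omega w -> exists (h : @Defs.form R) (phi : nat -> R * R -> R),
  [/\ L21c Omega h, forall n, test_function Omega (phi n),
      D (flin (-1) (grad (phi n)) w) h @[n --> \oo] --> (0 : R) &
      forall psi, test_function Omega psi -> fip Omega h (grad psi) = 0].
Proof.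
move=> cw; pose S := [set v | exists2 phi, test_function Omega phi & v = grad phi].
have [||||h [s [Lh Ss sh hS]]] := @form_projection _ _ oO bO S w.
- by move=> _ [phi tp ->]; exact: (grad_L2 oO bO).
- move=> a _ _ [phi tp ->] [psi ts ->]; have [chi tc ->] := grad_lin a tp ts.
  by exists chi.
- by exists (grad (cst 0)), (cst 0) => //; exact: test0.
- exact: L21c_L2.
have /choice[phi Hphi] : forall n, exists phi, test_function Omega phi /\ s n = grad phi.
  by move=> n; have [phi tp sp] := Ss n; exists phi.
have sE n : s n = grad (phi n) by have [] := Hphi n.
exists h, phi; split.
- apply: (L21c_closed oO bO _ Lh sh) => n; apply: (L21c_lin oO bO) => //.
  by rewrite sE; apply: (grad_closed oO bO); have [] := Hphi n.
- by move=> n; have [] := Hphi n.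
- by have E : s = (fun n => grad (phi n)) by [exact/funext]; move: sh; rewrite E.
- by move=> psi ts; apply: hS; exists psi.
Qed.

(** Only the harmonic component of [w] has to be replaced by a smooth representative: the rest is a
    limit of gradients of test functions, smooth already. *)
Lemma smooth_density w : L21c Omega w -> exists eta : nat -> @Defs.form R,
  [/\ forall n, L21c Omega (eta n), forall n, smooth_form Omega (eta n) &
      D (eta n) w @[n --> \oo] --> (0 : R)].
Proof.
move=> cw; have [h [phi [ch tphi phih hort]]] := exact_projection cw.
have [ae sH cH _] := harmonic_repP ch hort.
pose eta n := flin 1 (harmonic_rep h) (grad (phi n)).
have ceta n : L21c Omega (eta n).
  by apply: (L21c_lin oO bO) => //; exact: (grad_closed oO bO).
have Lw := L21c_L2 cw; have Lh := L21c_L2 ch.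
have Lg n := grad_L2 oO bO (tphi n).
exists eta; split => //.
  move=> n; have [s1 s2] := sH; have tx := test_dx (tphi n); have ty := test_dy (tphi n).
  have H f g : smooth_on Omega f -> test_function Omega g -> smooth_on Omega (fun p => cst 1 p * f p + g p).
    move=> sf tg m; apply: Ck_onD => //; last by apply: (Ck_on_sub (@subsetT _ _)); case: tg.
    by apply: Ck_onM => //; exact: (Ck_on_cst _ _ oO).
  by split; [exact: (H _ _ s1 tx)|exact: (H _ _ s2 ty)].
(* Almost everywhere [eta n - w] is the opposite of [w - grad (phi n) - h]. *)
have -> : (fun n => D (eta n) w) = (fun n => D (flin (-1) (grad (phi n)) w) h); last exact: phih.
apply/funext => n; rewrite /dist2.
have alg (x y : @Defs.form R) : ae_form x (flin (-1) y (cst 0, cst 0)) -> L2form Omega x -> L2form Omega y ->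
    fip Omega x x = fip Omega y y.
  move=> exy Lx Ly.
  have -> : fip Omega y y = fip Omega (flin (-1) y (cst 0, cst 0)) (flin (-1) y (cst 0, cst 0)).
    by apply: eq_I2 => p _ /=; ring.
  apply: fip_ae2 => //; apply: (flin_L2 oO) => //.
  by split; apply: (test_L2 oO bO); exact: test0.
apply: alg; [|exact: (flin_L2 oO _ Lw (L21c_L2 (ceta n)))|exact: (flin_L2 oO _ Lh (flin_L2 oO _ (Lg n) Lw))].
have [e1 e2] := ae; split; [apply: filterS e1|apply: filterS e2] => p H Op; move: (H Op) => /= ->.
  by move: (dx _ _) => u; ring.
by move: (dy _ _) => u; ring.
Qed.

Section OneCurve.
Variable g : R -> R * R.
Hypothesis cg : smooth_closed_curve g.
Hypothesis gO : forall t, Omega (g t).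

Definition Jform s : @Defs.form R := (J1 g s, J2 g s).

Lemma Jform_L2 s : fine_scale g Omega s -> L2form Omega (Jform s).
Proof.
move=> fs; have [t1 t2] := test_J cg fs.
by split; [exact: (test_L2 oO bO (test_subT t1))|exact: (test_L2 oO bO (test_subT t2))].
Qed.

Lemma line_integral_fip w s : fine_scale g Omega s -> L21c Omega w ->
  (forall p, Omega p -> {for p, continuous w.1}) -> (forall p, Omega p -> {for p, continuous w.2}) ->
  line_integral g w = fip Omega w (Jform s) / mass.
Proof.
move=> fs cw c1 c2; have [L1 L2] := L21c_L2 cw.
have E : fip Omega w (Jform s) = mass * line_integral g (w.1, w.2).
  exact: (Lam_line_integral cg oO gO (L2_intg oO bO L1) (L2_intg oO bO L2) (L21c_weak_closed cw) c1 c2 fs).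
have -> : line_integral g w = line_integral g (w.1, w.2) by [].
by rewrite E mulrAC divff ?mul1r//; apply: lt0r_neq0; exact: mass_gt0.
Qed.

Lemma form_norm_sub w v : form_norm Omega (form_sub w v) ^+ 2 = D w v.
Proof.
rewrite form_normE sqr_sqrtr ?fip_ge0//; apply: eq_I2 => p _ /=.
by rewrite !mulN1r ![- _ + _]addrC.
Qed.

(** [period] selects a limit: [smooth_density] provides one, and continuity of the scalar product
    shows that it is the only one. *)
Lemma period_fip w s : fine_scale g Omega s -> L21c Omega w ->
  period Omega g w = fip Omega w (Jform s) / mass.
Proof.
move=> fs cw; have LJ := Jform_L2 fs; have Lw := L21c_L2 cw.
have lim (eta : nat -> @Defs.form R) : (forall n, L21c Omega (eta n)) ->
    (forall n, smooth_form Omega (eta n)) -> D (eta n) w @[n --> \oo] --> (0 : R) ->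
    line_integral g (eta n) @[n --> \oo] --> fip Omega w (Jform s) / mass.
  move=> ce se ew.
  have -> : (fun n => line_integral g (eta n)) = (fun n => fip Omega (eta n) (Jform s) / mass).
    apply/funext => n; have [s1 s2] := se n.
    by apply: line_integral_fip => // p Op; [exact: (smooth_continuous s1)|exact: (smooth_continuous s2)].
  apply: cvgM; last exact: cvg_cst.
  by apply: (fip_cvg oO) => // n; exact: L21c_L2.
have [eta [ce se ew]] := smooth_density cw.
rewrite /period; apply: xget_subset1.
  exists eta; split; [by move=> n; split| |exact: lim].
  have -> : (fun n => form_norm Omega (form_sub (eta n) w)) = (fun n => Num.sqrt (D (eta n) w)).
    by apply/funext => n; rewrite -form_norm_sub sqrtr_sqr ger0_norm// sqrtr_ge0.
  by rewrite -sqrtr0; apply: continuous_cvg => //; exact: sqrt_continuous.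
have uniq l : (exists eta' : nat -> @Defs.form R,
    [/\ forall n, L21c Omega (eta' n) /\ smooth_form Omega (eta' n),
        form_norm Omega (form_sub (eta' n) w) @[n --> \oo] --> (0 : R)
      & line_integral g (eta' n) @[n --> \oo] --> l]) -> l = fip Omega w (Jform s) / mass.
  move=> [e' [ce' ne' le']]; apply: (cvg_unique (@Rhausdorff R) le').
  apply: lim => [n|n|]; [by have [] := ce' n|by have [] := ce' n|].
  have -> : (fun n => D (e' n) w) = (fun n => form_norm Omega (form_sub (e' n) w) ^+ 2).
    by apply/funext => n; rewrite form_norm_sub.
  have sq0 (a : nat -> R) : a n @[n --> \oo] --> (0 : R) -> a n ^+ 2 @[n --> \oo] --> (0 : R).
    move=> a0; have -> : (fun n => a n ^+ 2) = (fun n => a n * a n) by apply/funext => n; rewrite expr2.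
    by rewrite -[X in _ --> X](mulr0 0); exact: cvgM.
  exact: sq0.
by move=> l l' /uniq -> /uniq ->.
Qed.

End OneCurve.
End PeriodFormula.

(** * The orthogonal complement of the forms without periods *)

Section HarmonicPart.
Context {R : realType} {I : Type}.
Variable Omega : set (R * R).
Hypothesis oO : open Omega.
Hypothesis bO : Omega `<=` box 0 1.
Let mO : pmset Omega := open_pmset oO.
Implicit Types (phi : R * R -> R) (w v k : @Defs.form R).
Variable gamma : I -> R -> R * R.
Hypothesis cgamma : forall j, smooth_closed_curve (gamma j).
Hypothesis gammaO : forall j t, Omega (gamma j t).

Lemma exists_fine_scales : exists s : I -> R, forall j, fine_scale (gamma j) Omega (s j).
Proof.
have /choice[s Hs] : forall j, exists s, fine_scale (gamma j) Omega s.
  by move=> j; have [s [e []]] := fine_scale_exists (cgamma j) oO (gammaO j) ltr01; exists s.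
by exists s.
Qed.

Definition star w : @Defs.form R := (w.2, fun p => - w.1 p).

Lemma star_L2 w : L2form Omega w -> L2form Omega (star w).
Proof. by move=> [L1 L2]; split => //; exact: L2_opp. Qed.

Lemma fip_star w v : L2form Omega w -> L2form Omega v -> fip Omega (star w) v = - fip Omega w (star v).
Proof.
move=> Lw Lv; have i := intg_fip oO Lw (star_L2 Lv).
rewrite -[RHS]mulN1r /fip -(I2Z _ mO i).
have alg (a b c e : R) : b * c + - a * e = -1 * (a * e + b * - c) by ring.
apply: eq_I2 => p _; exact: alg.
Qed.

Lemma fip_star2 w v : fip Omega (star w) (star v) = fip Omega w v.
Proof.
have alg (a b c e : R) : b * c + - a * - e = a * e + b * c by ring.
apply: eq_I2 => p _; exact: alg.
Qed.

Variable s : I -> R.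
Hypothesis fs : forall j, fine_scale (gamma j) Omega (s j).

Definition J j := Jform (gamma j) (s j).

Lemma J_L2 j : L2form Omega (J j).
Proof. exact: (Jform_L2 oO bO (cgamma j) (fs j)). Qed.

Definition period_kernel : set (@Defs.form R) :=
  [set v | L21c Omega v /\ forall j, fip Omega v (J j) = 0].

Lemma grad_kernel phi : test_function Omega phi -> period_kernel (grad phi).
Proof.
move=> tp; split; first exact: (grad_closed oO bO).
by move=> j; have [s0 _] := fs j; exact: (Lam_exact (cgamma j) oO s0 tp).
Qed.

(** Since [J l] is supported in [Omega], its product with [star (J j)] can be computed over the
    whole plane, where [Lam_J_cross] applies, whatever the relative position of the two curves. *)
Lemma star_J_kernel j : period_kernel (star (J j)).
Proof.
have [s0 _] := fs j; split.
  have [L1 L2] := star_L2 (J_L2 j); split => // phi tp.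
  exact: (weak_closed_J (cgamma j) oO s0 tp).
move=> l; have [r0 _] := fs l; have [t1 t2] := test_J (cgamma l) (fs l).
rewrite -[RHS](Lam_J_cross (cgamma j) (cgamma l) s0 r0); apply/esym.
apply: I2_restrict; [exact: pmsetT|exact: mO|by []|].
have alg (a b c e : R) : b = 0 -> e = 0 -> a * b + c * e = 0 by move=> -> ->; ring.
move=> p _ np; exact: alg (test_out t1 np) (test_out t2 np).
Qed.

Lemma kernel_lin a v v' : period_kernel v -> period_kernel v' -> period_kernel (flin a v v').
Proof.
move=> [cv v0] [cv' v'0]; split; first exact: L21c_lin.
move=> j; rewrite (fip_lin oO a (L21c_L2 cv) (L21c_L2 cv') (J_L2 j)) v0 v'0.
by rewrite mulr0 addr0.
Qed.

Lemma star_closed k : L2form Omega k -> (forall phi, test_function Omega phi -> fip Omega k (grad phi) = 0) ->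
  L21c Omega (star k).
Proof.
move=> Lk kg; apply/L21cP; split; first exact: star_L2.
move=> phi tp; have gL := grad_L2 oO bO tp.
have -> : cograd phi = star (grad phi) by [].
by rewrite fip_star2 kg.
Qed.

(* [star (J j)] lies in [period_kernel], so the star of a form orthogonal to
   that space has vanishing periods. *)
Lemma harmonic_part w : L21c Omega w -> exists k,
  [/\ L21c Omega k /\ L21c Omega (star k),
      forall z, Omega z -> exists a b, has_partials k.1 z a b /\ has_partials k.2 z b (- a),
      forall j, fip Omega k (J j) = fip Omega w (J j),
      forall j, fip Omega (star k) (J j) = 0 &
      (forall v, period_kernel v -> fip Omega k v = 0) /\ fip Omega w k = fip Omega k k].
Proof.
move=> cw; have Lw := L21c_L2 cw.
have kL : period_kernel `<=` L2form Omega by move=> v [cv _]; exact: L21c_L2.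
have k0 : period_kernel !=set0 by exists (grad (cst 0)); apply: grad_kernel; exact: test0.
have [h [u [Lh ku uh hort]]] := form_projection oO bO kL kernel_lin k0 Lw.
have cu n : L21c Omega (flin (-1) (u n) w) by apply: (L21c_lin oO bO) => //; have [] := ku n.
have ch : L21c Omega h := L21c_closed oO bO cu Lh uh.
have hg phi : test_function Omega phi -> fip Omega h (grad phi) = 0.
  by move=> tp; exact: hort (grad_kernel tp).
have Ld n : L2form Omega (flin (-1) (u n) w) := L21c_L2 (cu n).
have hJ j : fip Omega h (J j) = fip Omega w (J j).
  have := fip_cvg oO Ld Lh (J_L2 j) uh.
  have -> : (fun n => fip Omega (flin (-1) (u n) w) (J j)) = cst (fip Omega w (J j)).
    apply/funext => n; rewrite (fip_diff oO Lw (kL _ (ku n)) (J_L2 j)).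
    by have [_ ->] := ku n; rewrite subr0.
  by move=> /(cvg_lim (@Rhausdorff R)) <-; rewrite lim_cst//; exact: Rhausdorff.
(* [w - h] is closed without periods, hence orthogonal to [k]; this gives the last conclusion. *)
have kd : period_kernel (flin (-1) h w).
  split; first exact: L21c_lin.
  by move=> j; rewrite (fip_diff oO Lw Lh (J_L2 j)) hJ subrr.
have [ae _ ck CR] := harmonic_repP oO bO ch hg.
set k := harmonic_rep Omega h in ae ck CR.
have Lk := L21c_L2 ck.
have E v : L2form Omega v -> fip Omega k v = fip Omega h v.
  by move=> Lv; apply/esym; exact: (fip_ae oO Lh Lk Lv ae).
have kort v : period_kernel v -> fip Omega k v = 0 by move=> kv; rewrite E ?hort//; exact: kL.
exists k; split => //.
- split=> //; apply: star_closed => // phi tp; exact: kort (grad_kernel tp).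
- by move=> j; rewrite (E _ (J_L2 j)).
- by move=> j; rewrite (fip_star Lk (J_L2 j)) kort ?oppr0//; exact: star_J_kernel.
- split => //; have := kort _ kd; rewrite fipC (fip_diff oO Lw Lh Lk).
  by rewrite -(E _ Lk) => /subr0_eq.
Qed.

End HarmonicPart.

(** * Analytic functions and the Bergman space *)

Section ComplexDerivative.
Context {R : realType}.
Local Open Scope complex_scope.
Local Notation normc := (@Normc.normc R).
Implicit Types (f : R[i] -> R[i]) (a l z : R[i]).

Lemma normc_re_le z : `|complex.Re z| <= normc z.
Proof.
case: z => x y /=; rewrite -sqrtr_sqr ler_wsqrtr//.
by rewrite lerDl sqr_ge0.
Qed.

Lemma normc_im_le z : `|complex.Im z| <= normc z.
Proof.
case: z => x y /=; rewrite -sqrtr_sqr ler_wsqrtr//.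
by rewrite lerDr sqr_ge0.
Qed.

Lemma normc_le z : normc z <= `|complex.Re z| + `|complex.Im z|.
Proof.
case: z => x y /=; rewrite -[leRHS]ger0_norm ?addr_ge0// -sqrtr_sqr ler_wsqrtr//.
rewrite sqrrD !real_normK ?num_real// lerD2r lerDl.
by rewrite mulrn_wge0// mulr_ge0.
Qed.

Lemma normc_ge0 z : 0 <= normc z.
Proof. by case: z => x y /=; exact: sqrtr_ge0. Qed.

Lemma pos_complex (r : R[i]) : 0 < r -> 0 < complex.Re r /\ r = (complex.Re r)%:C.
Proof. by rewrite ltcE => /andP[/eqP]; case: r => x y /= ->. Qed.

(** A form without quotients and with real [e] and [d], whereas the norm on [R[i]] takes its values
    in [R[i]]. *)
Lemma C_derivableP f a : @derivable R[i] R[i]^o R[i]^o f a 1 <->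
  exists l, forall e : R, 0 < e -> exists2 d : R, 0 < d & forall h, normc h < d ->
    normc (f (a + h) - f a - l * h) <= e * normc h.
Proof.
have E l h : h != 0 -> `|l - h^-1 *: ((f \o shift a) (h *: (1 : R[i]^o)) - f a)| =
    (normc (f (a + h) - f a - l * h) / normc h)%:C.
  move=> h0; rewrite /GRing.scale /= mulr1 [h + a]addrC.
  have -> : l - h^-1 * (f (a + h) - f a) = - (f (a + h) - f a - l * h) / h by field.
  by rewrite /Num.norm /= Normc.normcM Normc.normcV normcN.
have n0 h : h != 0 -> 0 < normc h.
  move=> h0; rewrite lt_neqAle normc_ge0 andbT eq_sym.
  by apply: contra h0 => /eqP/Normc.eq0_normc ->.
split.
  move=> /cvg_ex[l /cvgrPdist_lt H]; exists l => e e0.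
  have eC : 0 < e%:C :> R[i] by rewrite ltcR.
  have := H _ eC; rewrite near_withinE => /nbhs_ballP[r /pos_complex[r0 rE] Hr].
  exists (complex.Re r) => // h hr; have [->|h0] := eqVneq h 0.
    by rewrite addr0 subrr mulr0 subr0 Normc.normc0 mulr0.
  have := Hr h; rewrite -ball_normE /= sub0r normrN {1}rE ltcR => /(_ hr h0).
  rewrite E// ltcR ltr_pdivrMr ?n0//.
  exact: ltW.
move=> [l H]; apply/cvg_ex; exists l; apply/cvgrPdist_le => e /pos_complex[e0 ->].
have [d d0 Hd] := H _ e0.
rewrite near_withinE; apply/nbhs_ballP; exists d%:C; first by rewrite /= ltcR.
move=> h; rewrite -ball_normE /= sub0r normrN ltcR => hd h0.
by rewrite E// lecR ler_pdivrMr ?n0// Hd.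
Qed.

Lemma norm_toC (p : R * R) : `|p| <= normc (toC p) /\ normc (toC p) <= 2 * `|p|.
Proof.
split; first by rewrite /Num.norm /= ge_max (normc_re_le (toC p)) (normc_im_le (toC p)).
by apply: (le_trans (normc_le _)); rewrite mulr_natl mulr2n lerD ?norm_fst_le ?norm_snd_le.
Qed.

Lemma toCK z : toC (complex.Re z, complex.Im z) = z.
Proof. by case: z. Qed.

(** Multiplication by the derivative [a + i b] is the real linear map with these four coefficients.
    The halved [e] pays for comparing the modulus with the sup norm in one direction, and for adding
    two components in the other. *)
Lemma C_derivable_partials f p : @derivable R[i] R[i]^o R[i]^o f (toC p) 1 <->
  exists (a b : R), has_partials (fun q => complex.Re (f (toC q))) p a (- b) /\
    has_partials (fun q => complex.Im (f (toC q))) p b a.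
Proof.
have eqle (x y : R) : x = y -> x <= y by move=> ->.
split.
  move=> /C_derivableP[[a b] H]; exists a, b.
  have key e : 0 < e -> exists2 d, 0 < d & forall h : R * R, `|h| < d ->
      normc (f (toC (p + h)) - f (toC p) - (a +i* b) * toC h) <= e * `|h|.
    move=> e0; have e2 : 0 < e / 2 by rewrite divr_gt0.
    have [d d0 Hd] := H _ e2; exists (d / 2); first by rewrite divr_gt0.
    move=> h hd; have [_ h2] := norm_toC h.
    have -> : toC (p + h) = toC p + toC h by [].
    apply: (le_trans (Hd _ _)).
      by rewrite (le_lt_trans h2)// mulrC -ltr_pdivlMr.
    rewrite -mulrA ler_wpM2l ?(ltW e0)//.
    by rewrite mulrC ler_pdivrMr// mulrC.
  split; apply/diff2P => e /key[d d0 Hd]; exists d => // h /Hd; apply: le_trans.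
    apply: le_trans (normc_re_le _); apply: eqle; congr `|_|.
    by rewrite /lin2; case: (f _) (f _) => x y [x' y'] /=; ring.
  apply: le_trans (normc_im_le _); apply: eqle; congr `|_|.
  by rewrite /lin2; case: (f _) (f _) => x y [x' y'] /=; ring.
move=> [a [b [/diff2P H1 /diff2P H2]]]; apply/C_derivableP; exists (a +i* b) => e e0.
have e2 : 0 < e / 2 by rewrite divr_gt0.
have [d1 d10 Hd1] := H1 _ e2; have [d2 d20 Hd2] := H2 _ e2.
exists (Num.min d1 d2); first by rewrite lt_min d10.
move=> h; rewrite lt_min => /andP[h1 h2].
pose q : R * R := (complex.Re h, complex.Im h).
have hE : h = toC q by rewrite toCK.
have [qh _] := norm_toC q.
move: h1 h2 qh; rewrite hE => h1 h2 qh.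
have -> : toC p + toC q = toC (p + q) by [].
apply: (le_trans (normc_le _)).
have -> : e * normc (toC q) = e / 2 * normc (toC q) + e / 2 * normc (toC q) by field.
apply: lerD.
  apply: le_trans (ler_wpM2l (ltW e2) qh); apply: le_trans (Hd1 q (le_lt_trans qh h1)).
  apply: eqle; congr `|_|.
  by rewrite /lin2; case: (f _) (f _) => x y [x' y'] /=; ring.
apply: le_trans (ler_wpM2l (ltW e2) qh); apply: le_trans (Hd2 q (le_lt_trans qh h2)).
apply: eqle; congr `|_|.
by rewrite /lin2; case: (f _) (f _) => x y [x' y'] /=; ring.
Qed.

End ComplexDerivative.

Section BergmanForms.
Context {R : realType}.
Local Open Scope complex_scope.
Variable Omega : set (R * R).
Hypothesis oO : open Omega.
Let mO : pmset Omega := open_pmset oO.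
Implicit Types (f : R[i] -> R[i]) (w k : @Defs.form R) (h phi psi : R * R -> R).

(* The real part of [f dz]; the real part of [i f dz] is its [star]. *)
Definition re_form f : @Defs.form R :=
  (fun p => complex.Re (f (toC p)), fun p => - complex.Im (f (toC p))).

Definition analytic f := forall p, Omega p -> @derivable R[i] R[i]^o R[i]^o f (toC p) 1.

Lemma analytic_partials f p : analytic f -> Omega p -> exists (a b : R),
  has_partials (re_form f).1 p a (- b) /\ has_partials (re_form f).2 p (- b) (- a).
Proof.
move=> af /af/C_derivable_partials[a [b [H1 H2]]]; exists a, b; split => //.
exact: has_partialsN H2.
Qed.

Lemma analytic_continuous f p : analytic f -> Omega p ->
  {for p, continuous (re_form f).1} /\ {for p, continuous (re_form f).2}.
Proof.
move=> af /(analytic_partials af)[a [b [[d1 _] [d2 _]]]].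
by split; exact: differentiable_continuous.
Qed.

(** The values of [h] off [Omega] are arbitrary, but [psi] vanishes in a neighbourhood of [p]. *)
Lemma test_mul_out h psi p : test_function Omega psi -> ~ Omega p ->
  has_partials (fun q => h q * psi q) p 0 0.
Proof.
move=> tp np; have [_ _ sO] := tp.
have sp : \near p, psi p = 0 by apply: (test_near0 tp) => /sO.
apply: near_has_partials (has_partials_cst 0 p).
by apply: filterS sp => q /= ->; rewrite mulr0.
Qed.

Lemma test_mul_continuous h psi : (forall p, Omega p -> {for p, continuous h}) ->
  test_function Omega psi -> continuous (fun q => h q * psi q).
Proof.
move=> hc tp p; have [Op|np] := pselect (Omega p).
  by apply: cvgM; [exact: hc|exact: (test_continuous tp)].
by have [d _] := test_mul_out h tp np; exact: differentiable_continuous.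
Qed.

(** By Cauchy-Riemann the derivatives of [u] and [v] drop out of the divergence of
    [(- v * phi, u * phi)]. What remains is continuous, so the bisection form of the divergence
    theorem applies without knowing that the derivative of [f] is continuous. *)
Lemma analytic_weak_closed f : analytic f -> weak_closed Omega (re_form f).1 (re_form f).2.
Proof.
move=> af phi tp; set u := (re_form f).1; set v := (re_form f).2.
have [K [cK KO K0]] := test_functionE tp.
have [M M0 KM] := compact_sub_box cK.
have P h (a b : R) p : Omega p -> has_partials h p a b ->
    has_partials (fun q => h q * phi q) p (h p * dx phi p + phi p * a) (h p * dy phi p + phi p * b).
  by move=> Op hw; exact: (has_partialsM hw (test_has_partials p tp)).
pose X1 q := - v q * phi q; pose X2 q := u q * phi q.
have e0 p : ~ Omega p -> u p * dy phi p - v p * dx phi p = 0.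
  have alg (x y m n : R) : m = 0 -> n = 0 -> x * n - y * m = 0 by move=> -> ->; ring.
  by move=> np; exact: alg (test_out (test_dx tp) np) (test_out (test_dy tp) np).
have hc p : exists a b c e, [/\ has_partials X1 p a b, has_partials X2 p c e &
    a + e = u p * dy phi p - v p * dx phi p].
  have [Op|np] := pselect (Omega p).
    have [a [b [H1 H2]]] := analytic_partials af Op.
    have alg (x y m n c : R) : - y * m + c * - - b + (x * n + c * - b) = x * n - y * m by ring.
    do 4 eexists; split; [exact: (P _ _ _ _ Op (has_partialsN H2))|exact: (P _ _ _ _ Op H1)|exact: alg].
  exists 0, 0, 0, 0; split; [exact: test_mul_out|exact: test_mul_out|].
  by rewrite addr0; exact: esym (e0 p np).
have cE p : dx X1 p + dy X2 p = u p * dy phi p - v p * dx phi p.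
  by have [a [b [c [e [[_ [-> _]] [_ [_ ->]]]]]]] := hc p.
have cc : continuous (fun p => dx X1 p + dy X2 p).
  have -> : (fun p => dx X1 p + dy X2 p) = (fun p => u p * dy phi p - v p * dx phi p) by exact/funext.
  have c1 : continuous (fun p => u p * dy phi p).
    by apply: test_mul_continuous (test_dy tp) => p /(analytic_continuous af)[].
  have c2 : continuous (fun p => v p * dx phi p).
    by apply: test_mul_continuous (test_dx tp) => p /(analytic_continuous af)[].
  by move=> p; apply: cvgB; [exact: c1|exact: c2].
have d1 p : differentiable X1 p by have [a [b [c [e [[d _] _ _]]]]] := hc p.
have d2 p : differentiable X2 p by have [a [b [c [e [_ [d _] _]]]]] := hc p.
have far p : M < `|p| -> phi p = 0.
  by move=> Mp; apply: K0 => /KM; rewrite /box /= subr0 leNgt Mp.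
rewrite -(I2_restrict pmsetT mO (@subsetT _ _) (fun p _ => e0 p)).
rewrite -(divergence_integral0 d1 d2 cc (M := M)).
- by apply: eq_I2 => p _; rewrite cE.
- by move=> p /far; rewrite /X1 => ->; rewrite mulr0.
- by move=> p /far; rewrite /X2 => ->; rewrite mulr0.
Qed.

End BergmanForms.

Section BergmanSpace.
Context {R : realType}.
Local Open Scope complex_scope.
Local Notation P2 := (measurableTypeR R * measurableTypeR R)%type.
Local Notation mu := (@lebesgue_measure R).
Local Notation normc := (@Normc.normc R).
Variable Omega : set (R * R).
Hypothesis oO : open Omega.
Let mO : pmset Omega := open_pmset oO.
Implicit Types (f : R[i] -> R[i]) (w k : @Defs.form R) (h phi psi : R * R -> R).

Lemma normc_sq z : normc z ^+ 2 = complex.Re z ^+ 2 + complex.Im z ^+ 2.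
Proof. by case: z => x y /=; rewrite sqr_sqrtr// addr_ge0 ?sqr_ge0. Qed.

Lemma normc_re_form f p : normc (f (toC p)) ^+ 2 = (re_form f).1 p ^+ 2 + (re_form f).2 p ^+ 2.
Proof. by rewrite normc_sq /= sqrrN. Qed.

Lemma bergman_norm_re_form f : bergman_norm Omega f = form_norm Omega (re_form f).
Proof. by congr Num.sqrt; apply: eq_I2 => p _; exact: normc_re_form. Qed.

Lemma bergman_analytic f : bergman Omega f -> analytic Omega f.
Proof. by case. Qed.

Lemma bergman_L21c f : bergman Omega f -> L21c Omega (re_form f).
Proof.
move=> [af fin].
have c1 p : Omega p -> {for p, continuous (re_form f).1} by move=> /(analytic_continuous af)[].
have c2 p : Omega p -> {for p, continuous (re_form f).2} by move=> /(analytic_continuous af)[].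
have m1 : pmfun Omega (re_form f).1 by exact: continuous_pmfun.
have m2 : pmfun Omega (re_form f).2 by exact: continuous_pmfun.
have E : (\int[@lambda2 R]_(p in Omega) (normc (f (toC p)) ^+ 2)%:E =
    \int[@lambda2 R]_(p in Omega) ((re_form f).1 p ^+ 2 + (re_form f).2 p ^+ 2)%:E)%E.
  by apply: eq_integral => p _; rewrite normc_re_form.
have ms : measurable_fun (T := P2) Omega (fun p => ((re_form f).1 p ^+ 2 + (re_form f).2 p ^+ 2)%:E).
  by apply/measurable_EFinP; apply: measurable_funD; exact: measurable_funX.
have le h : pmfun Omega h -> (forall p, h p ^+ 2 <= (re_form f).1 p ^+ 2 + (re_form f).2 p ^+ 2) -> L2_on Omega h.
  move=> mh hle; split => //; apply: le_lt_trans fin; rewrite E.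
  apply: ge0_le_integral => //.
  - by move=> p _; rewrite lee_fin sqr_ge0.
  - exact: measurable_sq.
  - by move=> p _; rewrite lee_fin.
split.
- by apply: le => // p; rewrite lerDl sqr_ge0.
- by apply: le => // p; rewrite lerDr sqr_ge0.
- exact: (analytic_weak_closed oO af).
Qed.

(** The function [f = k.1 - i * k.2], for which [k] is the real part of [f dz]. *)
Definition form_fun k (z : R[i]) : R[i] :=
  k.1 (complex.Re z, complex.Im z) +i* - k.2 (complex.Re z, complex.Im z).

Lemma form_funK k : re_form (form_fun k) = k.
Proof.
case: k => k1 k2; rewrite /re_form /form_fun /=; congr (_, _); apply/funext => p /=.
  by case: p.
by rewrite opprK; case: p.
Qed.

Lemma form_fun_bergman k : L2form Omega k ->
  (forall z, Omega z -> exists a b, has_partials k.1 z a b /\ has_partials k.2 z b (- a)) ->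
  bergman Omega (form_fun k).
Proof.
move=> Lk CR; have [L1 L2] := Lk; split.
  move=> p /CR[a [b [H1 H2]]]; apply/C_derivable_partials; exists a, (- b); rewrite opprK; split.
    by have := congr1 fst (form_funK k); rewrite /= => ->.
  have -> : (fun q => complex.Im (form_fun k (toC q))) = \- k.2.
    by apply/funext => -[x y].
  by have := has_partialsN H2; rewrite opprK.
have -> : (\int[@lambda2 R]_(p in Omega) (normc (form_fun k (toC p)) ^+ 2)%:E =
    \int[@lambda2 R]_(p in Omega) ((k.1 p ^+ 2)%:E + (k.2 p ^+ 2)%:E))%E.
  by apply: eq_integral => p _; rewrite normc_re_form form_funK EFinD.
have [m1 f1] := L1; have [m2 f2] := L2.
rewrite ge0_integralD//.
- by rewrite lte_add_pinfty.
- by move=> p _; rewrite lee_fin sqr_ge0.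
- exact: measurable_sq.
- by move=> p _; rewrite lee_fin sqr_ge0.
- exact: measurable_sq.
Qed.

(** With [f = u + i v], the form [f dz] has real part [u dx - v dy] and imaginary part
    [v dx + u dy], the opposite of the [star] of the former. *)
Lemma complex_line_integralE g f : smooth_closed_curve g -> (forall t, Omega (g t)) -> analytic Omega f ->
  complex_line_integral g f = line_integral g (re_form f) +i* - line_integral g (star (re_form f)).
Proof.
move=> cg gO af.
have [v1 v2] := continuous_velocity cg.
have c1 t : {for t, continuous (fun t => (re_form f).1 (g t))}.
  by have [c _] := analytic_continuous af (gO t); exact: continuous_comp (continuous_curve cg (x := t)) c.
have c2 t : {for t, continuous (fun t => (re_form f).2 (g t))}.
  by have [_ c] := analytic_continuous af (gO t); exact: continuous_comp (continuous_curve cg (x := t)) c.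
have mI : measurable (`[0, 1]%classic : set (measurableTypeR R)) by exact: measurable_itv.
have i : mu.-integrable `[0, 1] (EFin \o (fun t => (star (re_form f)).1 (g t) * (velocity g t).1 +
    (star (re_form f)).2 (g t) * (velocity g t).2)).
  apply: continuous_compact_integrable; first exact: segment_compact.
  apply: continuous_subspaceT => t; apply: cvgD; apply: cvgM; [exact: c2|exact: v1| |exact: v2].
  by apply: cvgN; exact: c1.
have N : - line_integral g (star (re_form f)) = \int[mu]_(t in `[0, 1])
    (-1 * ((star (re_form f)).1 (g t) * (velocity g t).1 + (star (re_form f)).2 (g t) * (velocity g t).2)).
  by rewrite (RintegralZl _ mI i) mulN1r.
rewrite N /complex_line_integral /line_integral; congr (_ +i* _); apply: eq_Rintegral => t _ /=.
  by case: (f _) => x y /=; rewrite mulNr.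
by case: (f _) => x y /=; ring.
Qed.

End BergmanSpace.

(** * Comparison of the bounds *)

Section HoledDisc.
Context {R : realType} {I : countType}.

Lemma unit_disc_sub_box : @unit_disc R `<=` box 0 1.
Proof.
move=> [x y]; rewrite /unit_disc /box /= subr0 /Num.norm /= => xy.
have H (u v : R) : u ^+ 2 + v ^+ 2 < 1 -> `|u| <= 1.
  move=> uv; rewrite -(@ler_pXn2r _ 2) ?nnegrE// real_normK ?num_real// expr1n.
  by have := sqr_ge0 v; lra.
by rewrite ge_max (H _ _ xy) (H y x)// addrC.
Qed.

Lemma open_unit_disc : open (@unit_disc R).
Proof.
have cf : continuous (fun p : R * R => p.1 * p.1 + p.2 * p.2).
  by move=> p; apply: cvgD; apply: cvgM; solve [exact: cvg_fst|exact: cvg_snd].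
have -> : @unit_disc R = (fun p : R * R => p.1 * p.1 + p.2 * p.2) @^-1` [set x | x < 1].
  by apply/funext => p; rewrite /unit_disc /= !expr2.
by apply: open_comp; [move=> p _; exact: cf|exact: open_lt].
Qed.

(** An infinite union of holes could fail to be closed, but only finitely many meet a given box
    inside the disc. *)
Lemma open_holed_disc (B : I -> set (R * R)) : regular_holes B -> open (holed_disc B).
Proof.
move=> [hB _ fB]; rewrite openE => p [pD pB].
have [r r0 Dr] := open_box open_unit_disc pD.
have /fB/(_ Dr) fin := @compact_box _ p r.
pose F := [set j | box p r `&` B j !=set0].
have cF : closed (\bigcup_(j in F) B j).
  apply: closed_bigcup => // j _; have [cB _ _ _ _] := hB j.
  exact: (compact_closed (@norm_hausdorff _ _) cB).
have oF := closed_openC cF.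
have pF : (~` \bigcup_(j in F) B j) p by move=> [j _ Bj]; apply: pB; exists j.
have := open_nbhs_nbhs (conj oF pF); have bp : nbhs p (box p r).
  by apply/nbhs_ballP; exists r => // q; rewrite /box -ball_normE /= distrC => /ltW.
apply: filterS2 bp => q qp qF; split; first exact: Dr.
by move=> [j _ Bj]; apply: qF; exists j => //; exists q.
Qed.

End HoledDisc.

Section SquareSums.
Context {R : realType} {I : countType}.
Local Open Scope complex_scope.

Definition sqsum (x : I -> R) : \bar R := (\esum_(j in setT) (x j ^+ 2)%:E)%E.

Lemma sqsum_ge0 x : (0 <= sqsum x)%E.
Proof. by apply: esum_ge0 => j _; rewrite lee_fin sqr_ge0. Qed.

(** A bound on [ell2_norm] alone says nothing for a divergent sum, which [fine] sends to 0; joined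
    with membership it is one inequality between extended reals. *)
Lemma ell2_bound (K : Type) (absK : K -> R) (a : I -> K) (b : R) : 0 <= b ->
  (ell2 absK a /\ ell2_norm absK a <= b) <->
  (\esum_(j in setT) (absK (a j) ^+ 2)%:E <= (b ^+ 2)%:E)%E.
Proof.
move=> b0; rewrite /ell2 /ell2_norm /=.
have : (0 <= \esum_(j in setT) (absK (a j) ^+ 2)%:E)%E by apply: esum_ge0 => j _; rewrite lee_fin sqr_ge0.
case: (esum _ _) => [s s0|_|//]; last by split => // -[].
rewrite /= !lee_fin; rewrite lee_fin in s0; split=> [[_ sb]|sb].
  by rewrite -(sqr_sqrtr s0) ler_sqr ?nnegrE ?sqrtr_ge0.
by rewrite ltry -ler_sqr ?nnegrE ?sqrtr_ge0// sqr_sqrtr.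
Qed.

Lemma esum_abs_sq (x : I -> R) : (\esum_(j in setT) (`|x j| ^+ 2)%:E = sqsum x)%E.
Proof. by apply: eq_esum => j _; rewrite real_normK ?num_real. Qed.

Lemma esum_normc_sq (a : I -> R[i]) : (\esum_(j in setT) (Normc.normc (a j) ^+ 2)%:E =
  sqsum (fun j => complex.Re (a j)) + sqsum (fun j => complex.Im (a j)))%E.
Proof.
rewrite -esumD => [|j _|j _]; try by rewrite lee_fin sqr_ge0.
by apply: eq_esum => j _; rewrite normc_sq EFinD.
Qed.

End SquareSums.

Section Comparison.
Context {R : realType} {I : countType}.
Local Open Scope complex_scope.
Local Notation normc := (@Normc.normc R).
Variable Omega : set (R * R).
Hypothesis oO : open Omega.
Hypothesis bO : Omega `<=` box 0 1.
Variable gamma : I -> R -> R * R.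
Hypothesis cgamma : forall j, smooth_closed_curve (gamma j).
Hypothesis gammaO : forall j t, Omega (gamma j t).
Variable s : I -> R.
Hypothesis fs : forall j, fine_scale (gamma j) Omega (s j).
Implicit Types (w k : @Defs.form R) (f : R[i] -> R[i]).
Local Notation J := (J gamma s).
Local Notation "<| w , v |>" := (fip Omega w v) (at level 0).
Local Notation Per := (fun w j => period Omega (gamma j) w).
Local Notation PerA := (fun f j => complex_line_integral (gamma j) f).

(** Multiplication by i rotates the real form, so [star (re_form f)] is closed for the same reason
    as [re_form f]. *)
Lemma bergman_mul_i f : bergman Omega f -> bergman Omega (fun z => 'i%C * f z).
Proof.
move=> [af fin].
have ni : normc 'i%C = 1 by rewrite /= expr0n expr1n add0r sqrtr1.
split.
  move=> p /af/C_derivableP[l H]; apply/C_derivableP; exists ('i%C * l) => e /H[d d0 Hd].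
  exists d => // h /Hd; apply: le_trans.
  by rewrite -mulrA -!mulrBr Normc.normcM ni mul1r.
by under eq_integral do rewrite Normc.normcM ni mul1r.
Qed.

Lemma re_form_mul_i f : re_form (fun z => 'i%C * f z) = star (re_form f).
Proof.
rewrite /re_form /star /=; congr (_, _); apply/funext => p; case: (f _) => x y /=.
  by rewrite mul0r mul1r sub0r.
by rewrite mul0r mul1r add0r.
Qed.

Lemma bergman_star_L21c f : bergman Omega f -> L21c Omega (star (re_form f)).
Proof.
by move=> bf; rewrite -re_form_mul_i; apply: bergman_L21c => //; exact: bergman_mul_i.
Qed.

Lemma PerE w j : L21c Omega w -> Per w j = <|w, J j|> / mass.
Proof. exact: (period_fip oO bO (cgamma j) (gammaO j) (fs j)). Qed.

(** The left side is an ordinary integral, the right side is made of periods defined by continuity;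
    both reduce to scalar products with [J j]. *)
Lemma PerAE f j : bergman Omega f ->
  PerA f j = Per (re_form f) j +i* - Per (star (re_form f)) j.
Proof.
move=> bf; have af := bergman_analytic bf; have aif := bergman_analytic (bergman_mul_i bf).
have c1 := bergman_L21c oO bf; have c2 := bergman_star_L21c bf.
rewrite /= (complex_line_integralE (cgamma j) (gammaO j) af) !PerE//.
congr (_ +i* - _).
  by apply: (line_integral_fip oO bO (cgamma j) (gammaO j) (fs j) c1) => p /(analytic_continuous af)[].
apply: (line_integral_fip oO bO (cgamma j) (gammaO j) (fs j) c2) => p Op;
  by have := analytic_continuous aif Op; rewrite re_form_mul_i => -[].
Qed.

Lemma form_norm_sq w : form_norm Omega w ^+ 2 = <|w, w|>.
Proof. by rewrite form_normE sqr_sqrtr// fip_ge0. Qed.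

(** The hypothesis on the products says that [w - k] is orthogonal to [k]. *)
Lemma projection_le w k : L2form Omega w -> L2form Omega k -> <|w, k|> = <|k, k|> ->
  <|k, k|> <= <|w, w|>.
Proof.
move=> Lw Lk wk; have := fip_ge0 Omega (flin (-1) k w).
by rewrite (ip_lin2 (flin_L2 oO) (@fipC _ Omega) (fip_lin oO) (-1) Lk Lw) (fipC _ k) wk; lra.
Qed.

(** The projection keeps the periods of [w], has a [star] without periods, whence real values, and
    does not increase the norm. *)
Lemma harmonic_part_bergman w : L21c Omega w -> exists f,
  [/\ bergman Omega f, forall j, PerA f j = (Per w j)%:C & <|re_form f, re_form f|> <= <|w, w|>].
Proof.
move=> cw; have [k [[ck csk] CR kJ skJ [_ wk]]] := harmonic_part oO bO cgamma fs cw.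
have Lk := L21c_L2 ck; have Lw := L21c_L2 cw.
have bk := form_fun_bergman oO Lk CR.
exists (form_fun k); rewrite form_funK; split => //.
  move=> j; rewrite (PerAE j bk) form_funK !PerE// kJ skJ mul0r oppr0 //.
exact: projection_le.
Qed.

Lemma bessel_boundP (C : R) :
  bessel_bound (fun x : R => `|x|) (L21c Omega) (form_norm Omega) Per C <->
  0 <= C /\ forall w, L21c Omega w -> (sqsum (Per w) <= (C ^+ 2 * <|w, w|>)%:E)%E.
Proof.
have n0 C' w : 0 <= C' -> 0 <= C' * form_norm Omega w by move=> C0; rewrite mulr_ge0// sqrtr_ge0.
rewrite /bessel_bound; split=> -[C0 H]; split => // w /H.
  move/(ell2_bound _ _ (n0 C w C0)).
  by rewrite esum_abs_sq exprMn form_norm_sq.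
move=> Hw; apply/(ell2_bound _ _ (n0 C w C0)).
by rewrite esum_abs_sq exprMn form_norm_sq.
Qed.

Lemma bessel_boundAP (C : R) :
  bessel_bound normc (bergman Omega) (bergman_norm Omega) PerA C <->
  0 <= C /\ forall f, bergman Omega f ->
    (sqsum (fun j => complex.Re (PerA f j)) + sqsum (fun j => complex.Im (PerA f j)) <=
     (C ^+ 2 * <|re_form f, re_form f|>)%:E)%E.
Proof.
have n0 C' f : 0 <= C' -> 0 <= C' * bergman_norm Omega f by move=> C0; rewrite mulr_ge0// sqrtr_ge0.
rewrite /bessel_bound; split=> -[C0 H]; split => // f /H.
  move/(ell2_bound _ _ (n0 C f C0)).
  by rewrite esum_normc_sq bergman_norm_re_form exprMn form_norm_sq.
move=> Hw; apply/(ell2_bound _ _ (n0 C f C0)).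
by rewrite esum_normc_sq bergman_norm_re_form exprMn form_norm_sq.
Qed.

(* [k] and [star l], with the notation of the proof, are orthogonal: this is why
   passing to complex scalars does not increase the constant. *)
Lemma bessel_bound_eq (C : R) :
  bessel_bound (fun x : R => `|x|) (L21c Omega) (form_norm Omega) Per C <->
  bessel_bound normc (bergman Omega) (bergman_norm Omega) PerA C.
Proof.
split=> [/bessel_boundP[C0 H]|/bessel_boundAP[C0 H]].
  apply/bessel_boundAP; split => // f bf.
  have cw := bergman_L21c oO bf; have csw := bergman_star_L21c bf.
  set w := re_form f in cw csw *.
  (* [k] carries the real parts of the periods of [f] and [l], up to sign, the imaginary parts. *)
  have [k [[ck csk] _ kJ skJ [kker wk]]] := harmonic_part oO bO cgamma fs cw.
  have [l [[cl csl] _ lJ slJ [lker wl]]] := harmonic_part oO bO cgamma fs csw.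
  have Lw := L21c_L2 cw; have Lk := L21c_L2 ck; have Ll := L21c_L2 cl; have Lsl := L21c_L2 csl.
  have ksl : <|k, star l|> = 0 by apply: kker.
  (* [k - star l] has the same product with [w] as with itself, as a projection of [w] has; the
     minus sign reflects that [star] squares to -1. Cauchy-Schwarz concludes. *)
  have le : <|k, k|> + <|l, l|> <= <|w, w|>.
    have Le : L2form Omega (flin (-1) (star l) k) by exact: flin_L2.
    have ee : <|flin (-1) (star l) k, flin (-1) (star l) k|> = <|k, k|> + <|l, l|>.
      rewrite (ip_lin2 (flin_L2 oO) (@fipC _ Omega) (fip_lin oO) (-1) Lsl Lk) (fipC _ (star l) k) ksl fip_star2.
      by move: <|k, k|> <|l, l|> => x y; ring.
    have we : <|w, flin (-1) (star l) k|> = <|k, k|> + <|l, l|>.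
      rewrite (ip_linr (@fipC _ Omega) (fip_lin oO) (-1) Lsl Lk Lw) wk.
      by have := fip_star oO Lw Ll; rewrite wl => ->; ring.
    have := cauchy_schwarz (flin_L2 oO) (@fipC _ Omega) (fip_lin oO) (@fip_ge0 _ Omega) Lw Le.
    rewrite ee we; have := fip_ge0 Omega k; have := fip_ge0 Omega l; have := fip_ge0 Omega w.
    move: <|w, w|> <|k, k|> <|l, l|> => x y z x0 z0 y0.
    have [yz|yz] := ltP 0 (y + z); first by rewrite expr2 ler_pM2r.
    by move=> _; exact: le_trans yz x0.
  have -> : sqsum (fun j => complex.Re (PerA f j)) = sqsum (Per k).
    by apply: eq_esum => j _; rewrite (PerAE j bf) /= !PerE// kJ.
  have -> : sqsum (fun j => complex.Im (PerA f j)) = sqsum (Per l).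
    by apply: eq_esum => j _; rewrite (PerAE j bf) /= !PerE// lJ sqrrN.
  apply: (le_trans (leeD (H k ck) (H l cl))).
  by rewrite -EFinD lee_fin -mulrDr ler_wpM2l// sqr_ge0.
apply/bessel_boundP; split => // w cw.
have [f [bf Pf le]] := harmonic_part_bergman cw.
apply: (@le_trans _ _ (C ^+ 2 * <|re_form f, re_form f|>)%:E); last first.
  by rewrite lee_fin ler_wpM2l// sqr_ge0.
apply: le_trans (H f bf).
have -> : sqsum (fun j => complex.Re (PerA f j)) = sqsum (Per w).
  by apply: eq_esum => j _; rewrite (Pf j).
by rewrite leeDl// sqsum_ge0.
Qed.

Lemma norm_le_sq (C : R) (x y : R) : 0 <= C -> 0 <= x -> 0 <= y ->
  (Num.sqrt x <= C * Num.sqrt y) = (x <= C ^+ 2 * y).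
Proof.
move=> C0 x0 y0.
by rewrite -ler_sqr ?nnegrE ?mulr_ge0 ?sqrtr_ge0// exprMn !sqr_sqrtr.
Qed.

Lemma sqsum_ell2 (K : Type) (absK : K -> R) (a : I -> K) (x : R) :
  (\esum_(j in setT) (absK (a j) ^+ 2)%:E)%E = x%:E -> ell2_norm absK a = Num.sqrt x.
Proof. by rewrite /ell2_norm => ->. Qed.

(** For complex data, the real and imaginary parts are interpolated separately and projected to [k]
    and [l]. In [k + star l] the second term adds nothing to the real parts of the periods and the
    first nothing to the imaginary parts; the two are orthogonal, so the squared norms add as those
    of the data do. Conversely, real data are interpolated in the Bergman space and the real part of
    [f dz] is taken. *)
Lemma interpolation_bound_eq (C : R) :
  interpolation_bound (fun x : R => `|x|) (L21c Omega) (form_norm Omega) Per C <->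
  interpolation_bound normc (bergman Omega) (bergman_norm Omega) PerA C.
Proof.
split=> -[C0 H]; split => // a.
  rewrite /ell2 /= esum_normc_sq => fin.
  have := sqsum_ge0 (fun j => complex.Re (a j)); have := sqsum_ge0 (fun j => complex.Im (a j)).
  move: fin; case E1 : (sqsum (fun j => complex.Re (a j))) => [x| |] //;
    case E2 : (sqsum (fun j => complex.Im (a j))) => [y| |] // _.
  rewrite !lee_fin => y0 x0.
  have e1 : ell2 (fun x : R => `|x|) (fun j => complex.Re (a j)).
    by rewrite /ell2 /= esum_abs_sq E1 ltry.
  have e2 : ell2 (fun x : R => `|x|) (fun j => complex.Im (a j)).
    by rewrite /ell2 /= esum_abs_sq E2 ltry.
  have n1 : ell2_norm (fun x : R => `|x|) (fun j => complex.Re (a j)) = Num.sqrt x.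
    by apply: sqsum_ell2; rewrite esum_abs_sq.
  have n2 : ell2_norm (fun x : R => `|x|) (fun j => complex.Im (a j)) = Num.sqrt y.
    by apply: sqsum_ell2; rewrite esum_abs_sq.
  have n3 : ell2_norm normc a = Num.sqrt (x + y).
    by apply: sqsum_ell2; rewrite esum_normc_sq E1 E2.
  have [w1 [c1 P1 N1]] := H _ e1; have [w2 [c2 P2 N2]] := H _ e2.
  have [k [[ck csk] kCR kJ skJ [kker wk]]] := harmonic_part oO bO cgamma fs c1.
  have [l [[cl csl] lCR lJ slJ [lker wl]]] := harmonic_part oO bO cgamma fs c2.
  have Lw1 := L21c_L2 c1; have Lw2 := L21c_L2 c2.
  have Lk := L21c_L2 ck; have Ll := L21c_L2 cl; have Lsl := L21c_L2 csl; have Lsk := L21c_L2 csk.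
  pose m := flin 1 k (star l).
  have cm : L21c Omega m by exact: L21c_lin.
  have Lm := L21c_L2 cm.
  have mCR z : Omega z -> exists a b, has_partials m.1 z a b /\ has_partials m.2 z b (- a).
    move=> Oz; have [a1 [b1 [k1 k2]]] := kCR z Oz; have [a2 [b2 [l1 l2]]] := lCR z Oz.
    exists (a1 + b2), (b1 + - a2).
    have -> : m.1 = k.1 \+ l.2 by apply/funext => p /=; rewrite mul1r.
    have -> : m.2 = k.2 \+ (\- l.1) by apply/funext => p /=; rewrite mul1r.
    split; first exact: has_partialsD.
    by rewrite opprD; apply: has_partialsD => //; exact: has_partialsN.
  have bm := form_fun_bergman oO Lm mCR.
  exists (form_fun m); split => //.
    apply/funext => j.
    have := congr1 (fun F => F j) P1; have := congr1 (fun F => F j) P2 => /=.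
    have -> : PerA (form_fun m) j = Per w1 j +i* Per w2 j.
      have csm := bergman_star_L21c bm; move: csm.
      rewrite (PerAE j bm) form_funK => csm; rewrite !PerE//.
      have LJ := J_L2 oO bO cgamma fs j.
      have -> : <|m, J j|> = <|w1, J j|>.
        by rewrite (fip_lin oO 1 Lk Lsl LJ) slJ addr0 mul1r kJ.
      have -> : <|star m, J j|> = - <|w2, J j|>.
        rewrite (fip_star oO Lm LJ) (fip_lin oO 1 Lk Lsl (star_L2 oO LJ)) fip_star2 lJ.
        by rewrite (kker _ (star_J_kernel oO bO cgamma fs j)) mulr0 add0r.
      by rewrite mulNr opprK.
    by move=> -> ->; case: (a j).
  rewrite bergman_norm_re_form form_funK form_normE n3 norm_le_sq ?fip_ge0 ?addr_ge0//.
  have -> : <|m, m|> = <|k, k|> + <|l, l|>.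
    rewrite (ip_lin2 (flin_L2 oO) (@fipC _ Omega) (fip_lin oO) 1 Lk Lsl) fip_star2.
    have -> : <|k, star l|> = 0 by apply: kker.
    by rewrite mulr0 addr0 expr1n mul1r.
  have k_le := projection_le Lw1 Lk wk; have l_le := projection_le Lw2 Ll wl.
  rewrite form_normE n1 norm_le_sq ?fip_ge0// in N1; rewrite form_normE n2 norm_le_sq ?fip_ge0// in N2.
  by rewrite mulrDr; exact: lerD (le_trans k_le N1) (le_trans l_le N2).
move=> fin.
have := sqsum_ge0 a; move: fin; rewrite /ell2 /= esum_abs_sq; case E : (sqsum a) => [x| |] // _ x0.
have z0 : sqsum (fun j : I => complex.Im (a j)%:C) = 0%E.
  by apply: esum1 => j _; rewrite /= expr0n.
have Ea : (\esum_(j in setT) (normc ((a j)%:C) ^+ 2)%:E = x%:E)%E.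
  by rewrite esum_normc_sq z0 adde0.
have ea : ell2 normc (fun j => (a j)%:C) by rewrite /ell2 /= Ea ltry.
have [f [bf Pf Nf]] := H _ ea; exists (re_form f); split.
- exact: bergman_L21c.
- apply/funext => j; have e : complex_line_integral (gamma j) f = (a j)%:C := congr1 (fun F : I -> R[i] => F j) Pf.
  by have := congr1 (@complex.Re R) e; rewrite (PerAE j bf).
- by rewrite -bergman_norm_re_form (sqsum_ell2 (x := x)) ?esum_abs_sq// -(sqsum_ell2 Ea).
Qed.

End Comparison.

Theorem proposition1p7 (R : realType) (I : countType)
    (B : I -> set (R * R)%type) (gamma : I -> R -> (R * R)%type)
    (hB : regular_holes B) (hgamma : hole_curves B gamma) :
  ((bessel_L B gamma <-> bessel_A B gamma) /\ C_B B gamma = C_BA B gamma) /\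
  ((interpolation_L B gamma <-> interpolation_A B gamma) /\
   C_I B gamma = C_IA B gamma).
Proof.
have oO := open_holed_disc hB.
have bO : holed_disc B `<=` box 0 1 by move=> p [/unit_disc_sub_box].
have cgamma j : smooth_closed_curve (gamma j) by have [] := hgamma j.
have gammaO j t : holed_disc B (gamma j t) by have [] := hgamma j.
have [s fs] := exists_fine_scales oO cgamma gammaO.
(* Both spaces admit the same bounds [C], so the properties are equivalent and the infima agree,
   also when there is no bound. *)
have bessel_eq C := bessel_bound_eq oO bO cgamma gammaO fs C.
have interp_eq C := interpolation_bound_eq oO bO cgamma gammaO fs C.
split; split.
- by split=> -[C /bessel_eq HC]; exists C.
- by congr ereal_inf; apply/seteqP; split => _ [C /bessel_eq HC <-]; exists C.
- by split=> -[C /interp_eq HC]; exists C.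
- by congr ereal_inf; apply/seteqP; split => _ [C /interp_eq HC <-]; exists C.
Qed.
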